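(* Let $\Sigma^2$ be a Riemann surface, and let $g$ and $\omega$ be a meromorphic function and a holomorphic 1-form on $\Sigma^2$, respectively. Suppose that the pair $(g,\omega)$ satisfies the following two conditions. (C) $g\omega$ is holomorphic, while $\omega$ and $g\omega$ have no common zeros. (P) For any closed curve $\gamma$ on $\Sigma^2$, $\mathrm{Re}\oint_\gamma g\omega=0$ and $\oint_\gamma\omega=0$ hold. Then the map $f\colon\Sigma^2\to\mathbb{I}^3$ defined by $$f:=\mathrm{Re}\int(g,1,-i)\,\omega$$ is a ZMC-face. Conversely, any ZMC-face can be represented in this way, i.e. by some pair $(g,\omega)$ satisfying (C) and (P).
   Context: Isotropic 3-space $\mathbb{I}^3$ is $\mathbb{R}^3$ with coordinates $(t,x,y)$ and the degenerate inner product $\langle(t_1,x_1,y_1),(t_2,x_2,y_2)\rangle=x_1x_2+y_1y_2$. Riemann surfaces are connected. Let $\pi\colon\tilde\Sigma^2\to\Sigma^2$ be the universal cover. A map $f\colon\Sigma^2\to\mathbb{I}^3$ is a ZMC-face if there exists a holomorphic immersion $F=(F^0,F^1,F^2)\colon\tilde\Sigma^2\to\mathbb{C}^3$ such that $(dF^1)^2+(dF^2)^2=0$, $F^1$ is non-constant, and $f\circ\pi=\mathrm{Re}(F)$; $F$ is called the holomorphic lift of $f$. The null condition means $dF^1-i\,dF^2=0$ or $dF^1+i\,dF^2=0$; standing convention: only ZMC-faces whose holomorphic lift satisfies $dF^1-i\,dF^2=0$ are considered (the other case is reduced to this by the reflection $y\mapsto-y$). The integral is taken from a fixed base point and is determined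 up to an additive constant. *)

(* Defs.v *)
From HB Require Import structures.
From mathcomp Require Import all_boot all_order all_algebra.
From mathcomp Require Import complex.
From mathcomp Require Import all_classical all_reals all_analysis.

Set Implicit Arguments.
Unset Strict Implicit.
Unset Printing Implicit Defensive.

Import Order.TTheory GRing.Theory Num.Theory.
Import numFieldNormedType.Exports.

Local Open Scope classical_set_scope.
Local Open Scope complex_scope.
Local Open Scope ring_scope.

(* R[i] seen as a numFieldType, so that it carries the normed space structure
   over itself provided by [numFieldNormedType]; [derivable] and [derive1]
   below are thus complex differentiability and the complex derivative. *)
Definition Cplx (R : realType) : numFieldType := R[i].

(** * Riemann surfaces *)

(* A complex chart is a homeomorphism from the open set [dom] onto an open
   subset of C.  The values of [toC] and [ofC] elsewhere are irrelevant. *)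
Record chart (R : realType) (T : topologicalType) := Chart {
  dom : set T;
  toC : T -> Cplx R;
  ofC : Cplx R -> T;
  dom_open : open dom;
  img_open : open (toC @` dom);
  ofCK : {in dom, cancel toC ofC};
  toC_continuous : {in dom, continuous toC};
  ofC_continuous : {in toC @` dom, continuous ofC}
}.

(* The atlas is not required to be maximal. *)
Record riemannSurface (R : realType) := RiemannSurface {
  points :> topologicalType;
  atlas : set (chart R points);
  points_hausdorff : hausdorff_space points;
  points_nonempty : [set: points] !=set0;
  points_connected : connected [set: points];
  atlas_cover : forall p : points, exists phi, atlas phi /\ dom phi p;
  atlas_compatible : forall phi psi, atlas phi -> atlas psi ->
    forall p, dom phi p -> dom psi p ->
    derivable (toC psi \o ofC phi) (toC phi p) 1
}.

Definition chart_at (R : realType) (S : riemannSurface R) (p : S) :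
  chart R S := projT1 (cid (atlas_cover p)).

Definition holomorphic_at (R : realType) (S : riemannSurface R)
    (h : S -> Cplx R) (p : S) : Prop :=
  forall phi, atlas phi -> dom phi p ->
    \forall z \near toC phi p, derivable (h \o ofC phi) z 1.

Definition holomorphic (R : realType) (S : riemannSurface R)
    (h : S -> Cplx R) : Prop := forall p, holomorphic_at h p.

Definition holomorphic_map_on (R : realType) (S S' : riemannSurface R)
    (U : set S) (h : S -> S') : Prop :=
  forall p, U p -> {for p, continuous h} /\
    forall phi psi, atlas phi -> atlas psi -> dom phi p -> dom psi (h p) ->
      derivable (toC psi \o h \o ofC phi) (toC phi p) 1.

(* A meromorphic function, with [None] for the value oo: the poles form a
   closed set of isolated points, off which g is holomorphic, and |g| tends
   to oo at each of them. *)
Definition finite_part (R : realType) (S : Type) (g : S -> option (Cplx R)) :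
  S -> Cplx R := fun p => odflt 0 (g p).

Definition poles (R : realType) (S : Type) (g : S -> option (Cplx R)) : set S :=
  [set p | g p = None].

Definition meromorphic (R : realType) (S : riemannSurface R)
    (g : S -> option (Cplx R)) : Prop :=
  [/\ closed (poles g),
      forall p, ~ poles g p -> holomorphic_at (finite_part g) p &
      forall p, poles g p ->
        (\forall q \near p^', ~ poles g q) /\
        (forall M : R, \forall q \near p^', M%:C <= `|finite_part g q|)].

(** * Holomorphic 1-forms *)

(* [w phi p] is the coefficient at p of the (1,0)-form w with respect to
   dz, where z = [toC phi]; it is meaningful for phi in the atlas and p in
   its domain. *)
Definition one_form (R : realType) (S : riemannSurface R) : Type :=
  chart R S -> S -> Cplx R.

Definition holomorphic_form (R : realType) (S : riemannSurface R)
    (w : one_form S) : Prop :=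
  (forall phi psi, atlas phi -> atlas psi ->
     forall p, dom phi p -> dom psi p ->
     w phi p = w psi p * derive1 (toC psi \o ofC phi) (toC phi p)) /\
  (forall phi, atlas phi -> forall p, dom phi p ->
     derivable (w phi \o ofC phi) (toC phi p) 1).

Definition differential (R : realType) (S : riemannSurface R)
    (h : S -> Cplx R) : one_form S :=
  fun phi p => derive1 (h \o ofC phi) (toC phi p).

Definition scale_form (R : realType) (S : riemannSurface R)
    (a : Cplx R) (w : one_form S) : one_form S := fun phi p => a * w phi p.

(* The product g w; at a pole of g its coefficient is the limit of the
   coefficients at nearby points, so that [holomorphic_form (mul_form g w)]
   says that the singularities of g w at the poles of g are removable. *)
Definition mul_form (R : realType) (S : riemannSurface R)
    (g : S -> option (Cplx R)) (w : one_form S) : one_form S :=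
  fun phi p => if g p is Some c then c * w phi p
    else lim (finite_part g q * w phi q @[q --> p^']).

(** * Curves and line integrals *)

Definition C1_at (R : realType) (S : riemannSurface R)
    (c : R -> S) (t : R) : Prop :=
  {for t, continuous c} /\
  forall phi, atlas phi -> dom phi (c t) ->
  forall part : Cplx R -> R, part = @complex.Re R \/ part = @complex.Im R ->
    (\forall s \near t, derivable (part \o toC phi \o c : R -> R) s 1) /\
    {for t, continuous (derive1 (part \o toC phi \o c : R -> R))}.

(* C1 on the closed interval [a, b]: restriction of a curve that is C1 on a
   neighbourhood of [a, b]. *)
Definition C1_arc (R : realType) (S : riemannSurface R)
    (c : R -> S) (a b : R) : Prop :=
  exists c' : R -> S, forall t, a <= t <= b -> c' t = c t /\ C1_at c' t.

(* Curves are parametrized by [0, 1]; values outside are irrelevant.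
   [0 :: s] is the list of the subdivision points. *)
Definition piecewise_C1 (R : realType) (S : riemannSurface R)
    (c : R -> S) : Prop :=
  exists s : seq R, [/\ path <%R 0 s, last 0 s = 1 &
    forall k, (k < size s)%N -> C1_arc c (nth 0 (0 :: s) k) (nth 0 s k)].

Definition velocity (R : realType) (u : R -> Cplx R) (t : R) : Cplx R :=
  derive1 (@complex.Re R \o u : R -> R) t +i*
  derive1 (@complex.Im R \o u : R -> R) t.

Definition integral01 (R : realType) (u : R -> Cplx R) : Cplx R :=
  (\int[lebesgue_measure]_(t in `[0, 1]) complex.Re (u t)) +i*
  (\int[lebesgue_measure]_(t in `[0, 1]) complex.Im (u t)).

(* By the transformation law in [holomorphic_form], the integrand does not
   depend on which chart of the atlas around c t is used. *)
Definition line_integral (R : realType) (S : riemannSurface R)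
    (c : R -> S) (w : one_form S) : Cplx R :=
  integral01 (fun t => w (chart_at (c t)) (c t) *
                       velocity (toC (chart_at (c t)) \o c) t).

(** * The universal cover *)

Definition simply_connected (R : realType) (S : riemannSurface R) : Prop :=
  forall c : R -> S, {within `[0, 1], continuous c} -> c 0 = c 1 ->
  exists H : R * R -> S,
    [/\ {within `[0, 1] `*` `[0, 1], continuous H},
        forall t : R, 0 <= t <= 1 -> H (0, t) = c t,
        forall t : R, 0 <= t <= 1 -> H (1, t) = c 0 &
        forall s : R, 0 <= s <= 1 -> H (s, 0) = c 0 /\ H (s, 1) = c 0].

(* The sheets over an evenly covered open set U are mapped biholomorphically
   onto U, i.e. the complex structure upstairs is the lifted one. *)
Definition evenly_covered (R : realType) (S' S : riemannSurface R)
    (pr : S' -> S) (U : set S) : Prop :=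
  exists sheets : set (set S'),
    [/\ forall V, sheets V -> open V,
        forall V W, sheets V -> sheets W -> V `&` W !=set0 -> V = W,
        pr @^-1` U = \bigcup_(V in sheets) V &
        forall V, sheets V -> exists sec : S -> S',
          [/\ forall q, U q -> V (sec q) /\ pr (sec q) = q,
              forall x, V x -> sec (pr x) = x &
              holomorphic_map_on U sec]].

Definition universal_cover (R : realType) (S' S : riemannSurface R)
    (pr : S' -> S) : Prop :=
  [/\ simply_connected S',
      holomorphic_map_on [set: S'] pr,
      forall q, exists x, pr x = q &
      forall q, exists U, [/\ open U, U q & evenly_covered pr U]].

(** * ZMC-faces *)

(* Isotropic 3-space is 'rV[R]_3, with coordinates (t, x, y) numbered 0, 1, 2;
   its degenerate inner product does not occur in the definition of a
   ZMC-face. *)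

Definition component (R : realType) (S : riemannSurface R)
    (F : S -> 'rV[Cplx R]_3) (k : 'I_3) : S -> Cplx R := fun p => F p 0 k.

Definition holomorphic_immersion (R : realType) (S : riemannSurface R)
    (F : S -> 'rV[Cplx R]_3) : Prop :=
  (forall k, holomorphic (component F k)) /\
  (forall p phi, atlas phi -> dom phi p ->
     injective (fun v : Cplx R =>
       v *: \row_k differential (component F k) phi p)).

Definition holomorphic_lift (R : realType) (S' S : riemannSurface R)
    (pr : S' -> S) (f : S -> 'rV[R]_3) (F : S' -> 'rV[Cplx R]_3) : Prop :=
  [/\ holomorphic_immersion F,
      forall p phi, atlas phi -> dom phi p ->
        differential (component F 1) phi p ^+ 2 +
        differential (component F 2) phi p ^+ 2 = 0,
      exists p q, component F 1 p != component F 1 q &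
      forall p, f (pr p) = \row_k complex.Re (F p 0 k)].

Definition ZMC_face (R : realType) (S' S : riemannSurface R)
    (pr : S' -> S) (f : S -> 'rV[R]_3) : Prop :=
  exists F, holomorphic_lift pr f F.

(* The ZMC-faces selected by the sign convention dF^1 - i dF^2 = 0.  Lifts of
   f differ by constants, so the convention holds for all or none of them. *)
Definition oriented_ZMC_face (R : realType) (S' S : riemannSurface R)
    (pr : S' -> S) (f : S -> 'rV[R]_3) : Prop :=
  ZMC_face pr f /\
  forall F, holomorphic_lift pr f F ->
    forall p phi, atlas phi -> dom phi p ->
      differential (component F 1) phi p -
      'i%C * differential (component F 2) phi p = 0.

(** * Weierstrass data *)

Definition condition_C (R : realType) (S : riemannSurface R)
    (g : S -> option (Cplx R)) (w : one_form S) : Prop :=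
  holomorphic_form (mul_form g w) /\
  forall p phi, atlas phi -> dom phi p ->
    ~ (w phi p = 0 /\ mul_form g w phi p = 0).

Definition condition_P (R : realType) (S : riemannSurface R)
    (g : S -> option (Cplx R)) (w : one_form S) : Prop :=
  forall c : R -> S, piecewise_C1 c -> c 0 = c 1 ->
    complex.Re (line_integral c (mul_form g w)) = 0 /\ line_integral c w = 0.

Definition weierstrass_forms (R : realType) (S : riemannSurface R)
    (g : S -> option (Cplx R)) (w : one_form S) : 'I_3 -> one_form S :=
  tnth [tuple mul_form g w; w; scale_form (- 'i%C) w].

(* f = Re \int (g, 1, -i) w, integrated from the base point p0, with additive
   constant a; the value must be the same along every curve from p0. *)
Definition is_weierstrass_map (R : realType) (S : riemannSurface R)
    (g : S -> option (Cplx R)) (w : one_form S) (p0 : S) (a : 'rV[R]_3)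
    (f : S -> 'rV[R]_3) : Prop :=
  forall p (c : R -> S), piecewise_C1 c -> c 0 = p0 -> c 1 = p ->
    f p = a + \row_k complex.Re (line_integral c (weierstrass_forms g w k)).

(* Main.v *)
(* The derivative of a holomorphic function is determined by its real part.
   Hence the differentials dF^k of a holomorphic lift descend to S: locally dF^k
   is the differential of any holomorphic function with real part f^k.  Put
   w := dF^1.  The null condition gives dF^2 = -i w, the immersion property says
   that dF^0 and w have no common zero, g := dF^0 / w is meromorphic because the
   zeros of w are isolated, and the periods of the three forms have zero real
   part because f is single-valued.

   Conversely, (P) makes the real parts of the three integrals independent of
   the path, and the pull-backs of their local primitives to the simply connected
   cover are glued by monodromy to a holomorphic lift, an immersion by (C).

   Holomorphy means complex differentiability at each point.  Goursat's theorem
   gives local primitives; Cauchy's formula, for functions with a continuous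
   derivative, is applied first to a primitive and then to the function itself,
   and yields Taylor expansions, hence the holomorphy of derivatives and the
   isolation of zeros. *)
Require Import Defs.
From HB Require Import structures.
From mathcomp Require Import all_boot all_order all_algebra.
From mathcomp Require Import complex.
From mathcomp Require Import all_classical all_reals all_analysis.
From mathcomp Require Import measurable_realfun ring lra.

Set Implicit Arguments.
Unset Strict Implicit.
Unset Printing Implicit Defensive.

Import Order.TTheory GRing.Theory Num.Theory.
Import numFieldNormedType.Exports.

Local Open Scope classical_set_scope.
Local Open Scope complex_scope.
Local Open Scope ring_scope.

(** * The modulus of a complex number *)

Section Modulus.
Variable R : realType.
Local Notation C := (Cplx R).
Implicit Types (z w : C) (x y : R).

(** The homotopies that define simple connectedness are merely continuous, so their intermediate
    curves carry no line integral. Integration along a curve is therefore replaced by continuation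
    of germs: a function of the parameter whose increments are locally those of a local primitive.
    The notion is developed for abstract germs and applied both to primitives on the surface and to
    their pull-backs on the cover; Lebesgue integrals are tied to it once, on piecewise C1 curves.

    In the same spirit, sides of rectangles and circles are integrated through antiderivatives of
    curves, so that estimates of integrals become mean value inequalities. These inequalities,
    uniform continuity, gluing along a path and invariance under homotopy all come from one form of
    the compactness of an interval, [cousin].

    In the converse, the forms on S are defined from f alone and not from a sheet of the cover,
    which makes them independent of a choice of preimages from the start. *)

Definition rc x : C := x%:C.

Lemma rc_additive : additive rc.
Proof. by move=> a b; rewrite /rc rmorphB. Qed.
Lemma rc_multiplicative : multiplicative rc.
Proof. by split=> [a b|]; rewrite /rc ?rmorphM ?rmorph1. Qed.
HB.instance Definition _ := GRing.isAdditive.Build R C rc rc_additive.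
HB.instance Definition _ := GRing.isMultiplicative.Build R C rc rc_multiplicative.

Definition ii : C := 'i%C.

(** The norm of [Cplx R] takes its values in C; estimates are carried out with this real-valued
    copy, where the order is total. *)
Definition cmod z : R := complex.Re `|z|.

Lemma cmodE z : `|z| = rc (cmod z).
Proof. by rewrite /cmod; case: z => a b. Qed.

Lemma rc_inj : injective rc. Proof. by move=> a b []. Qed.
Lemma ler_rc x y : (rc x <= rc y) = (x <= y). Proof. exact: lecR. Qed.
Lemma ltr_rc x y : (rc x < rc y) = (x < y). Proof. exact: ltcR. Qed.

Lemma cmod_ge0 z : 0 <= cmod z.
Proof. by rewrite -ler_rc rmorph0 -cmodE. Qed.
Lemma cmodD z w : cmod (z + w) <= cmod z + cmod w.
Proof. by rewrite -ler_rc rmorphD /= -!cmodE ler_normD. Qed.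
Lemma cmodM z w : cmod (z * w) = cmod z * cmod w.
Proof. by apply: rc_inj; rewrite rmorphM /= -!cmodE normrM. Qed.
Lemma cmodN z : cmod (- z) = cmod z.
Proof. by apply: rc_inj; rewrite -!cmodE normrN. Qed.
Lemma cmodC z w : cmod (z - w) = cmod (w - z).
Proof. by rewrite -cmodN opprB. Qed.
Lemma cmod0 : cmod 0 = 0.
Proof. by apply: rc_inj; rewrite -!cmodE normr0 rmorph0. Qed.
Lemma cmod1 : cmod 1 = 1.
Proof. by apply: rc_inj; rewrite -!cmodE normr1 rmorph1. Qed.
Lemma cmod_eq0 z : (cmod z == 0) = (z == 0).
Proof. by rewrite -(inj_eq rc_inj) -cmodE rmorph0 normr_eq0. Qed.
Lemma cmod_gt0 z : (0 < cmod z) = (z != 0).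
Proof. by rewrite lt_def cmod_eq0 cmod_ge0 andbT. Qed.
Lemma cmodV z : cmod z^-1 = (cmod z)^-1.
Proof. by apply: rc_inj; rewrite fmorphV /= -!cmodE normfV. Qed.
Lemma cmodX z n : cmod (z ^+ n) = cmod z ^+ n.
Proof. by apply: rc_inj; rewrite rmorphXn /= -!cmodE normrX. Qed.
Lemma cmodB z w : cmod (z - w) <= cmod z + cmod w.
Proof. by rewrite -[cmod w]cmodN cmodD. Qed.
Lemma cmod_rc x : cmod (rc x) = `|x|.
Proof. by rewrite /cmod normc_def /= expr0n /= addr0 sqrtr_sqr. Qed.
Lemma cmod_ii : cmod ii = 1.
Proof. by rewrite /cmod normc_def /= expr0n /= add0r expr1n sqrtr1. Qed.
Lemma iiE : ii * ii = -1. Proof. by rewrite -expr2; exact: sqr_i. Qed.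
Lemma cmod_sub z w : cmod z - cmod w <= cmod (z - w).
Proof. by rewrite lerBlDr -{1}(subrK w z) cmodD. Qed.

Lemma cReD z w : complex.Re (z + w) = complex.Re z + complex.Re w.
Proof. by case: z => ? ?; case: w => ? ?. Qed.
Lemma cImD z w : complex.Im (z + w) = complex.Im z + complex.Im w.
Proof. by case: z => ? ?; case: w => ? ?. Qed.
Lemma cReN z : complex.Re (- z) = - complex.Re z. Proof. by case: z => ? ?. Qed.
Lemma cImN z : complex.Im (- z) = - complex.Im z. Proof. by case: z => ? ?. Qed.
Lemma cReB z w : complex.Re (z - w) = complex.Re z - complex.Re w.
Proof. by rewrite cReD cReN. Qed.
Lemma cImB z w : complex.Im (z - w) = complex.Im z - complex.Im w.
Proof. by rewrite cImD cImN. Qed.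
Lemma cReM z w : complex.Re (z * w) =
  complex.Re z * complex.Re w - complex.Im z * complex.Im w.
Proof. by case: z => ? ?; case: w => ? ?. Qed.
Lemma cImM z w : complex.Im (z * w) =
  complex.Re z * complex.Im w + complex.Im z * complex.Re w.
Proof. by case: z => ? ?; case: w => ? ?. Qed.
Lemma cE z : z = rc (complex.Re z) + ii * rc (complex.Im z).
Proof. exact: complexE. Qed.
Lemma cP z w : complex.Re z = complex.Re w -> complex.Im z = complex.Im w -> z = w.
Proof. by case: z => ? ?; case: w => ? ? /= -> ->. Qed.
Lemma Re_le z : `|complex.Re z| <= cmod z.
Proof.
by rewrite /cmod normc_def /= -sqrtr_sqr ler_wsqrtr // lerDl sqr_ge0.
Qed.
Lemma Im_le z : `|complex.Im z| <= cmod z.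
Proof.
by rewrite /cmod normc_def /= -sqrtr_sqr ler_wsqrtr // lerDr sqr_ge0.
Qed.
Lemma cmod_ReIm z : cmod z <= `|complex.Re z| + `|complex.Im z|.
Proof.
rewrite {1}[z]cE (le_trans (cmodD _ _)) // cmodM cmod_ii mul1r.
by rewrite !cmod_rc.
Qed.

Lemma cmod_small z : (forall e, 0 < e -> cmod z <= e) -> z = 0.
Proof.
move=> h; apply/eqP; rewrite -cmod_eq0 eq_le cmod_ge0 andbT.
by apply/ler_addgt0Pl => e /h; rewrite addr0.
Qed.

Lemma nbhs_cmod z (A : set C) :
  nbhs z A <-> exists2 d : R, 0 < d & forall w, cmod (w - z) < d -> A w.
Proof.
split=> [/nbhs_ballP[e /= e0 eA]|[d d0 dA]].
  have eE : e = rc (cmod e) by rewrite -cmodE gtr0_norm.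
  exists (cmod e); first by rewrite -ltr_rc -eE rmorph0.
  move=> w wz; apply: eA; rewrite /ball /= distrC cmodE eE.
  by rewrite ltr_rc.
apply/nbhs_ballP; exists (rc d) => /=.
  by rewrite -[X in X < _](rmorph0 rc) ltr_rc.
move=> w; rewrite /ball /= distrC cmodE ltr_rc; exact: dA.
Qed.

Lemma nbhs_abs x (A : set R) :
  nbhs x A <-> exists2 d : R, 0 < d & forall y, `|y - x| < d -> A y.
Proof.
split=> [/nbhs_ballP[e /= e0 eA]|[d d0 dA]].
  by exists e => // w wz; apply: eA; rewrite /ball /= distrC.
by apply/nbhs_ballP; exists d => //= w; rewrite /ball /= distrC; exact: dA.
Qed.

End Modulus.

(** * Complex derivatives and derivatives of curves *)

Section Calculus.
Variable R : realType.
Local Notation C := (Cplx R).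

Lemma cvgC_comp (T : Type) (F : set_system T) {FF : Filter F} (u : T -> C) (l : C) :
  u @ F --> l <-> forall e : R, 0 < e -> \forall x \near F, cmod (u x - l) < e.
Proof.
split=> [ul e e0|h].
  have : nbhs l [set z | cmod (z - l) < e] by apply/nbhs_cmod; exists e.
  exact: ul.
by move=> A /nbhs_cmod[d d0 dA]; apply: filterS (h _ d0) => x /dA.
Qed.

Lemma contCP (T : topologicalType) (u : T -> C) (t : T) :
  {for t, continuous u} <->
  forall e : R, 0 < e -> \forall x \near t, cmod (u x - u t) < e.
Proof. exact: cvgC_comp. Qed.

Lemma contRP (u : R -> C) (t : R) : {for t, continuous u} <->
  forall e : R, 0 < e -> exists2 d : R, 0 < d &
    forall s, `|s - t| < d -> cmod (u s - u t) < e.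
Proof.
split=> [/contCP h e /h /nbhs_abs //|h].
by apply/contCP => e /h ?; apply/nbhs_abs.
Qed.

Lemma contCCP (u : C -> C) (t : C) : {for t, continuous u} <->
  forall e : R, 0 < e -> exists2 d : R, 0 < d &
    forall s, cmod (s - t) < d -> cmod (u s - u t) < e.
Proof.
split=> [/contCP h e /h /nbhs_cmod //|h].
by apply/contCP => e /h ?; apply/nbhs_cmod.
Qed.

Lemma continuous_rc : continuous (@rc R).
Proof.
move=> t; apply/contRP => e e0; exists e => // s.
by rewrite -rmorphB /= cmod_rc.
Qed.

Lemma continuous_Re : continuous (@complex.Re R : C -> R).
Proof.
move=> z A /nbhs_abs[d d0 dA]; apply/nbhs_cmod; exists d => // w wz.
by apply: dA; rewrite -cReB; apply: le_lt_trans wz; exact: Re_le.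
Qed.

Lemma continuous_Im : continuous (@complex.Im R : C -> R).
Proof.
move=> z A /nbhs_abs[d d0 dA]; apply/nbhs_cmod; exists d => // w wz.
by apply: dA; rewrite -cImB; apply: le_lt_trans wz; exact: Im_le.
Qed.

(* First-order approximation [u h = a + d * i h + o(i h)] as [i h] tends to 0;
   complex derivatives take [i] to be the identity of C, derivatives of curves
   the embedding of R into C. *)
Definition dif (V : Type) (i u : V -> C) (a d : C) :=
  forall e : R, 0 < e -> exists2 r : R, 0 < r &
    forall h, cmod (i h) < r -> cmod (u h - a - d * i h) <= e * cmod (i h).

Definition cder (f : C -> C) (z d : C) := dif id (fun h => f (z + h)) (f z) d.
Definition rder (u : R -> C) (t : R) (d : C) :=
  dif (@rc R) (fun h => u (t + h)) (u t) d.

Section Dif.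
Variables (V : Type) (i : V -> C).
Implicit Types (u v : V -> C) (a b d : C).

Lemma dif_cst a : dif i (fun=> a) a 0.
Proof.
move=> e e0; exists 1 => // h _.
by rewrite subrr mul0r subrr cmod0 mulr_ge0 ?cmod_ge0 // ltW.
Qed.

Lemma dif_id a : dif i (fun h => a + i h) a 1.
Proof.
move=> e e0; exists 1 => // h _.
have -> : a + i h - a - 1 * i h = 0 by ring.
by rewrite cmod0 mulr_ge0 ?cmod_ge0 // ltW.
Qed.

Lemma dif_add u v a b d d' :
  dif i u a d -> dif i v b d' -> dif i (fun h => u h + v h) (a + b) (d + d').
Proof.
move=> hu hv e e0; have e2 : 0 < e / 2 by rewrite divr_gt0.
have [r r0 ur] := hu _ e2; have [s s0 vs] := hv _ e2.
exists (Num.min r s) => [|h]; first by rewrite lt_min r0.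
rewrite lt_min => /andP[/ur h1 /vs h2].
have -> : u h + v h - (a + b) - (d + d') * i h =
  (u h - a - d * i h) + (v h - b - d' * i h) by ring.
apply: (le_trans (cmodD _ _)); lra.
Qed.

Lemma dif_scale c u a d : dif i u a d -> dif i (fun h => c * u h) (c * a) (c * d).
Proof.
move=> hu e e0; have c0 := cmod_ge0 c.
have e2 : 0 < e / (cmod c + 1) by rewrite divr_gt0 // ltr_wpDl.
have [r r0 ur] := hu _ e2; exists r => // h /ur h1.
have -> : c * u h - c * a - c * d * i h = c * (u h - a - d * i h) by ring.
rewrite cmodM; apply: (le_trans (ler_wpM2l c0 h1)).
rewrite mulrA ler_wpM2r ?cmod_ge0 // mulrCA ler_piMr ?(ltW e0) //.
by rewrite ler_pdivrMr ?ltr_wpDl // mul1r lerDl.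
Qed.

Lemma dif_opp u a d : dif i u a d -> dif i (fun h => - u h) (- a) (- d).
Proof.
move=> /(dif_scale (-1)) h e /h[r r0 {}h]; exists r => // k /h.
by rewrite !mulN1r.
Qed.

Lemma dif_sub u v a b d d' :
  dif i u a d -> dif i v b d' -> dif i (fun h => u h - v h) (a - b) (d - d').
Proof. by move=> hu /dif_opp hv; exact: dif_add. Qed.

Lemma dif_bound u a d : dif i u a d -> exists2 r : R, 0 < r &
  forall h, cmod (i h) < r -> cmod (u h - a) <= (cmod d + 1) * cmod (i h).
Proof.
move=> /(_ _ ltr01)[r r0 h]; exists r => // k /h.
rewrite mul1r => {}h; have -> : u k - a = (u k - a - d * i k) + d * i k by ring.
by rewrite (le_trans (cmodD _ _)) // cmodM; lra.
Qed.

Lemma dif_cvg u a d : dif i u a d -> forall e : R, 0 < e ->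
  exists2 r : R, 0 < r & forall h, cmod (i h) < r -> cmod (u h - a) < e.
Proof.
move=> /dif_bound[r r0 h] e e0; have d0 := cmod_ge0 d.
have d1 : 0 < cmod d + 1 by rewrite ltr_wpDl.
exists (Num.min r (e / (cmod d + 1))).
  by rewrite lt_min r0 divr_gt0.
move=> k; rewrite lt_min => /andP[/h h1 h2].
by apply: (le_lt_trans h1); rewrite mulrC -ltr_pdivlMr.
Qed.

Lemma dif_mul u v a b d d' : dif i u a d -> dif i v b d' ->
  dif i (fun h => u h * v h) (a * b) (d * b + a * d').
Proof.
move=> hu hv e e0.
have [[a0 b0] d0] := (cmod_ge0 a, cmod_ge0 b, cmod_ge0 d).
set K := cmod a + cmod b + cmod d + 1.
have K0 : 0 < K by rewrite /K; lra.
have e2 : 0 < e / (3 * K) by rewrite divr_gt0 // mulr_gt0.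
have [r r0 ur] := hu _ e2; have [s s0 vs] := hv _ e2.
have [r' r'0 ur'] := dif_bound hu; have [s' s'0 vs'] := dif_cvg hv e2.
exists (Num.min (Num.min r s) (Num.min r' s')) => [|h].
  by rewrite !lt_min r0 s0 r'0.
rewrite !lt_min => /andP[/andP[/ur h1 /vs h2] /andP[/ur' h3 /vs' h4]].
have -> : u h * v h - a * b - (d * b + a * d') * i h =
  (u h - a - d * i h) * b + a * (v h - b - d' * i h) + (u h - a) * (v h - b)
  by ring.
set n := cmod (i h) in h1 h2 h3 *.
have n0 : 0 <= n := cmod_ge0 _.
have eE : e = 3 * (K * (e / (3 * K))) by field; rewrite gt_eqF.
move: e2 h1 h2 h4 eE; set q := e / _ => q0 h1 h2 h4 eE.
have A1 : cmod ((u h - a - d * i h) * b) <= K * q * n.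
  rewrite cmodM mulrC -mulrA; apply: ler_pM => //; rewrite ?cmod_ge0 // /K; lra.
have A2 : cmod (a * (v h - b - d' * i h)) <= K * q * n.
  rewrite cmodM -mulrA; apply: ler_pM => //; rewrite ?cmod_ge0 // /K; lra.
have A3 : cmod ((u h - a) * (v h - b)) <= K * q * n.
  rewrite cmodM mulrAC; apply: ler_pM; rewrite ?cmod_ge0 //; last by lra.
  by apply: (le_trans h3); rewrite ler_wpM2r // /K; lra.
apply: (le_trans (cmodD _ _)); apply: (le_trans (lerD (cmodD _ _) A3)).
have -> : e * n = 3 * (K * q * n) by rewrite {1}eE; ring.
lra.
Qed.

Lemma dif_comp f u a d d' : dif i u a d -> cder f a d' ->
  dif i (fun h => f (u h)) (f a) (d' * d).
Proof.
move=> hu hf e e0; have [d0 d'0] := (cmod_ge0 d, cmod_ge0 d').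
set K := cmod d + cmod d' + 1.
have K0 : 0 < K by rewrite /K; lra.
have e2 : 0 < e / (2 * K) by rewrite divr_gt0 // mulr_gt0.
have [r r0 fr] := hf _ e2; have [s s0 us] := hu _ e2.
have [s' s'0 us'] := dif_bound hu; have [r' r'0 ur'] := dif_cvg hu r0.
exists (Num.min s (Num.min s' r')) => [|h]; first by rewrite !lt_min s0 s'0.
rewrite !lt_min => /andP[/us h1 /andP[/us' h2 /ur' /fr h3]].
rewrite /= [a + _]addrC subrK in h3.
have -> : f (u h) - f a - d' * d * i h =
  (f (u h) - f a - d' * (u h - a)) + d' * (u h - a - d * i h) by ring.
set n := cmod (i h) in h1 h2 *.
have n0 : 0 <= n := cmod_ge0 _.
have eE : e = 2 * (K * (e / (2 * K))) by field; rewrite gt_eqF.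
move: e2 h1 h3 eE; set q := e / _ => q0 h1 h3 eE.
have A1 : cmod (f (u h) - f a - d' * (u h - a)) <= K * q * n.
  apply: (le_trans h3); rewrite -mulrA mulrCA ler_wpM2l ?(ltW q0) //.
  by apply: (le_trans h2); rewrite ler_wpM2r // /K; lra.
have A2 : cmod (d' * (u h - a - d * i h)) <= K * q * n.
  rewrite cmodM -mulrA; apply: ler_pM => //; rewrite ?cmod_ge0 // /K; lra.
apply: (le_trans (cmodD _ _)).
have -> : e * n = 2 * (K * q * n) by rewrite {1}eE; ring.
lra.
Qed.

Lemma dif_ext u v a d : dif i u a d ->
  (exists2 r : R, 0 < r & forall h, cmod (i h) < r -> u h = v h) -> dif i v a d.
Proof.
move=> hu [r r0 uv] e /hu[s s0 hs]; exists (Num.min r s) => [|h].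
  by rewrite lt_min r0.
by rewrite lt_min => /andP[/uv <- /hs].
Qed.

Lemma dif_uniq u a d d' :
  (forall e : R, 0 < e -> exists2 h, i h != 0 & cmod (i h) < e) ->
  dif i u a d -> dif i u a d' -> d = d'.
Proof.
move=> small hd hd'; apply/eqP; rewrite -subr_eq0; apply/eqP.
apply: cmod_small => e e0; have e2 : 0 < e / 2 by rewrite divr_gt0.
have [r r0 ur] := hd _ e2; have [s s0 us] := hd' _ e2.
have rs : 0 < Num.min r s by rewrite lt_min r0.
have [h h0] := small _ rs; rewrite lt_min => /andP[/ur h1 /us h2].
have h0' : 0 < cmod (i h) by rewrite cmod_gt0.
rewrite -(ler_pM2r h0') -cmodM.
have -> : (d - d') * i h = (u h - a - d' * i h) - (u h - a - d * i h) by ring.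
apply: (le_trans (cmodB _ _)); lra.
Qed.

End Dif.

Lemma cder_uniq f z d d' : cder f z d -> cder f z d' -> d = d'.
Proof.
apply: dif_uniq => e e0; exists (rc (e / 2)).
  by rewrite fmorph_eq0 gt_eqF // divr_gt0.
by rewrite cmod_rc gtr0_norm ?divr_gt0 //; lra.
Qed.

Lemma cder_comp f g z d d' :
  cder g z d -> cder f (g z) d' -> cder (f \o g) z (d' * d).
Proof. by move=> hg hf; exact: dif_comp hg hf. Qed.

Lemma rder_comp f u t d d' :
  rder u t d -> cder f (u t) d' -> rder (f \o u) t (d' * d).
Proof. by move=> hu hf; exact: dif_comp hu hf. Qed.

Lemma cder_near f g z d : cder f z d -> (\forall w \near z, f w = g w) ->
  cder g z d.
Proof.
move=> hf /nbhs_cmod[r r0 fg]; rewrite /cder -(fg z) ?subrr ?cmod0 //.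
apply: dif_ext hf _; exists r => // h hr; apply: fg.
by rewrite addrC addKr.
Qed.

Lemma rder_near u v t d : rder u t d -> (\forall s \near t, u s = v s) ->
  rder v t d.
Proof.
move=> hf /nbhs_abs[r r0 fg]; rewrite /rder -(fg t) ?subrr ?normr0 //.
apply: dif_ext hf _; exists r => // h hr; apply: fg.
by rewrite addrC addKr -cmod_rc.
Qed.

Lemma cder_cont f z d : cder f z d -> {for z, continuous f}.
Proof.
move=> /dif_cvg h; apply/contCCP => e /h[r r0 {}h]; exists r => // s /h.
by rewrite [z + _]addrC subrK.
Qed.

Lemma rder_cont u t d : rder u t d -> {for t, continuous u}.
Proof.
move=> /dif_cvg h; apply/contRP => e /h[r r0 {}h]; exists r => // s.
by rewrite -cmod_rc => /h; rewrite [t + _]addrC subrK.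
Qed.

Lemma cder_id z : cder id z 1. Proof. exact: dif_id. Qed.
Lemma cder_cst c z : cder (fun=> c) z 0. Proof. exact: dif_cst. Qed.

Lemma rder_rc t : rder (@rc R) t 1.
Proof.
move=> e e0; exists 1 => // h _.
by rewrite rmorphD /= mul1r [rc t + _]addrC addrK subrr cmod0 mulr_ge0 ?cmod_ge0 // ltW.
Qed.

Lemma rder_affine a b t : rder (fun s => a + rc s * b) t b.
Proof.
have := dif_add (dif_cst _ a) (dif_scale b (rder_rc t)).
rewrite /rder mulr1 add0r [b * _]mulrC.
by under [fun h => _]eq_fun do rewrite [b * _]mulrC.
Qed.

Lemma rder_reparam u k m t d : rder u (k * t + m) d ->
  rder (fun s => u (k * s + m)) t (rc k * d).
Proof.
move=> hu e e0; have k0 := normr_ge0 k.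
have k1 : 0 < `|k| + 1 by rewrite ltr_wpDl.
have e2 : 0 < e / (`|k| + 1) by rewrite divr_gt0.
have [r r0 ur] := hu _ e2.
exists (r / (`|k| + 1)) => [|h]; first by rewrite divr_gt0.
rewrite cmod_rc => hr; have := ur (k * h).
rewrite rmorphM /= cmodM !cmod_rc => {}ur.
have kh : `|k| * `|h| <= (`|k| + 1) * `|h| by rewrite ler_wpM2r // lerDl.
have -> : k * (t + h) + m = k * t + m + k * h by ring.
have -> : rc k * d * rc h = d * (rc k * rc h) by ring.
apply: (le_trans (ur _)).
  by apply: (le_lt_trans kh); rewrite mulrC -ltr_pdivlMr.
apply: (le_trans (ler_wpM2l (ltW e2) kh)).
by rewrite mulrA mulfVK // gt_eqF.
Qed.

Lemma cder_inv z : z != 0 -> cder (@GRing.inv C) z (- (z ^- 2)).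
Proof.
move=> z0 e e0.
have n0 : 0 < cmod z by rewrite cmod_gt0.
set n := cmod z in n0.
(* The first bound keeps |z + h| above n / 2; the second then makes the remainder h^2 / (z^2 (z +
   h)) at most e |h|. *)
exists (Num.min (n / 2) (e * n ^+ 3 / 2)).
  by rewrite lt_min !divr_gt0 // mulr_gt0 // exprn_gt0.
move=> h; rewrite lt_min => /andP[h1 h2].
have zh : n / 2 <= cmod (z + h).
  have := cmod_sub z (- h); rewrite cmodN opprK -/n; lra.
have zh0 : z + h != 0 by rewrite -cmod_gt0; apply: lt_le_trans zh; rewrite divr_gt0.
have -> : (z + h)^-1 - z^-1 - - z ^- 2 * h = h * h * (z ^- 2 * (z + h)^-1).
  by field; rewrite zh0 z0.
rewrite !cmodM -mulrA mulrC ler_wpM2r ?cmod_ge0 //.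
rewrite !cmodV cmodX -/n.
have h0 := cmod_ge0 h.
rewrite mulrA ler_pdivrMr; last by rewrite cmod_gt0.
rewrite ler_pdivrMr ?exprn_gt0 //.
have : e * (n / 2) * n ^+ 2 <= e * cmod (z + h) * n ^+ 2.
  by rewrite ler_wpM2r ?exprn_ge0 ?(ltW n0) // ler_wpM2l // ltW.
apply: le_trans; rewrite (le_trans (ltW h2)) //.
by rewrite le_eqVlt; apply/orP; left; apply/eqP; field.
Qed.

Lemma cder_ext f g z d : f =1 g -> cder f z d -> cder g z d.
Proof. by move=> /funext ->. Qed.

Lemma cder_exp z n : cder (fun w => w ^+ n.+1) z (n.+1%:R * z ^+ n).
Proof.
elim: n => [|n IH].
  by rewrite expr0 mulr1; exact: cder_id.
have H : cder (fun w => w * w ^+ n.+1) z (1 * z ^+ n.+1 + z * (n.+1%:R * z ^+ n)).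
  exact: dif_mul (cder_id z) IH.
have <- : 1 * z ^+ n.+1 + z * (n.+1%:R * z ^+ n) = n.+2%:R * z ^+ n.+1.
  by rewrite [in RHS]mulrS mulrDl mulrCA -exprS.
by apply: cder_ext H => w; rewrite -exprS.
Qed.

(** Cousin's lemma, the form in which compactness of an interval is used throughout. With s the
    supremum of the x such that [Q A x], a short interval around s satisfies Q and carries the
    property beyond s unless s = B. *)
Lemma cousin (A B : R) (Q : R -> R -> Prop) : A <= B ->
  (forall a b c, A <= a -> a <= b -> b <= c -> c <= B ->
     Q a b -> Q b c -> Q a c) ->
  (forall t, A <= t <= B -> exists2 r : R, 0 < r & forall a b, A <= a ->
     a <= t -> t <= b -> b <= B -> b - a < r -> Q a b) -> Q A B.
Proof.
move=> AB tr loc.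
pose S := [set x : R | A <= x <= B /\ Q A x].
have SA : S A.
  split; first by rewrite lexx AB.
  by have [|r r0] := loc A; [rewrite lexx AB|apply; rewrite ?lexx // subrr].
have ubS : ubound S B by move=> x [/andP[]].
have sS : has_sup S by split; [exists A|exists B].
pose s := sup S.
have sB : s <= B by apply: sup_le_ub => //; exists A.
have As : A <= s by apply: ub_le_sup => //; exists B.
have [|r r0 Qr] := loc s; first by rewrite As sB.
have [x Sx xs] : exists2 x, S x & s - r < x.
  by apply: sup_adherent => //.
have xs' : x <= s by apply: ub_le_sup => //; exists B.
case: Sx => /andP[Ax xB] QAx.
(* Since s - x < r, going past s by half of the slack r - (s - x) keeps y - x below r. *)
pose y := Num.min B (s + (r - (s - x)) / 2).
have sy : s <= y by rewrite le_min sB /=; lra.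
have yB : y <= B by rewrite ge_min lexx.
have yle : y <= s + (r - (s - x)) / 2 by rewrite ge_min lexx orbT.
have Qxy : Q x y by apply: Qr => //; lra.
have QAy : Q A y by apply: tr QAx Qxy => //; lra.
have ys : y <= s.
  by apply: ub_le_sup; [exists B|split=> //; rewrite yB andbT; lra].
suff -> : B = y by [].
apply/eqP; rewrite eq_le yB andbT.
by move: ys; rewrite /y ge_min => /orP[?|]; [rewrite le_min|]; lra.
Qed.

(** With M + e in place of M the inequality is additive over adjacent intervals and holds on short
    ones, so [cousin] applies; then e tends to 0. Derivatives are relative to [A, B], which allows
    for functions controlled on that interval only. *)
Lemma mean_value_within (u : R -> C) (A B M : R) : A <= B ->
  (forall t, A <= t <= B -> exists2 d, cmod d <= M &
     forall e : R, 0 < e -> exists2 r : R, 0 < r & forall s, A <= s <= B ->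
       `|s - t| < r -> cmod (u s - u t - d * rc (s - t)) <= e * `|s - t|) ->
  cmod (u B - u A) <= M * (B - A).
Proof.
move=> AB h.
suff H e : 0 < e -> cmod (u B - u A) <= (M + e) * (B - A).
  apply/ler_addgt0Pr => e e0.
  have BA1 : 0 < B - A + 1 by rewrite ltr_wpDl // subr_ge0.
  have := H (e / (B - A + 1)); rewrite divr_gt0 // => /(_ isT) /le_trans; apply.
  rewrite mulrDl lerD2l -mulrA ler_piMr ?(ltW e0) //.
  by rewrite mulrC ler_pdivrMr // mul1r; lra.
move=> e0.
apply: (@cousin A B (fun a b => cmod (u b - u a) <= (M + e) * (b - a))) => //.
  move=> a b c _ _ _ _ h1 h2.
  have -> : u c - u a = (u b - u a) + (u c - u b) by ring.
  apply: (le_trans (cmodD _ _)); lra.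
move=> t tAB; have [d dM hd] := h _ tAB; have [r r0 hr] := hd _ e0.
exists r => // a b Aa at_ tb bB bar.
case/andP: tAB => At tB.
have one s : A <= s <= B -> `|s - t| < r -> cmod (u s - u t) <= (M + e) * `|s - t|.
  move=> sAB st; have {}hr := hr _ sAB st.
  have -> : u s - u t = (u s - u t - d * rc (s - t)) + d * rc (s - t) by ring.
  apply: (le_trans (cmodD _ _)); rewrite cmodM cmod_rc.
  have := ler_wpM2r (normr_ge0 (s - t)) dM; lra.
have ha := one a; have hb := one b.
rewrite distrC ger0_norm ?subr_ge0 // in ha.
rewrite ger0_norm ?subr_ge0 // in hb.
have {}ha := ha ltac:(by apply/andP; split; lra) ltac:(by lra).
have {}hb := hb ltac:(by apply/andP; split; lra) ltac:(by lra).
rewrite cmodC in ha.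
have -> : u b - u a = (u t - u a) + (u b - u t) by ring.
apply: (le_trans (cmodD _ _)); lra.
Qed.

Lemma rder_within u t d : rder u t d -> forall e : R, 0 < e ->
  exists2 r : R, 0 < r & forall s, `|s - t| < r ->
    cmod (u s - u t - d * rc (s - t)) <= e * `|s - t|.
Proof.
move=> h e /h[r r0 {}h]; exists r => // s; rewrite -cmod_rc => /h.
by rewrite (addrC t) subrK.
Qed.

Lemma mean_value (u d : R -> C) (A B M : R) : A <= B ->
  (forall t, A <= t <= B -> rder u t (d t)) ->
  (forall t, A <= t <= B -> cmod (d t) <= M) ->
  cmod (u B - u A) <= M * (B - A).
Proof.
move=> AB h hM; apply: mean_value_within => // t tAB.
exists (d t); first exact: hM.
by move=> e /(rder_within (h _ tAB))[r r0 hr]; exists r => // s _; exact: hr.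
Qed.

Lemma rder_eq (u v d : R -> C) (A B : R) : A <= B ->
  (forall t, A <= t <= B -> rder u t (d t)) ->
  (forall t, A <= t <= B -> rder v t (d t)) -> u B - u A = v B - v A.
Proof.
move=> AB hu hv; apply/eqP; rewrite -subr_eq0; apply/eqP/cmod_small => e e0.
have -> : u B - u A - (v B - v A) = (u B - v B) - (u A - v A) by ring.
apply: le_trans (ltW e0).
have := @mean_value (fun t => u t - v t) (fun=> 0) A B 0 AB.
rewrite mul0r; apply=> [t tAB|t _]; last by rewrite cmod0.
by have := dif_sub (hu _ tAB) (hv _ tAB); rewrite subrr.
Qed.

End Calculus.

(** * Complex derivatives, derivatives of curves and antiderivatives *)

Section Bridge.

(** Multiplying the difference quotient by h removes the puncture, because both sides vanish at h =
    0. A general K covers the real and the complex derivative at once. *)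
Lemma is_deriveP (K : numFieldType) (f : K -> K) (x d : K) :
  is_derive x 1 f d <-> forall e : K, 0 < e ->
    \forall h \near (0 : K), `|f (x + h) - f x - d * h| <= e * `|h|.
Proof.
have E h : h != 0 -> `|d - h^-1 *: ((f \o shift x) (h *: 1) - f x)| * `|h| =
    `|f (x + h) - f x - d * h|.
  move=> h0; rewrite -normrM distrC mulrBl /= /GRing.scale /= mulr1.
  by rewrite mulrAC mulVf // mul1r [h + x]addrC.
split=> [[df dE] e e0|h].
  have : (fun h => h^-1 *: ((f \o shift x) (h *: 1) - f x)) @ 0^' --> d.
    by rewrite -dE.
  move=> /cvgrPdist_le /(_ e e0); rewrite near_withinE.
  apply: filterS => h hP; have [->|h0] := eqVneq h 0.
    by rewrite addr0 subrr mulr0 subrr normr0 mulr0.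
  by rewrite -E // ler_wpM2r // hP.
have F : (fun h => h^-1 *: ((f \o shift x) (h *: 1) - f x)) @ 0^' --> d.
  apply/cvgrPdist_le => e /h; rewrite near_withinE.
  apply: filterS => k hk k0; rewrite -(ler_pM2r (x := `|k|)) ?normr_gt0 //.
  by rewrite E.
split; first by apply/cvg_ex; exists d.
by apply: cvg_lim F; exact: norm_hausdorff.
Qed.

Variable R : realType.
Local Notation C := (Cplx R).

Lemma cderP (f : C -> C) (z d : C) : is_derive z 1 f d <-> cder f z d.
Proof.
split=> [/is_deriveP h e e0|h].
  have e0' : 0 < rc e by rewrite -[X in X < _](rmorph0 (@rc R)) ltr_rc.
  have /nbhs_cmod[r r0 hr] := h _ e0'; exists r => // k kr.
  have := hr k; rewrite subr0 => /(_ kr).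
  by rewrite !cmodE -rmorphM /= ler_rc.
apply/is_deriveP => e e0; have eE : e = rc (cmod e) by rewrite -cmodE gtr0_norm.
have e0' : 0 < cmod e by rewrite cmod_gt0 gt_eqF.
have [r r0 hr] := h _ e0'; apply/nbhs_cmod; exists r => // k; rewrite subr0 => /hr.
by rewrite -ler_rc rmorphM /= -eE -!cmodE.
Qed.

Lemma cder_derivable (f : C -> C) (z d : C) : cder f z d -> derivable f z 1.
Proof. by move=> /cderP[]. Qed.

Lemma cder_derive1 (f : C -> C) (z d : C) : cder f z d -> derive1 f z = d.
Proof. by move=> /cderP[_ <-]; rewrite derive1E. Qed.

Lemma derivable_cder (f : C -> C) (z : C) :
  derivable f z 1 -> cder f z (derive1 f z).
Proof. by move=> h; apply/cderP; rewrite derive1E; split. Qed.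

Lemma rderP (u : R -> C) (t : R) (d : C) : rder u t d <->
  is_derive t 1 (@complex.Re R \o u : R -> R) (complex.Re d) /\
  is_derive t 1 (@complex.Im R \o u : R -> R) (complex.Im d).
Proof.
split=> [h|[/is_deriveP h1 /is_deriveP h2] e e0].
  split; apply/is_deriveP => e /h[r r0 {}h]; apply/nbhs_abs; exists r => // k;
    rewrite subr0 -cmod_rc => /h; rewrite cmod_rc; apply: le_trans => /=.
    have -> : complex.Re (u (t + k)) - complex.Re (u t) - complex.Re d * k =
      complex.Re (u (t + k) - u t - d * rc k) by rewrite !cReB cReM /=; ring.
    exact: Re_le.
  have -> : complex.Im (u (t + k)) - complex.Im (u t) - complex.Im d * k =
    complex.Im (u (t + k) - u t - d * rc k) by rewrite !cImB cImM /=; ring.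
  exact: Im_le.
have e2 : 0 < e / 2 by rewrite divr_gt0.
have /nbhs_abs[r r0 {}h1] := h1 _ e2.
have /nbhs_abs[s s0 {}h2] := h2 _ e2.
exists (Num.min r s) => [|k]; first by rewrite lt_min r0.
rewrite cmod_rc -[k in `|k| < _]subr0 lt_min => /andP[/h1 {}h1 /h2 {}h2].
apply: (le_trans (cmod_ReIm _)); rewrite !cReB !cImB cReM cImM /=.
by rewrite !mulr0 subr0 add0r; move: h1 h2 => /=; lra.
Qed.

Lemma antiderivative (u : R -> C) (A B : R) : continuous u ->
  exists U : R -> C, forall t, A <= t <= B -> rder U t (u t).
Proof.
move=> cu.
have real (f : R -> R) : continuous f ->
    exists F : R -> R, forall t, A <= t <= B -> is_derive t 1 F (f t).
  (* Starting at A - 1 makes every point of [A, B] interior to [A - 1, B + 1], so that the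
     derivative is two-sided at A and B as well. *)
  move=> cf; exists (fun x => \int[lebesgue_measure]_(t in `[A - 1, x]) f t).
  move=> t /andP[At tB].
  have fi : lebesgue_measure.-integrable `[A - 1, B + 1] (EFin \o f).
    apply: continuous_compact_integrable; first exact: segment_compact.
    exact: continuous_subspaceT.
  have tB1 : t < B + 1 by lra.
  have At1 : A - 1 < t by lra.
  have [df dfE] := continuous_FTC1_closed tB1 fi At1 (cf t).
  by split; [exact: df|rewrite -derive1E].
have [F FE] := real (@complex.Re R \o u)
  (fun t => continuous_comp (cu t) (@continuous_Re R (u t))).
have [G GE] := real (@complex.Im R \o u)
  (fun t => continuous_comp (cu t) (@continuous_Im R (u t))).
exists (fun t => F t +i* G t) => t tAB; apply/rderP; split.
  exact: FE.
exact: GE.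
Qed.

End Bridge.

(** * Goursat's theorem on rectangles *)

Section Goursat.
Variable R : realType.
Local Notation C := (Cplx R).

Lemma half_pow_lt (x e : R) : 0 < e -> exists n : nat, x / 2 ^+ n < e.
Proof.
move=> e0; exists (Num.bound `|x / e|).
rewrite ltr_pdivrMr ?exprn_gt0 // mulrC -ltr_pdivrMr //.
apply: (le_lt_trans (ler_norm _)).
apply: (lt_le_trans (archi_boundP (normr_ge0 _))).
by rewrite -natrX ler_nat ltnW // ltn_expl.
Qed.

(* [G a c l m] speaks about the rectangle [a, a + l] x [c, c + m]. *)
Lemma bisection2 (G : R -> R -> R -> R -> Prop) (a0 c0 l0 m0 : R) :
  0 <= l0 -> 0 <= m0 ->
  (forall a c l m, G a c (l / 2) (m / 2) -> G (a + l / 2) c (l / 2) (m / 2) ->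
     G a (c + m / 2) (l / 2) (m / 2) ->
     G (a + l / 2) (c + m / 2) (l / 2) (m / 2) -> G a c l m) ->
  (forall x y, a0 <= x <= a0 + l0 -> c0 <= y <= c0 + m0 ->
     exists2 r : R, 0 < r & forall a c l m, a0 <= a -> a <= x -> x <= a + l ->
       a + l <= a0 + l0 -> c0 <= c -> c <= y -> y <= c + m -> c + m <= c0 + m0 ->
       l < r -> m < r -> G a c l m) ->
  G a0 c0 l0 m0.
Proof.
move=> l00 m00 quad loc.
apply: contrapT => nG0.
pose l n := l0 / 2 ^+ n; pose m n := m0 / 2 ^+ n.
have lS n : l n.+1 = l n / 2 by rewrite /l exprS invfM [_ * (2 ^+ n)^-1]mulrC mulrA.
have mS n : m n.+1 = m n / 2 by rewrite /m exprS invfM [_ * (2 ^+ n)^-1]mulrC mulrA.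
have l_ge0 n : 0 <= l n by rewrite divr_ge0 // exprn_ge0.
have m_ge0 n : 0 <= m n by rewrite divr_ge0 // exprn_ge0.
(* Choice of a bad quarter. The first clause is an implication, which makes the choice total: the
   corners can be defined by recursion before they are known to be bad. *)
have step (np : nat * (R * R)) : exists q : R * R,
    [/\ ~ G np.2.1 np.2.2 (l np.1) (m np.1) -> ~ G q.1 q.2 (l np.1.+1) (m np.1.+1),
        np.2.1 <= q.1 <= np.2.1 + l np.1.+1 & np.2.2 <= q.2 <= np.2.2 + m np.1.+1].
  case: np => n [a c] /=.
  have [Ga|] := pselect (G a c (l n) (m n)).
    by exists (a, c); split=> [/(_ Ga) //||] /=; rewrite lexx lerDl /=.
  rewrite lS mS => nG; have := quad a c (l n) (m n).
  have lh : 0 <= l n / 2 by rewrite -lS.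
  have mh : 0 <= m n / 2 by rewrite -mS.
  have [G1|G1 _] := pselect (G a c (l n / 2) (m n / 2)); last first.
    by exists (a, c); split=> //=; rewrite lexx lerDl ?andbT /=.
  have [G2|G2 _] := pselect (G (a + l n / 2) c (l n / 2) (m n / 2)); last first.
    by exists (a + l n / 2, c); split=> //=; rewrite lexx lerDl ?andbT /=.
  have [G3|G3 _] := pselect (G a (c + m n / 2) (l n / 2) (m n / 2)); last first.
    by exists (a, c + m n / 2); split=> //=; rewrite lexx lerDl ?andbT /=.
  have [G4 /(_ G1 G2 G3 G4) //|G4 _] :=
    pselect (G (a + l n / 2) (c + m n / 2) (l n / 2) (m n / 2)).
  by exists (a + l n / 2, c + m n / 2); split=> //=; rewrite lexx lerDl ?andbT /=.
have [nx nxP] := choice step.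
pose p := fix p n := if n is k.+1 then nx (k, p k) else (a0, c0).
have pS n : p n.+1 = nx (n, p n) by [].
have bad n : ~ G (p n).1 (p n).2 (l n) (m n).
  elim: n => [|n IH]; first by rewrite /l /m expr0 !divr1.
  by rewrite pS; have [H _ _] := nxP (n, p n); exact: H.
(* Nested intervals: the supremum of the left ends lies in all of them. *)
have nest (u : nat -> R) (s : nat -> R) : (forall n, 0 <= s n) ->
    (forall n, u n <= u n.+1 <= u n + s n.+1) -> (forall n, s n.+1 = s n / 2) ->
    exists x, forall n, u n <= x <= u n + s n.
  move=> s0 us sS.
  have mono n k : u n <= u (n + k)%N.
    elim: k => [|k IH]; first by rewrite addn0.
    by rewrite addnS (le_trans IH) //; have /andP[] := us (n + k)%N.
  have anti n k : u (n + k)%N + s (n + k)%N <= u n + s n.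
    elim: k => [|k IH]; first by rewrite addn0.
    rewrite addnS (le_trans _ IH) //; have := us (n + k)%N; rewrite !sS; lra.
  have cross n k : u k <= u n + s n.
    have [nk|kn] := leqP n k.
      have := anti n (k - n)%N; rewrite subnKC // => H.
      by apply: le_trans H; rewrite lerDl.
    have := mono k (n - k)%N; rewrite subnKC ?(ltnW kn) // => H.
    by apply: (le_trans H); rewrite lerDl.
  exists (sup (range u)) => n; apply/andP; split.
    apply: ub_le_sup; last by exists n.
    by exists (u 0%N + s 0%N) => _ [k _ <-].
  apply: sup_le_ub; first by exists (u 0%N), 0%N.
  by move=> _ [k _ <-].
have [x xP] : exists x, forall n, (p n).1 <= x <= (p n).1 + l n.
  apply: (nest (fun n => (p n).1)) l_ge0 _ lS => n.
  by have [_ h _] := nxP (n, p n); exact: h.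
have [y yP] : exists y, forall n, (p n).2 <= y <= (p n).2 + m n.
  apply: (nest (fun n => (p n).2)) m_ge0 _ mS => n.
  by have [_ _ h] := nxP (n, p n); exact: h.
have low n : a0 <= (p n).1 /\ c0 <= (p n).2.
  elim: n => [|n [IH1 IH2]]; first by rewrite !lexx.
  have [_ /andP[h1 _] /andP[h2 _]] := nxP (n, p n).
  by rewrite pS; split; [exact: le_trans h1|exact: le_trans h2].
have up n : (p n).1 + l n <= a0 + l0 /\ (p n).2 + m n <= c0 + m0.
  elim: n => [|n [IH1 IH2]]; first by rewrite /l /m expr0 !divr1 !lexx.
  have [_ /andP[_ h1] /andP[_ h2]] := nxP (n, p n).
  by rewrite pS; move: h1 h2 IH1 IH2; rewrite !lS !mS /=; split; lra.
have [||r r0 locr] := loc x y.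
- by have := xP 0%N; rewrite /l expr0 divr1.
- by have := yP 0%N; rewrite /m expr0 divr1.
have [n nr] := half_pow_lt (l0 + m0) r0.
have ln : l n < r by apply: le_lt_trans nr; rewrite ler_wpM2r ?invr_ge0 ?exprn_ge0 // lerDl.
have mn : m n < r by apply: le_lt_trans nr; rewrite ler_wpM2r ?invr_ge0 ?exprn_ge0 // lerDr.
apply: (bad n); have [? ?] := low n; have [? ?] := up n.
by have /andP[? ?] := xP n; have /andP[? ?] := yP n; apply: locr.
Qed.

Lemma mean_value_abs (u d : R -> C) (A B M : R) :
  (forall t, Num.min A B <= t <= Num.max A B -> rder u t (d t)) ->
  (forall t, Num.min A B <= t <= Num.max A B -> cmod (d t) <= M) ->
  cmod (u B - u A) <= M * `|B - A|.
Proof.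
have [AB|/ltW BA] := leP A B => h hM.
  by rewrite ger0_norm ?subr_ge0 //; exact: mean_value h hM.
by rewrite cmodC distrC ger0_norm ?subr_ge0 //; exact: mean_value h hM.
Qed.

Section Square.
Variables (f df : C -> C) (z0 : C) (s : R).
Hypothesis s0 : 0 < s.

Let pt (x y : R) : C := z0 + rc x + ii R * rc y.
Let sq (x : R) := - s <= x <= s.
Hypothesis fder : forall x y, sq x -> sq y -> cder f (pt x y) (df (pt x y)).

(** The retraction of R onto [- s, s]: [antiderivative] asks for continuity on the whole line, while
    f is controlled on the square only. *)
Let clamp (x : R) := Num.max (- s) (Num.min s x).

Let clamp_id x : sq x -> clamp x = x.
Proof.
move=> /andP[a b]; rewrite /clamp.
by rewrite (min_idPr b) (max_idPr a).
Qed.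

Let sq_clamp x : sq (clamp x).
Proof.
rewrite /sq /clamp; apply/andP; split; first by rewrite le_max lexx.
by rewrite ge_max ge_min lexx /= andbT; move: s0; lra.
Qed.

Let clampP x : [\/ x <= - s /\ clamp x = - s, sq x /\ clamp x = x
  | s <= x /\ clamp x = s].
Proof.
have ss : - s <= s by move: s0; lra.
have [xs|sx] := leP x (- s).
  by constructor 1; rewrite /clamp (min_idPr (le_trans xs ss)) (max_idPl xs).
have [xs|sx'] := leP x s.
  by constructor 2; rewrite clamp_id /sq ?(ltW sx) ?xs.
by constructor 3; rewrite /clamp (min_idPl (ltW sx')) (max_idPr ss) ltW.
Qed.

Let clamp_cont : continuous clamp.
Proof.
move=> x A /nbhs_abs[d d0 dA]; apply/nbhs_abs; exists d => // y yx.
apply: dA; apply: le_lt_trans yx.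
have h1 := ler_norm (y - x); have h2 := ler_norm (x - y); rewrite distrC in h2.
rewrite ler_norml.
by have [[? ->]|[/andP[? ?] ->]|[? ->]] := clampP x;
  have [[? ->]|[/andP[? ?] ->]|[? ->]] := clampP y;
  apply/andP; split; move: s0; lra.
Qed.

(** One antiderivative per horizontal line, chosen without any relation between different lines;
    only differences along a single line will occur. *)
Let fH : exists H : R -> R -> C,
  forall y x, sq y -> sq x -> rder (H y) x (f (pt x y)).
Proof.
have ex y : exists U : R -> C, sq y -> forall x, sq x -> rder U x (f (pt x y)).
  have [yS|nyS] := pselect (sq y); last by exists (fun=> 0).
  pose u x := f (pt (clamp x) y).
  have cu : continuous u.
    move=> x; apply: (@continuous_comp _ _ _ (fun x => pt (clamp x) y) f); last first.
      exact: cder_cont (fder (sq_clamp x) yS).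
    apply: cvgD; last exact: cvg_cst.
    apply: cvgD; first exact: cvg_cst.
    apply: (@continuous_comp _ _ _ clamp (@rc R)); first exact: clamp_cont.
    exact: continuous_rc.
  have [U hU] := antiderivative (- s) s cu.
  by exists U => _ x xS; have := hU _ xS; rewrite /u clamp_id.
have [H hH] := choice ex.
by exists H => y x yS xS; exact: hH.
Qed.

Let fV : exists V : R -> R -> C,
  forall x y, sq x -> sq y -> rder (V x) y (f (pt x y)).
Proof.
have ex x : exists U : R -> C, sq x -> forall y, sq y -> rder U y (f (pt x y)).
  have [xS|nxS] := pselect (sq x); last by exists (fun=> 0).
  pose u y := f (pt x (clamp y)).
  have cu : continuous u.
    move=> y; apply: (@continuous_comp _ _ _ (fun y => pt x (clamp y)) f); last first.
      exact: cder_cont (fder xS (sq_clamp y)).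
    apply: cvgD; first exact: cvg_cst.
    apply: cvgM; first exact: cvg_cst.
    apply: (@continuous_comp _ _ _ clamp (@rc R)); first exact: clamp_cont.
    exact: continuous_rc.
  have [U hU] := antiderivative (- s) s cu.
  by exists U => _ y yS; have := hU _ yS; rewrite /u clamp_id.
have [V hV] := choice ex.
by exists V => x y xS yS; exact: hV.
Qed.

Section HV.
Variables (H V : R -> R -> C).
Hypothesis HP : forall y x, sq y -> sq x -> rder (H y) x (f (pt x y)).
Hypothesis VP : forall x y, sq x -> sq y -> rder (V x) y (f (pt x y)).

(* The integral of f dz along the boundary of the rectangle [a, b] x [c, d]. *)
Let Phi a b c d : C := (H c b - H c a) + ii R * (V b d - V b c)
  - (H d b - H d a) - ii R * (V a d - V a c).

Let pt_sub x y x' y' : pt x y - pt x' y' = rc (x - x') + ii R * rc (y - y').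
Proof. by rewrite /pt !rmorphB /=; ring. Qed.

Let cmod_pt x y x' y' : cmod (pt x y - pt x' y') <= `|x - x'| + `|y - y'|.
Proof.
by rewrite pt_sub (le_trans (cmodD _ _)) // cmodM cmod_ii mul1r !cmod_rc.
Qed.

Let pt_x y x : rder (fun x => pt x y) x 1.
Proof.
have := rder_affine (z0 + ii R * rc y) 1 x.
by congr rder; apply/funext => t; rewrite /pt mulr1; ring.
Qed.

Let pt_y x y : rder (fun y => pt x y) y (ii R).
Proof.
have := rder_affine (z0 + rc x) (ii R) y.
by congr rder; apply/funext => t; rewrite /pt mulrC.
Qed.

(** The first-order approximation of f at the point has the primitive [L], whose increments cancel
    around the boundary. The four sides, of total length 2 S, only see the remainder, which is at
    most e / 2 * S. *)
Let local_est x0 y0 : sq x0 -> sq y0 -> forall e : R, 0 < e ->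
  exists2 r : R, 0 < r & forall a b c d, - s <= a -> a <= x0 -> x0 <= b ->
    b <= s -> - s <= c -> c <= y0 -> y0 <= d -> d <= s -> b - a < r ->
    d - c < r -> cmod (Phi a b c d) <= e * ((b - a) + (d - c)) ^+ 2.
Proof.
move=> x0S y0S e e0; set w0 := pt x0 y0.
have e2 : 0 < e / 2 by rewrite divr_gt0.
have [r r0 hr] := fder x0S y0S e2.
exists (r / 2); first by rewrite divr_gt0.
move=> a b c d sa ax xb bs sc cy yd ds bar dcr.
set S := (b - a) + (d - c).
pose L z : C := f w0 * z + df w0 / 2 * ((z - w0) * (z - w0)).
have LP z : cder L z (f w0 + df w0 * (z - w0)).
  have h1 : cder (fun z => z - w0) z 1.
    by have := dif_sub (cder_id z) (cder_cst w0 z); rewrite subr0.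
  have := dif_add (dif_scale (f w0) (cder_id z))
    (dif_scale (df w0 / 2) (dif_mul h1 h1)).
  rewrite mulr1 mul1r mulr1.
  have -> : df w0 / 2 * ((z - w0) + (z - w0)) = df w0 * (z - w0) by field.
  by [].
have small x y : a <= x <= b -> c <= y <= d ->
    cmod (f (pt x y) - (f w0 + df w0 * (pt x y - w0))) <= e / 2 * S.
  move=> /andP[? ?] /andP[? ?].
  have d1 : `|x - x0| <= b - a by rewrite ler_norml; apply/andP; split; lra.
  have d2 : `|y - y0| <= d - c by rewrite ler_norml; apply/andP; split; lra.
  have d3 : cmod (pt x y - w0) <= S.
    by rewrite (le_trans (cmod_pt _ _ _ _)) // /S lerD.
  have := hr (pt x y - w0); rewrite /= -/w0 [w0 + _]addrC subrK => h.
  rewrite opprD addrA; apply: (le_trans (h _)); last by rewrite ler_wpM2l // ltW.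
  by apply: (le_lt_trans d3); rewrite /S; lra.
have edgeH y : c <= y <= d ->
    cmod ((H y b - L (pt b y)) - (H y a - L (pt a y))) <= e / 2 * S * (b - a).
  move=> yI; have yS : sq y by apply/andP; split; lra.
  apply: (@mean_value _ (fun x => H y x - L (pt x y))
    (fun x => f (pt x y) - (f w0 + df w0 * (pt x y - w0)))) => [||x xI].
  - lra.
  - move=> x xI; have xS : sq x by apply/andP; split; lra.
    have := rder_comp (pt_x y x) (LP (pt x y)); rewrite mulr1 => hL.
    exact: dif_sub (HP yS xS) hL.
  - exact: small.
have edgeV x : a <= x <= b ->
    cmod ((ii R * V x d - L (pt x d)) - (ii R * V x c - L (pt x c))) <=
    e / 2 * S * (d - c).
  move=> xI; have xS : sq x by apply/andP; split; lra.
  apply: (@mean_value _ (fun y => ii R * V x y - L (pt x y))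
    (fun y => ii R * (f (pt x y) - (f w0 + df w0 * (pt x y - w0))))) => [||y yI].
  - lra.
  - move=> y yI; have yS : sq y by apply/andP; split; lra.
    have hL := rder_comp (pt_y x y) (LP (pt x y)).
    have := dif_sub (dif_scale (ii R) (VP xS yS)) hL.
    by rewrite [_ * ii R]mulrC -mulrBr.
  - by rewrite cmodM cmod_ii mul1r; exact: small.
have aI : a <= a <= b by lra.
have bI : a <= b <= b by lra.
have cI : c <= c <= d by lra.
have dI : c <= d <= d by lra.
have E1 := edgeH _ cI; have E2 := edgeH _ dI.
have E3 := edgeV _ aI; have E4 := edgeV _ bI.
set k1 := (X in cmod X) in E1; set k2 := (X in cmod X) in E2.
set k3 := (X in cmod X) in E3; set k4 := (X in cmod X) in E4.
have -> : Phi a b c d = (k1 + k4) - (k2 + k3) by rewrite /Phi /k1 /k2 /k3 /k4; ring.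
apply: (le_trans (cmodB _ _)).
apply: (le_trans (lerD (cmodD _ _) (cmodD _ _))).
have -> : e * S ^+ 2 = e / 2 * S * (b - a) + e / 2 * S * (d - c) +
  (e / 2 * S * (b - a) + e / 2 * S * (d - c)) by rewrite /S; field.
by rewrite -!addrA; lra.
Qed.

(** A bound by a multiple of the squared half-perimeter passes from the four quarters to the whole,
    since [Phi] is additive and the square is divided by 4. Hence [bisection2] reduces it to
    [local_est]. *)
Let goursat_le a b c d : - s <= a -> a <= b -> b <= s ->
  - s <= c -> c <= d -> d <= s -> Phi a b c d = 0.
Proof.
move=> sa ab bs sc cd ds; apply: cmod_small => e e0.
(* The summand 1 keeps K positive for degenerate rectangles. *)
pose K := ((b - a) + (d - c)) ^+ 2 + 1.
have K0 : 0 < K by rewrite ltr_wpDl // sqr_ge0.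
have eK : 0 < e / K by rewrite divr_gt0.
have addKr' (u v : R) : u + (v - u) = v by ring.
suff : cmod (Phi a (a + (b - a)) c (c + (d - c))) <= e / K * ((b - a) + (d - c)) ^+ 2.
  rewrite !addKr' => /le_trans; apply.
  by rewrite mulrAC ler_pdivrMr // ler_wpM2l ?(ltW e0) // lerDl.
apply: (@bisection2 (fun a c l m => cmod (Phi a (a + l) c (c + m)) <=
  e / K * (l + m) ^+ 2)); rewrite ?subr_ge0 //.
  move=> a' c' l m.
  set k1 := Phi _ _ _ _; set k2 := Phi _ _ _ _.
  set k3 := Phi _ _ _ _; set k4 := Phi _ _ _ _ => E1 E2 E3 E4.
  have -> : Phi a' (a' + l) c' (c' + m) = (k1 + k2) + (k3 + k4).
    have lE : a' + l = a' + l / 2 + l / 2 by field.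
    have mE : c' + m = c' + m / 2 + m / 2 by field.
    by rewrite /k1 /k2 /k3 /k4 lE mE /Phi; ring.
  apply: (le_trans (cmodD _ _)).
  apply: (le_trans (lerD (cmodD _ _) (cmodD _ _))).
  have -> : e / K * (l + m) ^+ 2 = e / K * (l / 2 + m / 2) ^+ 2 +
    e / K * (l / 2 + m / 2) ^+ 2 + (e / K * (l / 2 + m / 2) ^+ 2 +
    e / K * (l / 2 + m / 2) ^+ 2) by field; rewrite gt_eqF.
  by apply: lerD; apply: lerD.
move=> x y xI yI.
have xS : sq x by apply/andP; split; lra.
have yS : sq y by apply/andP; split; lra.
have [r r0 hr] := local_est xS yS eK; exists r => // a' c' l m.
move=> ? ? ? ? ? ? ? ? ? ?.
have := hr a' (a' + l) c' (c' + m); have addrK' (u v : R) : u + v - u = v by ring.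
by rewrite !addrK'; apply=> //; lra.
Qed.

Let goursat a b c d : sq a -> sq b -> sq c -> sq d -> Phi a b c d = 0.
Proof.
move=> aS bS cS dS.
wlog ab : a b aS bS / a <= b => [hw|].
  have [ab|/ltW ba] := leP a b; first exact: hw.
  have -> : Phi a b c d = - Phi b a c d by rewrite /Phi; ring.
  by rewrite hw ?oppr0.
wlog cd : c d cS dS / c <= d => [hw|].
  have [cd|/ltW dc] := leP c d; first exact: hw.
  have -> : Phi a b c d = - Phi a b d c by rewrite /Phi; ring.
  by rewrite hw ?oppr0.
move: aS bS cS dS => /andP[? ?] /andP[? ?] /andP[? ?] /andP[? ?].
exact: goursat_le.
Qed.

(** The integral of f from the centre z0, first along the horizontal axis and then vertically up to
    z. *)
Let P (z : C) : C := let x := complex.Re (z - z0) in let y := complex.Im (z - z0) in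
  H 0 x - H 0 0 + ii R * (V x y - V x 0).

(** Applied to the rectangle between x and x' and between 0 and y, [goursat] rewrites P (z + h) - P
    z as the integral over a horizontal segment from z and a vertical one to z + h. On both, f
    differs from f z by at most e / 2. *)
Let P_cder z : cmod (z - z0) < s -> cder P z (f z).
Proof.
move=> zs e e0.
have e2 : 0 < e / 2 by rewrite divr_gt0.
have ptE w : pt (complex.Re (w - z0)) (complex.Im (w - z0)) = w.
  by rewrite /pt -addrA -cE addrC subrK.
have S0 : sq 0 by rewrite /sq; apply/andP; split; move: s0; lra.
have inS w : cmod (w - z0) < s ->
    sq (complex.Re (w - z0)) /\ sq (complex.Im (w - z0)).
  move=> ws; split; rewrite /sq -ler_norml; apply: le_trans (ltW ws).
    exact: Re_le.
  exact: Im_le.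
have [xS yS] := inS _ zs.
have fz := fder xS yS; rewrite ptE in fz.
have /contCCP/(_ _ e2)[r r0 hr] := cder_cont fz.
exists (Num.min (r / 2) (s - cmod (z - z0))).
  by rewrite lt_min divr_gt0 //= subr_gt0.
move=> h; rewrite lt_min => /andP[h1 h2].
have zhs : cmod (z + h - z0) < s.
  by rewrite addrAC; apply: (le_lt_trans (cmodD _ _)); lra.
have [x'S y'S] := inS _ zhs.
rewrite /P.
set x := complex.Re (z - z0) in xS *; set y := complex.Im (z - z0) in yS *.
set x' := complex.Re (z + h - z0) in x'S *; set y' := complex.Im (z + h - z0) in y'S *.
have xx : x' - x = complex.Re h by rewrite /x /x' -cReB; congr complex.Re; ring.
have yy : y' - y = complex.Im h by rewrite /y /y' -cImB; congr complex.Im; ring.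
have hE : h = rc (x' - x) + ii R * rc (y' - y) by rewrite xx yy -cE.
have := goursat xS x'S S0 yS; rewrite /Phi => G0.
have -> : H 0 x' - H 0 0 + ii R * (V x' y' - V x' 0) -
   (H 0 x - H 0 0 + ii R * (V x y - V x 0)) - f z * h =
   ((H y x' - f z * rc x') - (H y x - f z * rc x)) +
   ii R * ((V x' y' - f z * rc y') - (V x' y - f z * rc y)).
  rewrite {1}hE -[LHS]subr0 -G0 !rmorphB /=; ring.
have hx : `|x' - x| <= cmod h by rewrite xx Re_le.
have hy : `|y' - y| <= cmod h by rewrite yy Im_le.
have near t t' : `|t - x| <= `|x' - x| -> `|t' - y| <= `|y' - y| ->
    cmod (f (pt t t') - f z) <= e / 2.
  move=> ht ht'; apply/ltW/hr; rewrite -{1}(ptE z) -/x -/y.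
  by apply: (le_lt_trans (cmod_pt _ _ _ _)); lra.
have btw (A B t : R) : Num.min A B <= t <= Num.max A B -> `|t - A| <= `|B - A|.
  have [AB|BA] := leP A B => /andP[? ?].
    by rewrite !ger0_norm ?subr_ge0 //; lra.
  by rewrite !ler0_norm ?subr_le0 ?(ltW BA) //; lra.
have btwS (A B t : R) : sq A -> sq B -> Num.min A B <= t <= Num.max A B -> sq t.
  by have [AB|BA] := leP A B => /andP[? ?] /andP[? ?] /andP[? ?];
    apply/andP; split; lra.
have lin t : rder (fun t => f z * rc t) t (f z).
  by have := dif_scale (f z) (rder_rc t); rewrite mulr1.
apply: (le_trans (cmodD _ _)); rewrite cmodM cmod_ii mul1r.
have A1 := @mean_value_abs (fun t => H y t - f z * rc t)
  (fun t => f (pt t y) - f z) x x' (e / 2).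
have A2 := @mean_value_abs (fun t => V x' t - f z * rc t)
  (fun t => f (pt x' t) - f z) y y' (e / 2).
have {}A1 : cmod (H y x' - f z * rc x' - (H y x - f z * rc x)) <= e / 2 * `|x' - x|.
  apply: A1 => t tI.
    by apply: dif_sub (lin t); apply: HP => //; exact: btwS tI.
  by apply: near; [exact: btw|rewrite subrr normr0].
have {}A2 : cmod (V x' y' - f z * rc y' - (V x' y - f z * rc y)) <= e / 2 * `|y' - y|.
  apply: A2 => t tI.
    by apply: dif_sub (lin t); apply: VP => //; exact: btwS tI.
  by apply: near => //; exact: btw.
have := ler_wpM2l (ltW e2) hx; have := ler_wpM2l (ltW e2) hy.
by move=> /= ? ?; lra.
Qed.

Lemma antiderivatives_primitive :
  exists P, forall z, cmod (z - z0) < s -> cder P z (f z).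
Proof. by exists P; exact: P_cder. Qed.

End HV.

Lemma square_primitive :
  exists P, forall z, cmod (z - z0) < s -> cder P z (f z).
Proof.
have [H HP] := fH; have [V VP] := fV; exact: antiderivatives_primitive HP VP.
Qed.

End Square.

(** On the square of half-side r / 4 one has |x| + |y| <= r / 2, so it lies inside the disc of
    radius r. *)
Theorem local_primitive (f df : C -> C) (z0 : C) (r : R) : 0 < r ->
  (forall z, cmod (z - z0) < r -> cder f z (df z)) ->
  exists P, forall z, cmod (z - z0) < r / 4 -> cder P z (f z).
Proof.
move=> r0 h; apply: (@square_primitive f df) => [|x y xS yS].
  by rewrite divr_gt0.
apply: h; have -> : z0 + rc x + ii R * rc y - z0 = rc x + ii R * rc y by ring.
apply: (le_lt_trans (cmodD _ _)); rewrite cmodM cmod_ii mul1r !cmod_rc.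
have : `|x| <= r / 4 by rewrite ler_norml.
have : `|y| <= r / 4 by rewrite ler_norml.
lra.
Qed.

End Goursat.

(** * Cauchy's formula and Taylor expansions *)

Section CircleMean.
Variable R : realType.
Local Notation C := (Cplx R).
Local Notation I := (ii R).
Implicit Types (u v g : R -> C) (a : C).

(* The integral of a continuous function over [0, 1], computed from any
   antiderivative. *)
Definition cmean u : C := xget 0 [set d | exists2 U : R -> C,
  forall t, 0 <= t <= 1 -> rder U t (u t) & d = U 1 - U 0].

Lemma cmeanE u U : (forall t, 0 <= t <= 1 -> rder U t (u t)) ->
  cmean u = U 1 - U 0.
Proof.
move=> hU; rewrite /cmean; case: xgetP => [d _ [V hV ->]|/(_ (U 1 - U 0))].
  exact: rder_eq hV hU.
by case; exists U.
Qed.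

Lemma cmean_scaleD c u v : continuous u -> continuous v ->
  cmean (fun t => c * u t + v t) = c * cmean u + cmean v.
Proof.
move=> cu cv; have [U hU] := antiderivative 0 1 cu.
have [V hV] := antiderivative 0 1 cv.
rewrite (cmeanE hU) (cmeanE hV) (cmeanE (U := fun t => c * U t + V t)); first ring.
by move=> t tI; apply: dif_add (hV _ tI); exact: dif_scale (hU _ tI).
Qed.

Lemma cmean_cst c : cmean (fun=> c) = c.
Proof.
rewrite (@cmeanE _ (fun t => 0 + rc t * c)) => [|t _]; last exact: rder_affine.
by rewrite rmorph1 rmorph0 /=; ring.
Qed.

Lemma cmean_scale c u : continuous u -> cmean (fun t => c * u t) = c * cmean u.
Proof.
move=> cu; have [U hU] := antiderivative 0 1 cu.
rewrite (cmeanE hU) (cmeanE (U := fun t => c * U t)); first ring.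
by move=> t tI; exact: dif_scale (hU _ tI).
Qed.

Lemma cmean_le u (M : R) : continuous u ->
  (forall t, 0 <= t <= 1 -> cmod (u t) <= M) -> cmod (cmean u) <= M.
Proof.
move=> cu uM; have [U hU] := antiderivative 0 1 cu.
by rewrite (cmeanE hU) -[leRHS]mulr1 -[X in M * X]subr0; exact: mean_value hU uM.
Qed.

(** The summand 0 matches the form [k * t + m] of [rder_reparam]. *)
Definition unit_circle (t : R) : C :=
  cos (pi *+ 2 * t + 0) +i* sin (pi *+ 2 * t + 0).

Lemma rder_unit_circle t :
  rder unit_circle t (rc (pi *+ 2) * (I * unit_circle t)).
Proof.
apply: (@rder_reparam _ (fun s => cos s +i* sin s : C)).
have -> : I * unit_circle t = - sin (pi *+ 2 * t + 0) +i* cos (pi *+ 2 * t + 0).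
  by apply: cP; rewrite ?cReM ?cImM /=; ring.
by apply/rderP; split; [exact: is_derive_cos|exact: is_derive_sin].
Qed.

Lemma unit_circle_loop : unit_circle 1 = unit_circle 0.
Proof.
by rewrite /unit_circle !addr0 mulr1 mulr0 cos2pi sin2pi cos0 sin0.
Qed.

Lemma cmod_unit_circle t : cmod (unit_circle t) = 1.
Proof. by rewrite /cmod normc_def /= cos2Dsin2 sqrtr1. Qed.

Variable r : R.
Hypothesis r0 : 0 < r.

Definition circle (t : R) : C := rc r * unit_circle t.

(** 2 pi i. As the derivative of [circle] is [tau * circle], the mean of h (circle t) * circle t is
    the contour integral of h divided by 2 pi i. *)
Let tau : C := rc (pi *+ 2) * I.

Let tau0 : tau != 0.
Proof.
apply: mulf_neq0; last by rewrite -cmod_eq0 cmod_ii oner_eq0.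
by rewrite fmorph_eq0 gt_eqF // mulr2n addr_gt0 ?pi_gt0.
Qed.

Lemma rder_circle t : rder circle t (tau * circle t).
Proof.
have -> : tau * circle t = rc r * (rc (pi *+ 2) * (I * unit_circle t)).
  by rewrite /circle /tau; ring.
exact: dif_scale (rder_unit_circle t).
Qed.

Lemma cmod_circle t : cmod (circle t) = r.
Proof. by rewrite cmodM cmod_unit_circle mulr1 cmod_rc gtr0_norm. Qed.

Lemma circle_neq0 t : circle t != 0.
Proof. by rewrite -cmod_gt0 cmod_circle. Qed.

Lemma circle_loop : circle 1 = circle 0.
Proof. by rewrite /circle unit_circle_loop. Qed.

Lemma continuous_circle : continuous circle.
Proof. by move=> t; exact: rder_cont (rder_circle t). Qed.

Lemma circle_sub_neq0 a t : cmod a < r -> circle t - a != 0.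
Proof.
move=> ar; rewrite -cmod_gt0; apply: lt_le_trans (cmod_sub _ _).
by rewrite cmod_circle subr_gt0.
Qed.

(** Up to the factor 1 / tau, the integrand is the derivative of F along a closed curve. The
    parameters b and s serve the circles contracted towards a point in Cauchy's formula. *)
Lemma cmean_primitive (F h : C -> C) (b : C) (s : R) :
  (forall t, cder F (b + rc s * circle t) (h (b + rc s * circle t))) ->
  cmean (fun t => h (b + rc s * circle t) * (rc s * circle t)) = 0.
Proof.
move=> Fh.
rewrite (@cmeanE _ (fun t => tau^-1 * F (b + rc s * circle t))).
  by rewrite circle_loop subrr.
move=> t _.
have hc : rder (fun t => b + rc s * circle t) t (rc s * (tau * circle t)).
  have := dif_add (dif_cst _ b) (dif_scale (rc s) (rder_circle t)).
  by rewrite add0r.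
have := dif_scale tau^-1 (rder_comp hc (Fh t)).
have -> : tau^-1 * (h (b + rc s * circle t) * (rc s * (tau * circle t))) =
  h (b + rc s * circle t) * (rc s * circle t) by field.
by [].
Qed.

Lemma cmean_circle : cmean circle = 0.
Proof.
have := @cmean_primitive id (fun=> 1) 0 1 (fun t => cder_id _).
by under [fun t => _]eq_fun do rewrite rmorph1 !mul1r.
Qed.

(** Away from 0, the function z^-(k+2) has the primitive - z^-(k+1) / (k+1); one factor z is
    absorbed by the derivative of the circle. *)
Lemma cmean_circleV k : cmean (fun t => (circle t)^-1 ^+ k.+1) = 0.
Proof.
pose c : C := (k.+1%:R)^-1.
have k0 : k.+1%:R != 0 :> C by rewrite pnatr_eq0.
have := @cmean_primitive (fun z => - c * z^-1 ^+ k.+1)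
  (fun z => z^-1 ^+ k.+2) 0 1.
have -> : (fun t => (0 + rc 1 * circle t)^-1 ^+ k.+2 * (rc 1 * circle t)) =
    (fun t => (circle t)^-1 ^+ k.+1).
  apply/funext => t; rewrite rmorph1 add0r mul1r exprSr mulrVK //.
  by rewrite unitfE circle_neq0.
apply=> t; rewrite rmorph1 add0r mul1r; set z := circle t.
have z0 : z != 0 by exact: circle_neq0.
have := dif_scale (- c) (cder_comp (cder_inv z0) (cder_exp z^-1 k)).
have -> : - c * (k.+1%:R * z^-1 ^+ k * - z ^- 2) = z^-1 ^+ k.+2.
  rewrite /c -[k.+2]addn2 exprD exprVn; field.
  by rewrite expf_neq0 // z0 -mulrS k0.
by [].
Qed.

Lemma curve_contD (u v : R -> C) : continuous u -> continuous v ->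
  continuous (fun t => u t + v t).
Proof. by move=> cu cv t; apply: cvgD; [exact: cu|exact: cv]. Qed.

Lemma curve_contM (u v : R -> C) : continuous u -> continuous v ->
  continuous (fun t => u t * v t).
Proof. by move=> cu cv t; apply: cvgM; [exact: cu|exact: cv]. Qed.

Lemma curve_contV (u : R -> C) : continuous u -> (forall t, u t != 0) ->
  continuous (fun t => (u t)^-1).
Proof. by move=> cu u0 t; apply: cvgV => //; exact: cu. Qed.

Lemma curve_contX (u : R -> C) n : continuous u -> continuous (fun t => u t ^+ n).
Proof.
move=> cu; elim: n => [|n IH]; first by move=> t; exact: cvg_cst.
by under [fun t => _]eq_fun do rewrite exprS; exact: curve_contM.
Qed.

Lemma curve_cont_cst (c : C) : continuous (fun _ : R => c).
Proof. by move=> t; exact: cvg_cst. Qed.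

Lemma continuous_circleB a : continuous (fun t => circle t - a).
Proof. exact: curve_contD continuous_circle (@curve_cont_cst _). Qed.

Lemma continuous_circleBV a : cmod a < r -> continuous (fun t => (circle t - a)^-1).
Proof. by move=> ar; apply: curve_contV; [exact: continuous_circleB|move=> t; exact: circle_sub_neq0]. Qed.

Lemma continuous_kernel a : cmod a < r -> continuous (fun t => circle t / (circle t - a)).
Proof. by move=> ar; apply: curve_contM; [exact: continuous_circle|exact: continuous_circleBV]. Qed.

Lemma continuous_circleVX n : continuous (fun t => (circle t)^-1 ^+ n).
Proof.
apply: curve_contX; apply: curve_contV; [exact: continuous_circle|exact: circle_neq0].
Qed.

(** The finite geometric series of z / (z - a) in a / z with its exact remainder, so that sums and
    means are exchanged only finitely often. *)
Lemma kernel_expansion g a n : continuous g -> cmod a < r ->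
  cmean (fun t => g t * (circle t / (circle t - a))) =
  \sum_(k < n) cmean (fun t => g t * (circle t)^-1 ^+ k) * a ^+ k +
  a ^+ n * cmean (fun t => g t * (circle t)^-1 ^+ n * (circle t / (circle t - a))).
Proof.
move=> cg ar; elim: n => [|n ->].
  rewrite big_ord0 expr0 mul1r add0r; congr cmean; apply/funext => t.
  by rewrite expr0 mulr1.
rewrite big_ord_recr /= -addrA; congr (_ + _).
have cn k : continuous (fun t => g t * (circle t)^-1 ^+ k).
  exact: curve_contM cg (@continuous_circleVX k).
have -> : (fun t => g t * (circle t)^-1 ^+ n * (circle t / (circle t - a))) =
  (fun t => a * (g t * (circle t)^-1 ^+ n.+1 * (circle t / (circle t - a))) +
    g t * (circle t)^-1 ^+ n).
  apply/funext => t; rewrite exprS; field.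
  by rewrite circle_neq0 circle_sub_neq0.
rewrite (cmean_scaleD _ (curve_contM (cn n.+1) (continuous_kernel ar)) (cn n)).
by rewrite exprS; ring.
Qed.

(** For |a| <= r / 2 the points of the circle are at distance at least r / 2 from a, so the kernel
    is bounded by 2. *)
Lemma kernel_remainder g a n (M : R) : continuous g -> cmod a <= r / 2 ->
  (forall t, cmod (g t) <= M) ->
  cmod (a ^+ n *
    cmean (fun t => g t * (circle t)^-1 ^+ n * (circle t / (circle t - a)))) <=
  2 * M * (cmod a / r) ^+ n.
Proof.
move=> cg ar gM; have ar' : cmod a < r by move: r0 ar; lra.
rewrite cmodM cmodX expr_div_n mulrCA ler_wpM2l ?exprn_ge0 ?cmod_ge0 //.
apply: cmean_le => [|t _].
  exact: curve_contM (curve_contM cg (@continuous_circleVX n)) (continuous_kernel ar').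
rewrite cmodM [cmod (g t * _)]cmodM [cmod (_ / _)]cmodM cmodX !cmodV cmod_circle exprVn.
have d0 : r / 2 <= cmod (circle t - a).
  by apply: le_trans (cmod_sub _ _); rewrite cmod_circle; lra.
have dp : 0 < cmod (circle t - a) by apply: lt_le_trans d0; rewrite divr_gt0.
have r2 : r / cmod (circle t - a) <= 2 by rewrite ler_pdivrMr //; lra.
have rn : 0 <= (r ^+ n)^-1 by rewrite invr_ge0 exprn_ge0 // ltW.
have M0 : 0 <= M := le_trans (cmod_ge0 _) (gM t).
rewrite [2 * M]mulrC [M * 2 * _]mulrAC; apply: ler_pM => //.
- by rewrite mulr_ge0 ?cmod_ge0.
- by apply: divr_ge0; [exact: ltW|exact: cmod_ge0].
- by rewrite ler_wpM2r.
Qed.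

(** The winding number of the circle around a. In the kernel expansion of the constant 1 all terms
    but the first are means of negative powers, which vanish, and the remainder tends to 0. *)
Lemma cmean_kernel a : cmod a <= r / 2 ->
  cmean (fun t => circle t / (circle t - a)) = 1.
Proof.
move=> ar; have ar' : cmod a < r by move: r0 ar; lra.
apply/eqP; rewrite -subr_eq0; apply/eqP/cmod_small => e e0.
have [n nP] := half_pow_lt 1 e0.
(* Raising the exponent above n absorbs the factor 2 of the remainder bound. *)
have h := @kernel_expansion (fun=> 1) a n.+2 (@curve_cont_cst 1) ar'.
have := @kernel_remainder (fun=> 1) a n.+2 1 (@curve_cont_cst 1) ar.
rewrite cmod1 => /(_ (fun=> lexx _)).
set E := _ * _ in h * => hE.
have -> : cmean (fun t => circle t / (circle t - a)) - 1 = E.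
  have -> : (fun t => circle t / (circle t - a)) =
    (fun t => 1 * (circle t / (circle t - a))) by apply/funext => t; rewrite mul1r.
  rewrite h big_ord_recl big1 => [|k _]; last first.
    have -> : (fun t => 1 * (circle t)^-1 ^+ lift ord0 k) =
      (fun t => (circle t)^-1 ^+ k.+1) by apply/funext => t; rewrite mul1r.
    by rewrite cmean_circleV mul0r.
  have -> : (fun t => 1 * (circle t)^-1 ^+ (ord0 : 'I_n.+2)) = (fun=> 1).
    by apply/funext => t; rewrite mul1r expr0.
  by rewrite cmean_cst expr0 mulr1 addr0 addrC addKr.
apply: (le_trans hE); apply: le_trans (ltW nP).
rewrite mulr1 mul1r -exprVn.
have q : cmod a / r <= 2^-1 by rewrite ler_pdivrMr // mulrC.
have q0 : 0 <= cmod a / r by apply: divr_ge0; [exact: cmod_ge0|exact: ltW].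
apply: (le_trans (ler_wpM2l _ (lerXn2r n.+2 _ _ q))); rewrite ?nnegrE //.
rewrite exprS mulrA mulfV // mul1r exprS ler_piMl ?exprn_ge0 //; lra.
Qed.

(** * Cauchy's formula by contraction of the circle towards the point *)

Section CauchyFormula.
Variables (f df : C -> C) (rho : R).
Hypothesis r_rho : r < rho.
Hypothesis fder : forall z, cmod z < rho -> cder f z (df z).
Hypothesis dfc : forall z, cmod z < rho -> {for z, continuous df}.
Variable a : C.
Hypothesis ar : cmod a < r.

Let w t := circle t - a.
Let pt (s : R) t := a + rc s * w t.

Let pt_in s t : 0 <= s <= 1 -> cmod (pt s t) < rho.
Proof.
move=> /andP[s0 s1]; have -> : pt s t = rc (1 - s) * a + rc s * circle t.
  by rewrite /pt /w rmorphB rmorph1 /=; ring.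
apply: (le_lt_trans (cmodD _ _)); rewrite cmodM [cmod (rc s * _)]cmodM !cmod_rc cmod_circle.
rewrite !ger0_norm ?subr_ge0 //.
apply: le_lt_trans r_rho.
have : (1 - s) * cmod a <= (1 - s) * r by rewrite ler_wpM2l ?subr_ge0 // ltW.
lra.
Qed.

Let w_le t : cmod (w t) <= 2 * r.
Proof. by apply: (le_trans (cmodB _ _)); rewrite cmod_circle; move: ar; lra. Qed.

Let w_neq0 t : w t != 0. Proof. exact: circle_sub_neq0. Qed.

Lemma continuous_segment s : continuous (pt s).
Proof. exact: curve_contD (@curve_cont_cst _) (curve_contM (@curve_cont_cst _) (@continuous_circleB a)). Qed.

(** Continuity of df at each point of the contracted circle, made uniform in t by [cousin]: the
    radius d belongs to the relation, and adjacent intervals take the smaller one. *)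
Let uniform s (e : R) : 0 <= s <= 1 -> 0 < e -> exists2 d : R, 0 < d &
  forall t s', 0 <= t <= 1 -> 0 <= s' <= 1 -> `|s' - s| < d ->
    cmod (df (pt s' t) - df (pt s t)) <= e.
Proof.
move=> sI e0.
suff [d d0 hd] : exists2 d : R, 0 < d & forall t, 0 <= t <= 1 ->
    forall s', 0 <= s' <= 1 -> `|s' - s| < d -> cmod (df (pt s' t) - df (pt s t)) <= e.
  by exists d => // t s' tI; exact: hd.
apply: (@cousin R 0 1 (fun t1 t2 => exists2 d : R, 0 < d &
  forall t, t1 <= t <= t2 ->
  forall s', 0 <= s' <= 1 -> `|s' - s| < d -> cmod (df (pt s' t) - df (pt s t)) <= e)).
- exact: ler01.
- move=> t1 t2 t3 _ _ _ _ [d d0 hd] [d' d'0 hd'].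
  exists (Num.min d d') => [|t /andP[h1 h3] s' s'I]; first by rewrite lt_min d0.
  rewrite lt_min => /andP[g1 g2].
  have [h2|/ltW h2] := leP t t2; first by apply: hd => //; rewrite h1.
  by apply: hd' => //; rewrite h2.
move=> t tI.
have e2 : 0 < e / 2 by rewrite divr_gt0.
have /contCCP/(_ _ e2)[n n0 hn] := dfc (pt_in t sI).
have n2 : 0 < n / 2 by rewrite divr_gt0.
have /contRP/(_ _ n2)[d d0 hd] := @continuous_circleB a t.
exists (Num.min d (n / (4 * r))).
  by rewrite lt_min d0 divr_gt0 // mulr_gt0.
move=> t1 t2 _ h1 h2 _; rewrite lt_min => /andP[h3 _].
exists (n / (4 * r)); first by rewrite divr_gt0 // mulr_gt0.
move=> t' /andP[h4 h5] s' s'I hs'.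
have wt : cmod (w t' - w t) < n / 2.
  by apply: hd; rewrite ltr_norml; apply/andP; split; lra.
have s01 : `|s| <= 1 by case/andP: sI => ? ?; rewrite ger0_norm.
have p1 : cmod (pt s t' - pt s t) < n / 2.
  have -> : pt s t' - pt s t = rc s * (w t' - w t) by rewrite /pt; ring.
  rewrite cmodM cmod_rc; apply: le_lt_trans wt.
  by rewrite ler_piMl ?cmod_ge0.
have p2 : cmod (pt s' t' - pt s t) < n.
  have -> : pt s' t' - pt s t = rc (s' - s) * w t' + (pt s t' - pt s t).
    by rewrite /pt rmorphB /=; ring.
  apply: (le_lt_trans (cmodD _ _)); rewrite cmodM cmod_rc.
  have : `|s' - s| * cmod (w t') <= n / (4 * r) * (2 * r).
    by apply: ler_pM; rewrite ?cmod_ge0 ?normr_ge0 //; exact: ltW.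
  have -> : n / (4 * r) * (2 * r) = n / 2 by field; rewrite gt_eqF.
  lra.
have q1 := hn _ p2; have q2 := hn (pt s t').
have -> : df (pt s' t') - df (pt s t') =
  (df (pt s' t') - df (pt s t)) - (df (pt s t') - df (pt s t)) by ring.
apply: (le_trans (cmodB _ _)).
have {}q2 : cmod (df (pt s t') - df (pt s t)) < e / 2 by apply: q2; lra.
by move: q1 q2; lra.
Qed.

Let G s t := (f (pt s t) - f a) / w t * circle t.

Lemma continuous_quotient s : 0 <= s <= 1 -> continuous (G s).
Proof.
move=> sI; apply: curve_contM; last exact: continuous_circle.
apply: curve_contM; last exact: continuous_circleBV.
apply: curve_contD; last exact: curve_cont_cst.
move=> t; apply: (@continuous_comp _ _ _ (pt s) f); first exact: continuous_segment.
exact: cder_cont (fder (pt_in t sI)).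
Qed.

Lemma continuous_derivative s : 0 <= s <= 1 -> continuous (fun t => df (pt s t) * circle t).
Proof.
move=> sI; apply: curve_contM; last exact: continuous_circle.
move=> t; apply: (@continuous_comp _ _ _ (pt s) df); first exact: continuous_segment.
exact: dfc (pt_in t sI).
Qed.

(** f is a primitive of df, so [cmean_primitive] applies once rc s is divided out. At s = 0 the
    curve shrinks to a, and the mean of [circle] itself vanishes. *)
Let dG0 s : 0 <= s <= 1 -> cmean (fun t => df (pt s t) * circle t) = 0.
Proof.
move=> /andP[]; rewrite le_eqVlt => /orP[/eqP <- _|s0 s1].
  have -> : (fun t => df (pt 0 t) * circle t) = (fun t => df a * circle t).
    by apply/funext => t; rewrite /pt rmorph0 /= mul0r addr0.
  by rewrite (cmean_scale _ continuous_circle) cmean_circle mulr0.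
have sI : 0 <= s <= 1 by rewrite (ltW s0).
have rs0 : rc s != 0 by rewrite fmorph_eq0 gt_eqF.
have ptE t : pt s t = (a - rc s * a) + rc s * circle t by rewrite /pt /w; ring.
have := @cmean_primitive f df (a - rc s * a) s.
have -> : (fun t => df (a - rc s * a + rc s * circle t) * (rc s * circle t)) =
    (fun t => rc s * (df (pt s t) * circle t)).
  by apply/funext => t; rewrite ptE; ring.
rewrite (cmean_scale _ (continuous_derivative sI)) => H.
apply: (mulfI rs0); rewrite mulr0; apply: H => t.
by rewrite -ptE; exact: fder (pt_in t sI).
Qed.

Let phi s := cmean (G s).

(* The mean of the difference quotient over the circle contracted towards [a]
   by the factor s has zero derivative in s and vanishes at s = 0. *)
Lemma cauchy_quotient : cmean (fun t => (f (circle t) - f a) / (circle t - a) *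
  circle t) = 0.
Proof.
have -> : (fun t => (f (circle t) - f a) / (circle t - a) * circle t) = G 1.
  apply/funext => t; rewrite /G /pt rmorph1 /= mul1r /w.
  by rewrite [a + _]addrC subrK.
have G0 : cmean (G 0) = 0.
  rewrite -[RHS](cmean_cst 0); congr cmean; apply/funext => t.
  by rewrite /G /pt rmorph0 /= mul0r addr0 subrr !mul0r.
have -> : cmean (G 1) = cmean (G 1) - cmean (G 0) by rewrite G0 subr0.
apply/eqP; rewrite -cmod_eq0 eq_le cmod_ge0 andbT.
rewrite -[leRHS](mul0r (1 - 0)).
apply: (@mean_value_within _ phi) => [|s sI]; first exact: ler01.
exists 0; first by rewrite cmod0.
move=> e e0; have er : 0 < e / r by rewrite divr_gt0.
have [d d0 hd] := uniform sI er; exists d => // s' s'I ss'.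
rewrite mul0r subr0.
(* The increment of G from s to s' minus its linear part in s' - s; that linear part has mean zero
   by [dG0]. *)
pose D t := (f (pt s' t) - f (pt s t) - rc (s' - s) * w t * df (pt s t)) / w t * circle t.
have DE : phi s' - phi s = cmean D.
  have -> : D = fun t => - rc (s' - s) * (df (pt s t) * circle t) +
      (-1 * G s t + G s' t).
    by apply/funext => t; rewrite /D /G; field; exact: w_neq0.
  rewrite cmean_scaleD; [|exact: continuous_derivative|]; last first.
    exact: curve_contD (curve_contM (@curve_cont_cst _) (continuous_quotient sI)) (continuous_quotient s'I).
  by rewrite cmean_scaleD; [rewrite dG0 // /phi; ring|exact: continuous_quotient|exact: continuous_quotient].
have cD : continuous D.
  apply: curve_contM; last exact: continuous_circle.
  apply: curve_contM; last exact: continuous_circleBV.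
  have cf s1 : 0 <= s1 <= 1 -> continuous (fun t => f (pt s1 t)).
    move=> s1I t; apply: (@continuous_comp _ _ _ (pt s1) f); first exact: continuous_segment.
    exact: cder_cont (fder (pt_in t s1I)).
  have cN u : continuous u -> continuous (fun t => - u t).
    by move=> cu t; apply: cvgN; exact: cu.
  apply: curve_contD; first by apply: curve_contD; [exact: cf|apply: cN; exact: cf].
  apply: cN; apply: curve_contM; first exact: curve_contM (@curve_cont_cst _) (@continuous_circleB a).
  move=> t; apply: (@continuous_comp _ _ _ (pt s) df); first exact: continuous_segment.
  exact: dfc (pt_in t sI).
rewrite DE; apply: cmean_le => // t tI.
have w0 := w_neq0 t.
have -> : e * `|s' - s| = (e / r * cmod (w t)) * `|s' - s| / cmod (w t) * r.
  by field; rewrite cmod_eq0 w0 gt_eqF.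
rewrite /D cmodM cmod_circle cmodM cmodV ler_wpM2r ?(ltW r0) //.
rewrite ler_wpM2r ?invr_ge0 ?cmod_ge0 //.
have -> : f (pt s' t) - f (pt s t) - rc (s' - s) * w t * df (pt s t) =
  (f (pt s' t) - rc s' * (w t * df (pt s t))) -
  (f (pt s t) - rc s * (w t * df (pt s t))) by rewrite rmorphB /=; ring.
have btw x : Num.min s s' <= x <= Num.max s s' ->
    0 <= x <= 1 /\ `|x - s| <= `|s' - s|.
  case/andP: sI => ? ?; case/andP: s'I => ? ?.
  have [ss|ss] := leP s s' => /andP[? ?]; (split; first by apply/andP; split; lra).
    by rewrite !ger0_norm ?subr_ge0 //; lra.
  by rewrite !ler0_norm ?subr_le0 //; lra.
apply: (@mean_value_abs _ (fun x => f (pt x t) - rc x * (w t * df (pt s t)))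
  (fun x => df (pt x t) * w t - w t * df (pt s t))) => x /btw[xI xs].
  have h1 : rder (fun x => pt x t) x (w t) by exact: rder_affine.
  have h2 := rder_comp h1 (fder (pt_in t xI)).
  have := rder_affine 0 (w t * df (pt s t)) x.
  under [fun s => _]eq_fun do rewrite add0r.
  exact: dif_sub h2.
have -> : df (pt x t) * w t - w t * df (pt s t) = (df (pt x t) - df (pt s t)) * w t by ring.
rewrite cmodM ler_wpM2r ?cmod_ge0 //; apply: hd => //.
exact: le_lt_trans ss'.
Qed.

End CauchyFormula.

End CircleMean.

Section Taylor.
Variable R : realType.
Local Notation C := (Cplx R).

(** [cauchy_quotient] and [cmean_kernel] together give Cauchy's formula, and the kernel is then
    expanded. Finite sums with an explicit remainder for every n take the place of a convergent
    series. *)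
Lemma taylor0 (f df : C -> C) (rho r M : R) : 0 < r -> r < rho ->
  (forall z, cmod z < rho -> cder f z (df z)) ->
  (forall z, cmod z < rho -> {for z, continuous df}) ->
  (forall z, cmod z = r -> cmod (f z) <= M) ->
  exists c : nat -> C, forall a, cmod a <= r / 2 -> forall n,
    cmod (f a - \sum_(k < n) c k * a ^+ k) <= 2 * M * (cmod a / r) ^+ n.
Proof.
move=> r0 rr fder dfc fM.
pose g t := f (circle r t).
have cg : continuous g.
  move=> t; apply: (@continuous_comp _ _ _ (circle r) f); first exact: continuous_circle.
  by apply: cder_cont (fder _ _); rewrite cmod_circle.
exists (fun k => cmean (fun t => g t * (circle r t)^-1 ^+ k)) => a ar n.
have ar' : cmod a < r by move: r0 ar; lra.
have E := kernel_expansion r0 n cg ar'.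
have := @kernel_remainder _ _ r0 g a n M cg ar.
set S := \sum_(k < n) _ in E *; set T := _ * _ in E * => H.
suff -> : f a - S = T by apply: H => t; apply: fM; rewrite cmod_circle.
suff -> : f a = cmean (fun t => g t * (circle r t / (circle r t - a))).
  by rewrite E addrC addKr.
have ck : continuous (fun t => circle r t / (circle r t - a)).
  move=> t; apply: cvgM; first exact: continuous_circle.
  apply: cvgV; first exact: circle_sub_neq0.
  by apply: cvgB; [exact: continuous_circle|exact: cvg_cst].
have cgk : continuous (fun t => g t * (circle r t / (circle r t - a))).
  by move=> t; apply: cvgM; [exact: cg|exact: ck].
have := cauchy_quotient r0 rr fder dfc ar'.
have -> : (fun t => (f (circle r t) - f a) / (circle r t - a) * circle r t) =
  (fun t => - f a * (circle r t / (circle r t - a)) +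
    g t * (circle r t / (circle r t - a))) by apply/funext => t; rewrite /g; ring.
rewrite (cmean_scaleD _ ck cgk) (cmean_kernel r0 ar) mulr1 => /eqP.
by rewrite addrC subr_eq0 => /eqP.
Qed.

Lemma taylor (f df : C -> C) (z0 : C) (rho r M : R) : 0 < r -> r < rho ->
  (forall z, cmod (z - z0) < rho -> cder f z (df z)) ->
  (forall z, cmod (z - z0) < rho -> {for z, continuous df}) ->
  (forall z, cmod (z - z0) = r -> cmod (f z) <= M) ->
  exists c : nat -> C, forall a, cmod a <= r / 2 -> forall n,
    cmod (f (z0 + a) - \sum_(k < n) c k * a ^+ k) <= 2 * M * (cmod a / r) ^+ n.
Proof.
move=> r0 rr fder dfc fM.
have sh z : z0 + z - z0 = z by rewrite addrC addKr.
apply: (@taylor0 (fun z => f (z0 + z)) (fun z => df (z0 + z)) rho) => // z zr.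
- have := fder (z0 + z); rewrite sh => /(_ zr) h.
  by apply: dif_ext h _; exists 1 => // k _; rewrite addrA.
- apply: (@continuous_comp _ _ _ (fun z => z0 + z) df).
    apply/contCCP => e e0; exists e => // s.
    by have -> : z0 + s - (z0 + z) = s - z by ring.
  by apply: dfc; rewrite sh.
- by apply: fM; rewrite sh.
Qed.

End Taylor.

(** * Holomorphy of derivatives, isolated zeros, real parts *)

Section Holomorphic.
Variable R : realType.
Local Notation C := (Cplx R).
Implicit Types (f g df : C -> C) (z : C).

Lemma quadratic_cder g z c (r K : R) : 0 < r ->
  (forall h, cmod h < r -> cmod (g (z + h) - g z - c * h) <= K * cmod h ^+ 2) ->
  cder g z c.
Proof.
move=> r0 hK e e0; pose K' := `|K| + 1.
have K'0 : 0 < K' by rewrite ltr_wpDl.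
exists (Num.min r (e / K')); first by rewrite lt_min r0 divr_gt0.
move=> h /=; rewrite lt_min => /andP[/hK h1]; rewrite ltr_pdivlMr // => h2.
apply: (le_trans h1); rewrite expr2 mulrA ler_wpM2r ?cmod_ge0 //.
apply: le_trans (ltW h2); rewrite mulrC ler_wpM2l ?cmod_ge0 //.
by apply: (le_trans (ler_norm K)); rewrite lerDl.
Qed.

(* The difference [f (z + 2h) - f z] is expanded around [z + h] and around [z]. *)
Lemma quadratic_derivative f df (z0 : C) (rho : R) : 0 < rho ->
  (forall z, cmod (z - z0) < rho -> cder f z (df z)) ->
  (forall z, cmod (z - z0) < rho -> {for z, continuous df}) ->
  exists2 r : R, 0 < r <= rho & exists (K : R) (c : C -> C),
    forall z h, cmod (z - z0) < r -> cmod h < r ->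
      cmod (df (z + h) - df z - c z * h) <= K * cmod h ^+ 2.
Proof.
move=> rho0 fder dfc.
have z00 : cmod (z0 - z0) < rho by rewrite subrr cmod0.
have /contCCP/(_ _ ltr01)[r0 r00 hr0] := cder_cont (fder _ z00).
pose M := cmod (f z0) + 1.
pose r1 := Num.min r0 rho.
have r10 : 0 < r1 by rewrite lt_min r00.
have r1r0 : r1 <= r0 by rewrite ge_min lexx.
have r1rho : r1 <= rho by rewrite ge_min lexx orbT.
have fM z : cmod (z - z0) < r1 -> cmod (f z) <= M.
  move=> /lt_le_trans/(_ r1r0)/hr0 h.
  have -> : f z = (f z - f z0) + f z0 by ring.
  by apply: (le_trans (cmodD _ _)); rewrite /M addrC lerD2l ltW.
have tay z : cmod (z - z0) < r1 / 2 -> exists c : nat -> C,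
    forall a, cmod a <= r1 / 8 -> forall n,
    cmod (f (z + a) - \sum_(k < n) c k * a ^+ k) <= 2 * M * (cmod a / (r1 / 4)) ^+ n.
  move=> zr.
  have inn w : cmod (w - z) < r1 / 2 -> cmod (w - z0) < r1.
    move=> wz; have -> : w - z0 = (w - z) + (z - z0) by ring.
    by apply: (le_lt_trans (cmodD _ _)); lra.
  have [|||||c hc] := @taylor R f df z (r1 / 2) (r1 / 4) M.
  - by rewrite divr_gt0.
  - lra.
  - by move=> w /inn h; apply: fder; exact: lt_le_trans r1rho.
  - by move=> w /inn h; apply: dfc; exact: lt_le_trans r1rho.
  - by move=> w wz; apply: fM; apply: inn; rewrite wz; lra.
  by exists c => a ar; apply: hc; move: ar; lra.
pose K0 := 2 * M * (r1 / 4)^-1 ^+ 3.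
have third z : exists c, cmod (z - z0) < r1 / 2 ->
    forall a, cmod a <= r1 / 8 ->
    cmod (f (z + a) - f z - df z * a - c * a ^+ 2) <= K0 * cmod a ^+ 3.
  have [zr|nzr] := pselect (cmod (z - z0) < r1 / 2); last by exists 0.
  have [c hc] := tay _ zr.
  (* The first two coefficients are identified from the estimate itself: at a = 0, and by uniqueness
     of the derivative. *)
  have c0 : c 0%N = f z.
    have := hc 0; rewrite cmod0 => /(_ ltac:(by rewrite divr_ge0 // ltW) 1%N).
    rewrite big_ord1 expr0 mulr1 addr0 mul0r expr1 mulr0 => h.
    apply/esym/eqP; rewrite -subr_eq0 -cmod_eq0 eq_le h; exact: cmod_ge0.
  have c1 : c 1%N = df z.
    have fz : cder f z (df z) by apply: fder; move: zr r1rho r10; lra.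
    apply: cder_uniq fz.
    apply: (@quadratic_cder _ _ _ (r1 / 8) (2 * M * (r1 / 4)^-1 ^+ 2)) => [|h hr].
      by rewrite divr_gt0.
    have := hc _ (ltW hr) 2%N.
    rewrite big_ord_recr big_ord1 /= c0 expr0 mulr1 expr1 opprD addrA => h2.
    by apply: (le_trans h2); rewrite expr_div_n -exprVn; lra.
  exists (c 2%N) => _ a ar; have := hc _ ar 3%N.
  rewrite !big_ord_recr big_ord0 /= c0 c1 expr0 expr1 mulr1 add0r !opprD !addrA.
  by move=> h2; apply: (le_trans h2); rewrite expr_div_n -exprVn /K0; lra.
have [c hc] := choice third.
(* The increment 2h must stay within the radius r1 / 8 of the expansions. *)
exists (r1 / 16); first by apply/andP; split; [rewrite divr_gt0|move: r1rho r10; lra].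
(* The expansions at z + h in h and - h contribute K0 |h|^3 each, the one at z in 2h contributes 8
   K0 |h|^3; the total 10 K0 |h|^3 is divided by 2 |h|. The unknown coefficient c (z + h) cancels
   between the first two. *)
exists (5 * K0), (fun z => 2 * c z) => z h zr hr.
have [->|h0] := eqVneq h 0.
  by rewrite addr0 subrr mulr0 subrr cmod0 expr0n /= mulr0.
have zh : cmod (z + h - z0) < r1 / 2.
  have -> : z + h - z0 = (z - z0) + h by ring.
  by apply: (le_lt_trans (cmodD _ _)); lra.
have zr2 : cmod (z - z0) < r1 / 2 by lra.
have E1 := hc _ zh h ltac:(lra).
have E2 := hc _ zh (- h) ltac:(by rewrite cmodN; lra).
have h2E : cmod (2 * h) = 2 * cmod h.
  by rewrite cmodM -[2 : C](rmorph_nat (@rc R)) cmod_rc ger0_norm.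
have E3 := hc _ zr2 (2 * h) ltac:(by rewrite h2E; lra).
rewrite cmodN in E2; rewrite h2E in E3.
have zhh : z + h + - h = z by ring.
have zh2 : z + h + h = z + 2 * h by ring.
rewrite zhh in E2; rewrite zh2 in E1.
have n0 : 0 < 2 * cmod h by rewrite mulr_gt0 // cmod_gt0.
rewrite -(ler_pM2l n0) -h2E -cmodM.
set k1 := (X in cmod X) in E1; set k2 := (X in cmod X) in E2.
set k3 := (X in cmod X) in E3.
have -> : 2 * h * (df (z + h) - df z - 2 * c z * h) = (k3 - k1) + k2.
  by rewrite /k1 /k2 /k3; ring.
apply: (le_trans (cmodD _ _)); have := cmodB k3 k1; rewrite h2E.
have -> : 2 * cmod h * (5 * K0 * cmod h ^+ 2) = 10 * (K0 * cmod h ^+ 3) by ring.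
have E3' : K0 * (2 * cmod h) ^+ 3 = 8 * (K0 * cmod h ^+ 3) by ring.
by rewrite E3' in E3; lra.
Qed.

(* The preceding lemma applies first to a primitive of [f], whose derivative is
   continuous, and then to [f] itself. *)
Theorem derivative_holomorphic f df (z0 : C) (rho : R) : 0 < rho ->
  (forall z, cmod (z - z0) < rho -> cder f z (df z)) ->
  exists2 r : R, 0 < r <= rho & exists ddf : C -> C,
    forall z, cmod (z - z0) < r -> cder df z (ddf z).
Proof.
move=> rho0 fder; have [P hP] := local_primitive rho0 fder.
have rho4 : 0 < rho / 4 by rewrite divr_gt0.
have [|r /andP[r0 rr] [K [c hK]]] := quadratic_derivative rho4 hP.
  by move=> z zr; apply: cder_cont (fder z _); move: zr rho0; lra.
have cE z : cmod (z - z0) < r -> c z = df z.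
  move=> zr; have fz : cder f z (df z) by apply: fder; move: zr rr rho0; lra.
  by apply: cder_uniq fz; apply: quadratic_cder r0 _ => h hr; exact: hK.
(* The quadratic estimates from z to w and from w back to z add up to one of (df w - df z) (w - z),
   so df is locally Lipschitz. *)
have dfc z : cmod (z - z0) < r -> {for z, continuous df}.
  move=> zr; apply/contCCP => e e0.
  pose K' := 2 * `|K| + 1.
  have K'0 : 0 < K' by rewrite ltr_wpDl // mulr_ge0.
  exists (Num.min (r - cmod (z - z0)) (Num.min r (e / K'))).
    by rewrite !lt_min subr_gt0 zr r0 divr_gt0.
  move=> w; rewrite !lt_min => /andP[w1 /andP[w2]]; rewrite ltr_pdivlMr // => w3.
  have [->|wz] := eqVneq w z; first by rewrite subrr cmod0.
  have n0 : 0 < cmod (w - z) by rewrite cmod_gt0 subr_eq0.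
  have wr : cmod (w - z0) < r.
    have -> : w - z0 = (w - z) + (z - z0) by ring.
    by apply: (le_lt_trans (cmodD _ _)); lra.
  have E1 := hK z (w - z) zr w2.
  have E2 := hK w (z - w) wr ltac:(by rewrite cmodC).
  have zw : z + (w - z) = w by ring.
  have wz' : w + (z - w) = z by ring.
  rewrite zw (cE _ zr) in E1; rewrite wz' (cE _ wr) [cmod (z - w)]cmodC in E2.
  apply: le_lt_trans w3; rewrite -(ler_pM2r n0) -cmodM.
  have -> : (df w - df z) * (w - z) =
    (f w - f z - df z * (w - z)) + (f z - f w - df w * (z - w)) by ring.
  apply: (le_trans (cmodD _ _)); apply: (le_trans (lerD E1 E2)).
  have -> : K * cmod (w - z) ^+ 2 + K * cmod (w - z) ^+ 2 =
    2 * K * (cmod (w - z) ^+ 2) by ring.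
  have -> : cmod (w - z) * K' * cmod (w - z) = K' * cmod (w - z) ^+ 2 by ring.
  rewrite ler_wpM2r ?sqr_ge0 // /K'; have := ler_norm K; lra.
have fder' z : cmod (z - z0) < r -> cder f z (df z).
  by move=> zr; apply: fder; move: zr rr rho0; lra.
have [s /andP[s0 sr] [K2 [c2 hK2]]] := quadratic_derivative r0 fder' dfc.
exists s; first by apply/andP; split=> //; move: sr rr rho0; lra.
by exists c2 => z zs; apply: quadratic_cder s0 _ => h hs; exact: hK2.
Qed.

(** If all Taylor coefficients vanish, the remainder bound M / 2^n forces f = 0 on the disc of
    radius r / 2. Otherwise the first nonzero coefficient dominates the remainder near z0. *)
Theorem isolated_zeros f df (z0 : C) (rho : R) : 0 < rho ->
  (forall z, cmod (z - z0) < rho -> cder f z (df z)) ->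
  (exists2 r : R, 0 < r & forall z, cmod (z - z0) < r -> f z = 0) \/
  (exists2 r : R, 0 < r & forall z, z != z0 -> cmod (z - z0) < r -> f z != 0).
Proof.
move=> rho0 fder; have [s /andP[s0 srho] [ddf hdd]] := derivative_holomorphic rho0 fder.
have z00 : cmod (z0 - z0) < rho by rewrite subrr cmod0.
have /contCCP/(_ _ ltr01)[r0 r00 hr0] := cder_cont (fder _ z00).
pose r1 := Num.min r0 s; pose r := r1 / 2.
have r10 : 0 < r1 by rewrite lt_min r00.
have r1r0 : r1 <= r0 by rewrite ge_min lexx.
have r1s : r1 <= s by rewrite ge_min lexx orbT.
have rpos : 0 < r by rewrite divr_gt0.
have rr1 : r < r1 by rewrite /r; lra.
have [|||c hc] := @taylor R f df z0 r1 r (cmod (f z0) + 1) rpos rr1.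
- by move=> z zr; apply: fder; move: zr r1s srho; lra.
- by move=> z zr; apply: cder_cont (hdd z _); move: zr r1s; lra.
- move=> z zr; have {}zr : cmod (z - z0) < r0 by rewrite zr; move: rr1 r1r0; lra.
  have -> : f z = (f z - f z0) + f z0 by ring.
  by apply: (le_trans (cmodD _ _)); have := hr0 _ zr; lra.
set M := 2 * _ in hc.
have M0 : 0 < M by rewrite mulr_gt0 // ltr_wpDl // cmod_ge0.
have [[m cm]|allc] := pselect (exists m, c m != 0); last first.
  left; exists (r / 2) => [|z zr]; first by rewrite divr_gt0.
  apply: cmod_small => e e0; have [n hn] := half_pow_lt M e0.
  have := hc (z - z0) (ltW zr) n; rewrite [z0 + _]addrC subrK big1 => [|k _]; last first.
    have -> : c k = 0 by apply: contrapT => /eqP ck; apply: allc; exists k.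
    by rewrite mul0r.
  rewrite subr0 => /le_trans; apply; apply: le_trans (ltW hn).
  rewrite ler_wpM2l ?(ltW M0) // -exprVn lerXn2r ?nnegrE ?invr_ge0 //.
    by rewrite divr_ge0 ?cmod_ge0 // ltW.
  by rewrite ler_pdivrMr // mulrC ltW.
right; have ex : exists m, c m != 0 by exists m.
case: (ex_minnP ex) => {m cm} m cm minm.
have cm0 : 0 < cmod (c m) by rewrite cmod_gt0.
(* For 0 < |a| < d the remainder M (|a| / r)^(m+1) is smaller than |c m| |a|^m. *)
pose d := Num.min (r / 2) (cmod (c m) * r ^+ m.+1 / M).
have d0 : 0 < d.
  by rewrite lt_min; apply/andP; split; rewrite ?divr_gt0 // mulr_gt0 // exprn_gt0.
exists d => // z zz0; rewrite lt_min => /andP[z1]; rewrite ltr_pdivlMr // => z2.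
apply/eqP => fz; have := hc (z - z0) (ltW z1) m.+1.
rewrite [z0 + _]addrC subrK fz big_ord_recr /= big1 => [|k _]; last first.
  suff -> : c k = 0 by rewrite mul0r.
  apply/eqP; apply: contraT => ck; have := minm _ ck.
  by rewrite leqNgt ltn_ord.
rewrite !add0r cmodN cmodM cmodX exprSr mulrA expr_div_n.
set n := cmod (z - z0) in z2 *.
have n0 : 0 < n by rewrite cmod_gt0 subr_eq0.
apply/negP; rewrite -ltNge.
have -> : M * (n ^+ m / r ^+ m) * (n / r) = M * n / r ^+ m.+1 * n ^+ m.
  by rewrite exprS; field; rewrite expf_neq0 gt_eqF.
rewrite ltr_pM2r ?exprn_gt0 // ltr_pdivrMr ?exprn_gt0 //.
by rewrite mulrC.
Qed.

Lemma disc_constant f (z0 : C) (rho : R) :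
  (forall z, cmod (z - z0) < rho -> cder f z 0) ->
  forall z, cmod (z - z0) < rho -> f z = f z0.
Proof.
move=> h z zr; apply/eqP; rewrite -subr_eq0 -cmod_eq0 eq_le cmod_ge0 andbT.
pose p t := z0 + rc t * (z - z0).
have -> : f z = (f \o p) 1 by rewrite /p /= rmorph1 mul1r [z0 + _]addrC subrK.
have -> : f z0 = (f \o p) 0 by rewrite /p /= rmorph0 mul0r addr0.
rewrite -[leRHS](mul0r (1 - 0)).
apply: (@mean_value _ _ (fun=> 0)) => [|t /andP[t0 t1]|t _]; first exact: ler01.
  have := rder_comp (rder_affine z0 (z - z0) t) (h (p t) _).
  rewrite mul0r; apply; rewrite /p [z0 + _]addrC addrK cmodM cmod_rc ger0_norm //.
  by apply: le_lt_trans zr; rewrite ler_piMl ?cmod_ge0.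
by rewrite cmod0.
Qed.

(** In the direction k the real part of f has derivative Re (d k); the directions 1 and i recover Re
    d and - Im d. Only the derivatives at the single point z enter. *)
Lemma Re_determines_derivative f g z d d' : cder f z d -> cder g z d' ->
  (\forall w \near z,
     complex.Re (f w) - complex.Re (f z) = complex.Re (g w) - complex.Re (g z)) ->
  d = d'.
Proof.
move=> hf hg /nbhs_cmod[r r0 hr].
suff H k : cmod k = 1 -> complex.Re ((d - d') * k) = 0.
  have h1 := H 1 (cmod1 _); have h2 := H (ii R) (cmod_ii _).
  move: h1 h2; rewrite !cReM /= mulr0 mulr1 mulr0 mulr1 => h1 h2.
  apply/eqP; rewrite -subr_eq0; apply/eqP/cP; rewrite /=; lra.
move=> k1; apply/eqP; rewrite -normr_eq0 eq_le normr_ge0 andbT.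
apply/ler_addgt0Pl => e e0; rewrite addr0.
have [s s0 hs] := dif_sub hf hg e0.
pose t := Num.min (r / 2) (s / 2).
have t0 : 0 < t by rewrite lt_min !divr_gt0.
have tr : t <= r / 2 by rewrite ge_min lexx.
have ts : t <= s / 2 by rewrite ge_min lexx orbT.
have kt : cmod (k * rc t) = t by rewrite cmodM k1 mul1r cmod_rc gtr0_norm.
have := hs (k * rc t); rewrite /= kt => /(_ ltac:(move: s0; lra)) h.
have {}h := le_trans (Re_le _) h.
have := hr (z + k * rc t); rewrite [z + _]addrC addrK kt => /(_ ltac:(move: r0; lra)) h2.
rewrite !cReB in h.
rewrite -(ler_pM2r t0); apply: le_trans h.
rewrite -[X in _ * X]gtr0_norm // -normrM -normrN.
rewrite le_eqVlt; apply/orP; left; apply/eqP; congr `|_|.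
have -> : complex.Re ((d - d') * (k * rc t)) = complex.Re ((d - d') * k) * t.
  by rewrite !cReM !cImM /=; ring.
by rewrite [z + _]addrC; move: h2; lra.
Qed.

End Holomorphic.

(** * Continuation of germs along paths *)

Section Paths.
Variable R : realType.
Variable X : topologicalType.
Implicit Types (c : R -> X).

Definition unit_path c := forall t, 0 <= t <= 1 -> forall A, nbhs (c t) A ->
  exists2 r : R, 0 < r & forall s, 0 <= s <= 1 -> `|s - t| < r -> A (c s).

Lemma unit_pathP c : {within `[0, 1], continuous c} <-> unit_path c.
Proof.
have I t : (`[0, 1]%classic : set R) t = (0 <= t <= 1) :> Prop.
  by rewrite set_itvE.
split=> [/subspace_continuousP h t tI A cA|h].
  have /h /(_ A cA) : (`[0, 1]%classic : set R) t by rewrite I.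
  move=> /nbhs_abs[r r0 hr].
  by exists r => // s sI /hr; apply; rewrite I.
apply/subspace_continuousP => t; rewrite I => tI A cA.
have [r r0 hr] := h t tI A cA; apply/nbhs_abs; exists r => // s st.
by rewrite I => sI; exact: hr.
Qed.

(* The arguments are in the form [k * t + m] of [continuation_affine] and
   [pC1_affine]. *)
Definition path_cat c1 c2 (t : R) : X :=
  if t <= 2^-1 then c1 (2 * t + 0) else c2 (2 * t + - 1).
Definition path_rev c (t : R) : X := c (- 1 * t + 1).

End Paths.

Section Continuation.
Variable R : realType.
Local Notation C := (Cplx R).
Variable X : topologicalType.
(* [G x P]: the germ at x of the locally defined function P is admissible.
   Admissible germs behave like local primitives of a closed form. *)
Variable G : X -> (X -> C) -> Prop.
Hypothesis G_exists : forall x, exists P, G x P.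
Hypothesis G_near : forall x P, G x P -> \forall y \near x, G y P.
Hypothesis G_unique : forall x P Q, G x P -> G x Q ->
  \forall y \near x, P y - P x = Q y - Q x.
Implicit Types (c : R -> X) (u v : R -> C).

(** Analytic continuation along c as a function of the parameter, determined up to a constant. It
    makes sense for merely continuous curves, such as those of a homotopy. *)
Definition continuation c u := forall t, 0 <= t <= 1 -> exists2 P, G (c t) P &
  exists2 r : R, 0 < r & forall s, 0 <= s <= 1 -> `|s - t| < r ->
    u s - u t = P (c s) - P (c t).

Lemma continuation_germ c u t Q : unit_path c -> continuation c u ->
  0 <= t <= 1 -> G (c t) Q -> exists2 r : R, 0 < r &
  forall s, 0 <= s <= 1 -> `|s - t| < r -> u s - u t = Q (c s) - Q (c t).
Proof.
move=> pc cu tI GQ; have [P GP [r r0 hr]] := cu t tI.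
have [r' r'0 hr'] := pc t tI _ (G_unique GP GQ).
exists (Num.min r r') => [|s sI]; first by rewrite lt_min r0.
by rewrite lt_min => /andP[/(hr _ sI) -> /(hr' _ sI)].
Qed.

Lemma continuation_increment c u P a b : unit_path c -> continuation c u ->
  0 <= a -> a <= b -> b <= 1 -> (forall t, a <= t <= b -> G (c t) P) ->
  u b - u a = P (c b) - P (c a).
Proof.
move=> pc cu a0 ab b1 GP.
apply: (@cousin R a b (fun x y => u y - u x = P (c y) - P (c x))) => //.
  move=> x y z _ _ _ _ h1 h2.
  have -> : u z - u x = (u y - u x) + (u z - u y) by ring.
  by rewrite h1 h2; ring.
move=> t tI; have t01 : 0 <= t <= 1 by case/andP: tI => *; apply/andP; split; lra.
have [r r0 hr] := continuation_germ pc cu t01 (GP _ tI).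
exists r => // x y ax xt ty yb yxr.
have hx := hr x; have hy := hr y.
have -> : u y - u x = (u y - u t) - (u x - u t) by ring.
rewrite hx; [|by apply/andP; split; lra|by rewrite ler0_norm; lra].
rewrite hy; [|by apply/andP; split; lra|by rewrite ger0_norm; lra].
by ring.
Qed.

Lemma continuation_unique c u v : unit_path c -> continuation c u ->
  continuation c v -> u 1 - u 0 = v 1 - v 0.
Proof.
move=> pc cu cv.
apply: (@cousin R 0 1 (fun x y => u y - u x = v y - v x)); first exact: ler01.
  move=> x y z _ _ _ _ h1 h2.
  have -> : u z - u x = (u y - u x) + (u z - u y) by ring.
  by rewrite h1 h2; ring.
move=> t tI; have [P GP] := G_exists (c t).
have [r r0 hr] := continuation_germ pc cu tI GP.
have [r' r'0 hr'] := continuation_germ pc cv tI GP.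
exists (Num.min r r') => [|x y ax xt ty yb]; first by rewrite lt_min r0.
rewrite lt_min => /andP[yxr yxr'].
have -> : u y - u x = (u y - u t) - (u x - u t) by ring.
have -> : v y - v x = (v y - v t) - (v x - v t) by ring.
have xI : 0 <= x <= 1 by case/andP: tI => *; apply/andP; split; lra.
have yI : 0 <= y <= 1 by case/andP: tI => *; apply/andP; split; lra.
have xt' : `|x - t| = t - x by rewrite ler0_norm; lra.
have yt' : `|y - t| = y - t by rewrite ger0_norm; lra.
rewrite hr //; last by lra.
rewrite hr //; last by lra.
rewrite hr' //; last by lra.
by rewrite hr' //; lra.
Qed.

(** Locally [P \o c] is a continuation. Two adjacent pieces are glued after the second is shifted by
    a constant; at the junction the germs coming from both sides have equal increments by
    [G_unique]. *)
Lemma continuation_exists c : unit_path c -> exists u, continuation c u.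
Proof.
move=> pc.
pose Q a b := exists u, forall t, a <= t <= b -> exists2 P, G (c t) P &
  exists2 r : R, 0 < r & forall s, a <= s <= b -> `|s - t| < r ->
    u s - u t = P (c s) - P (c t).
apply: (@cousin R 0 1 Q); first exact: ler01.
- move=> a b d a0 ab bd d1 [u hu] [v hv].
  exists (fun t => if t <= b then u t else v t - v b + u b) => t /andP[at_ td].
  have hv' : exists2 P, G (c b) P & exists2 r : R, 0 < r &
      forall s, b <= s <= d -> `|s - b| < r -> v s - v b = P (c s) - P (c b).
    by apply: hv; rewrite lexx.
  have [tb|bt] := ltP t b.
    have [|P GP [r r0 hr]] := hu t; first by rewrite at_ ltW.
    exists P => //; exists (Num.min r (b - t)) => [|s /andP[as_ sd]].
      by rewrite lt_min r0 subr_gt0.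
    rewrite lt_min => /andP[str sb]; have sb' : s <= b.
      by have := ler_norm (s - t); lra.
    by rewrite sb' (ltW tb); apply: hr => //; rewrite as_.
  have [tb|tb] := leP t b; last first.
    have [|P GP [r r0 hr]] := hv t; first by rewrite bt.
    exists P => //; exists (Num.min r (t - b)) => [|s /andP[as_ sd]].
      by rewrite lt_min r0 subr_gt0.
    rewrite lt_min => /andP[str sb]; have sb' : b < s.
      by have := ler_norm (t - s); rewrite distrC; lra.
    rewrite leNgt sb' /=; rewrite -(hr s) //; first by ring.
    by rewrite (ltW sb').
  have tbE : t = b by lra.
  subst t.
  have [|P GP [r r0 hr]] := hu b; first by rewrite ab lexx.
  have [P' GP' [r' r'0 hr']] := hv'.
  have bI : 0 <= b <= 1 by apply/andP; split; lra.
  have [r2 r20 hr2] := pc b bI _ (G_unique GP' GP).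
  exists P => //; exists (Num.min r (Num.min r' r2)) => [|s /andP[as_ sd]].
    by rewrite !lt_min r0 r'0.
  rewrite !lt_min => /and3P[s1 s2 s3].
  have sI : 0 <= s <= 1 by apply/andP; split; lra.
  have [sb|bs] := leP s b; first by apply: hr => //; rewrite as_.
  by rewrite addrK hr' ?(ltW bs) //; exact: hr2.
- move=> t tI; have [P GP] := G_exists (c t).
  have [r r0 hr] := pc t tI _ (G_near GP).
  exists r => // a b a0 at_ tb b1 bar.
  exists (P \o c) => s /andP[as_ sb]; exists P; last by exists 1.
  apply: hr; first by apply/andP; split; lra.
  by rewrite ltr_norml; apply/andP; split; lra.
Qed.

Lemma continuation_affine c c' u k m : continuation c u ->
  (forall t, 0 <= t <= 1 -> 0 <= k * t + m <= 1) ->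
  (forall t, 0 <= t <= 1 -> c' t = c (k * t + m)) ->
  continuation c' (fun t => u (k * t + m)).
Proof.
move=> cu kI c'E t tI; have [P GP [r r0 hr]] := cu _ (kI t tI).
have k1 : 0 < `|k| + 1 by rewrite ltr_wpDl.
exists P; first by rewrite c'E.
exists (r / (`|k| + 1)) => [|s sI st]; first by rewrite divr_gt0.
rewrite !c'E //; apply: hr; first exact: kI.
have -> : k * s + m - (k * t + m) = k * (s - t) by ring.
rewrite normrM; move: st; rewrite ltr_pdivlMr // mulrC.
by apply: le_lt_trans; rewrite ler_wpM2r // lerDl.
Qed.

Definition increment c : C :=
  xget 0 [set d | exists2 u, continuation c u & d = u 1 - u 0].

Lemma incrementE c u : unit_path c -> continuation c u ->
  increment c = u 1 - u 0.
Proof.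
move=> pc cu; rewrite /increment; case: xgetP => [d _ [v cv ->]|/(_ (u 1 - u 0))].
  exact: continuation_unique cv cu.
by case; exists u.
Qed.

Lemma increment_cst x : increment (fun=> x) = 0.
Proof.
have pc : unit_path (fun _ : R => x).
  by move=> t _ A xA; exists 1 => // s _ _; exact: nbhs_singleton.
rewrite (@incrementE _ (fun=> 0) pc) ?subrr // => t _.
have [P GP] := G_exists x; exists P => //; exists 1 => // s _ _.
by rewrite !subrr.
Qed.

Lemma increment_cat c1 c2 : unit_path c1 -> unit_path c2 ->
  unit_path (path_cat c1 c2) -> c1 1 = c2 0 ->
  increment (path_cat c1 c2) = increment c1 + increment c2.
Proof.
move=> p1 p2 p c12; have [u hu] := continuation_exists p.
have u1 : continuation c1 (fun t => u (2^-1 * t + 0)).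
  apply: continuation_affine hu _ _ => t /andP[t0 t1].
    by apply/andP; split; lra.
  rewrite /path_cat ifT; last by lra.
  by congr c1; field.
have u2 : continuation c2 (fun t => u (2^-1 * t + 2^-1)).
  apply: continuation_affine hu _ _ => t /andP[t0 t1].
    by apply/andP; split; lra.
  rewrite /path_cat; case: ifPn => [h|_]; last by congr c2; field.
  have -> : t = 0 by lra.
  by rewrite -c12; congr c1; field.
rewrite (incrementE p hu) (incrementE p1 u1) (incrementE p2 u2).
have -> : 2^-1 * 1 + 0 = 2^-1 * 0 + 2^-1 :> R by ring.
have -> : 2^-1 * 1 + 2^-1 = 1 :> R by field.
have -> : 2^-1 * 0 + 0 = 0 :> R by ring.
by ring.
Qed.

Lemma increment_rev c : unit_path c -> unit_path (path_rev c) ->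
  increment (path_rev c) = - increment c.
Proof.
move=> p pr; have [u hu] := continuation_exists p.
have u1 : continuation (path_rev c) (fun t => u (- 1 * t + 1)).
  apply: continuation_affine hu _ _ => // t /andP[t0 t1].
  by apply/andP; split; lra.
rewrite (incrementE p hu) (incrementE pr u1).
have -> : - 1 * 1 + 1 = 0 :> R by ring.
have -> : - 1 * 0 + 1 = 1 :> R by ring.
by ring.
Qed.

Lemma increment_germ c P : unit_path c ->
  (forall t, 0 <= t <= 1 -> G (c t) P) -> increment c = P (c 1) - P (c 0).
Proof.
move=> pc GP; have [u hu] := continuation_exists pc.
rewrite (incrementE pc hu).
by apply: continuation_increment hu _ _ _ GP; rewrite ?lexx ?ler01.
Qed.

(** The increment is locally constant in s. On a short parameter interval, H s and H s0 run where a
    single germ is admissible, so their increments differ by values of germs at the two ends; these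
    corrections telescope along [0, 1] and vanish at the fixed end points. *)
Lemma increment_homotopy (H : R -> R -> X) :
  (forall s t, 0 <= s <= 1 -> 0 <= t <= 1 -> forall A, nbhs (H s t) A ->
     exists2 r : R, 0 < r & forall s' t', 0 <= s' <= 1 -> 0 <= t' <= 1 ->
       `|s' - s| < r -> `|t' - t| < r -> A (H s' t')) ->
  (forall s, 0 <= s <= 1 -> H s 0 = H 0 0 /\ H s 1 = H 0 1) ->
  increment (H 0) = increment (H 1).
Proof.
move=> cH ends.
have pH s : 0 <= s <= 1 -> unit_path (H s).
  move=> sI t tI A /(cH s t sI tI)[r r0 hr]; exists r => // t' t'I tt.
  by apply: hr => //; rewrite subrr normr0.
have ex s : exists u, 0 <= s <= 1 -> continuation (H s) u.
  have [sI|nsI] := pselect (0 <= s <= 1); last by exists (fun=> 0).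
  by have [u hu] := continuation_exists (pH _ sI); exists u.
have [u hu] := choice ex.
suff loc s0 : 0 <= s0 <= 1 -> exists2 r : R, 0 < r & forall s, 0 <= s <= 1 ->
    `|s - s0| < r -> increment (H s) = increment (H s0).
  apply: (@cousin R 0 1 (fun a b => increment (H a) = increment (H b))).
  - exact: ler01.
  - by move=> a b d _ _ _ _ -> ->.
  move=> s sI; have [r r0 hr] := loc s sI; exists r => // a b a0 as_ sb b1 bar.
  rewrite (hr a) ?(hr b) //; first by apply/andP; split; lra.
  - by rewrite ger0_norm; lra.
  - by apply/andP; split; lra.
  - by rewrite ler0_norm; lra.
move=> s0I.
(* The increment of H s over [t, t'] minus that of H s0 is measured by germs
   at the end points, compared across the two curves. *)
pose Q t t' := forall P P', G (H s0 t) P -> G (H s0 t') P' ->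
  exists2 r : R, 0 < r & forall s, 0 <= s <= 1 -> `|s - s0| < r ->
    (u s t' - u s t) + (P (H s t) - P (H s0 t)) =
    (u s0 t' - u s0 t) + (P' (H s t') - P' (H s0 t')).
have Q01 : Q 0 1.
  apply: (@cousin R 0 1 Q); first exact: ler01.
  - move=> a b d _ _ _ _ Qab Qbd P P' GP GP'.
    have [P2 GP2] := G_exists (H s0 b).
    have [r r0 hr] := Qab _ _ GP GP2; have [r' r'0 hr'] := Qbd _ _ GP2 GP'.
    exists (Num.min r r') => [|s sI]; first by rewrite lt_min r0.
    rewrite lt_min => /andP[/(hr s sI) h1 /(hr' s sI) h2].
    have -> : u s d - u s a + (P (H s a) - P (H s0 a)) =
      (u s b - u s a + (P (H s a) - P (H s0 a))) + (u s d - u s b) by ring.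
    rewrite h1.
    have -> : u s0 b - u s0 a + (P2 (H s b) - P2 (H s0 b)) + (u s d - u s b) =
      u s0 b - u s0 a + (u s d - u s b + (P2 (H s b) - P2 (H s0 b))) by ring.
    by rewrite h2; ring.
  move=> t0 t0I; have [P0 GP0] := G_exists (H s0 t0).
  have [r r0 hr] := cH _ _ s0I t0I _ (G_near GP0).
  exists r => // t t' tge tt0 t0t' t'le ttr P P' GP GP'.
  have near_t0 x : t <= x <= t' -> 0 <= x <= 1 /\ `|x - t0| < r.
    move=> /andP[? ?]; split; first by apply/andP; split; lra.
    by rewrite ltr_norml; apply/andP; split; lra.
  have inc s : 0 <= s <= 1 -> `|s - s0| < r ->
      u s t' - u s t = P0 (H s t') - P0 (H s t).
    move=> sI ss; apply: (continuation_increment (pH s sI) (hu s sI)) => //; first lra.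
    by move=> x /near_t0[xI xt]; exact: hr.
  have cmp x Px : t <= x <= t' -> G (H s0 x) Px -> exists2 r' : R, 0 < r' &
      forall s, 0 <= s <= 1 -> `|s - s0| < r' ->
        Px (H s x) - Px (H s0 x) = P0 (H s x) - P0 (H s0 x).
    move=> /near_t0[xI xt] GPx.
    have GP0x : G (H s0 x) P0 by apply: hr => //; rewrite subrr normr0.
    have [r' r'0 hr'] := cH _ _ s0I xI _ (G_unique GPx GP0x).
    by exists r' => // s sI ss; apply: hr' => //; rewrite subrr normr0.
  have [|r1 r10 hr1] := cmp t P _ GP; first by rewrite lexx /=; lra.
  have [|r2 r20 hr2] := cmp t' P' _ GP'; first by rewrite lexx andbT; lra.
  exists (Num.min r (Num.min r1 r2)) => [|s sI]; first by rewrite !lt_min r0 r10.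
  rewrite !lt_min => /and3P[h0 h1 h2].
  rewrite hr1 // hr2 // inc // inc //; last by rewrite subrr normr0.
  by ring.
have [P0 GP0] := G_exists (H s0 0); have [P1 GP1] := G_exists (H s0 1).
have [r r0 hr] := Q01 _ _ GP0 GP1; exists r => // s sI ss.
have := hr s sI ss.
have [-> ->] := ends s sI; have [-> ->] := ends s0 s0I.
rewrite !subrr !addr0 => E.
by rewrite (incrementE (pH s sI) (hu s sI)) (incrementE (pH s0 s0I) (hu s0 s0I)).
Qed.

End Continuation.

(** * Charts and piecewise C1 curves *)

Section Charts.
Variable R : realType.
Local Notation C := (Cplx R).
Variable S : riemannSurface R.
Implicit Types (phi psi : chart R S) (p q : S).

Lemma toCK phi p : dom phi p -> ofC phi (toC phi p) = p.
Proof. by move=> dp; apply: ofCK; rewrite inE. Qed.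

Lemma near_dom phi p : dom phi p -> \forall q \near p, dom phi q.
Proof. by move=> dp; apply: open_nbhs_nbhs; split=> //; exact: dom_open. Qed.

Lemma toC_cont phi p : dom phi p -> {for p, continuous (toC phi)}.
Proof. by move=> dp; apply: toC_continuous; rewrite inE. Qed.

Lemma ofC_cont phi p : dom phi p -> {for toC phi p, continuous (ofC phi)}.
Proof. by move=> dp; apply: ofC_continuous; rewrite inE; exists p. Qed.

Lemma near_img phi p : dom phi p -> \forall z \near toC phi p,
  dom phi (ofC phi z) /\ toC phi (ofC phi z) = z.
Proof.
move=> dp; have : \forall z \near toC phi p, (toC phi @` dom phi) z.
  by apply: open_nbhs_nbhs; split; [exact: img_open|exists p].
by apply: filterS => z [q dq <-]; rewrite toCK.
Qed.

Lemma near_chart phi p (A : set S) : dom phi p ->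
  (\forall q \near p, A q) <-> (\forall z \near toC phi p, A (ofC phi z)).
Proof.
move=> dp; split=> [pA|zA].
  by have := ofC_cont dp; apply; rewrite toCK.
have := toC_cont dp zA; rewrite nbhs_simpl /= => h.
by apply: filterS2 h (near_dom dp) => q /= + dq; rewrite toCK.
Qed.

Lemma near_toC phi p (B : set C) : dom phi p ->
  (\forall z \near toC phi p, B z) <-> (\forall q \near p, B (toC phi q)).
Proof.
move=> dp; rewrite (near_chart _ dp); split; apply: filterS2 (near_img dp) => z.
  by move=> [_ ->].
by move=> [_ ->].
Qed.

Definition transition phi psi (z : C) := toC psi (ofC phi z).

Lemma transition_cder phi psi p : atlas phi -> atlas psi -> dom phi p -> dom psi p ->
  cder (transition phi psi) (toC phi p)
    (derive1 (toC psi \o ofC phi) (toC phi p)).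
Proof.
by move=> aphi apsi dp dp'; apply: derivable_cder; exact: atlas_compatible.
Qed.

(** Compatibility of charts gives differentiability only; continuity of the derivative, which C1
    curves require, comes from [derivative_holomorphic]. *)
Lemma transition_C1 phi psi p : atlas phi -> atlas psi -> dom phi p -> dom psi p ->
  exists2 d : C -> C, {for toC phi p, continuous d} &
    \forall z \near toC phi p, cder (transition phi psi) z (d z).
Proof.
move=> aphi apsi dp dp'; pose d := derive1 (toC psi \o ofC phi).
have near_d : \forall z \near toC phi p, cder (transition phi psi) z (d z).
  apply/near_toC => //.
  have := near_dom dp; have := near_dom dp'; apply: filterS2 => q dq' dq.
  exact: transition_cder.
exists d => //; move/nbhs_cmod: near_d => [r r0 hr].
have [s /andP[s0 _] [dd hdd]] := derivative_holomorphic r0 hr.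
by apply: cder_cont (hdd _ _); rewrite subrr cmod0.
Qed.

Lemma near_punctured p (A : set S) : (\forall q \near p, A q) -> exists2 q, A q & q != p.
Proof.
move=> pA; have [phi [aphi dp]] := atlas_cover p.
have /nbhs_cmod[r r0 hr] := (near_chart A dp).1 pA.
have /nbhs_cmod[s s0 hs] := near_img dp.
pose t := Num.min r s; have t0 : 0 < t by rewrite lt_min r0.
have tr : t <= r by rewrite ge_min lexx.
have ts : t <= s by rewrite ge_min lexx orbT.
pose z := toC phi p + rc (t / 2).
have zp : cmod (z - toC phi p) = t / 2.
  by rewrite /z addrC addKr cmod_rc ger0_norm // divr_ge0 // ltW.
exists (ofC phi z); first by apply: hr; rewrite zp; lra.
have [|_ zE] := hs z; first by rewrite zp; lra.
apply/eqP => E; have : z - toC phi p = 0 by rewrite -zE E subrr.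
by move/(congr1 (@cmod R)); rewrite zp cmod0; lra.
Qed.

(** A Riemann surface has no isolated point, so the limit in [mul_form] is unique when it exists. *)
Lemma punctured_proper p : ProperFilter p^'.
Proof.
apply: Build_ProperFilter_ex => A; rewrite /dnbhs /within /= => hA.
have [q hq qp] := near_punctured hA; exists q; exact: hq.
Qed.

End Charts.

Section PiecewiseC1.
Variable R : realType.
Local Notation C := (Cplx R).
Variable S : riemannSurface R.
Implicit Types (phi psi : chart R S) (p q : S) (c : R -> S).

Lemma velocity_rder (u : R -> C) t : (forall part : C -> R,
    part = @complex.Re R \/ part = @complex.Im R -> derivable (part \o u : R -> R) t 1) ->
  rder u t (velocity u t).
Proof.
move=> h; apply/rderP; rewrite /velocity /=; split; rewrite derive1E.
  by split=> //; apply: h; left.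
by split=> //; apply: h; right.
Qed.

Lemma rder_velocity (u : R -> C) t d : rder u t d -> velocity u t = d.
Proof.
by move=> /rderP[[_ h1] [_ h2]]; apply: cP; rewrite /velocity /= derive1E.
Qed.

Lemma C1_at_rder c t phi : C1_at c t -> atlas phi -> dom phi (c t) ->
  (\forall s \near t, rder (toC phi \o c) s (velocity (toC phi \o c) s)) /\
  {for t, continuous (velocity (toC phi \o c))}.
Proof.
move=> [cc h] aphi dc.
have [r1 r2] := h phi aphi dc (@complex.Re R) (or_introl erefl).
have [i1 i2] := h phi aphi dc (@complex.Im R) (or_intror erefl).
split.
  apply: filterS2 r1 i1 => s hr hi; apply: velocity_rder => part [->|->].
    exact: hr.
  exact: hi.
have -> : velocity (toC phi \o c) = fun s =>
    rc (derive1 (@complex.Re R \o toC phi \o c : R -> R) s) +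
    ii R * rc (derive1 (@complex.Im R \o toC phi \o c : R -> R) s).
  by apply/funext => s; rewrite [LHS]cE.
apply: cvgD; first by apply: continuous_comp r2 _; exact: continuous_rc.
apply: cvgM; first exact: cvg_cst.
by apply: continuous_comp i2 _; exact: continuous_rc.
Qed.

Lemma rder_C1_at c t : {for t, continuous c} ->
  (forall phi, atlas phi -> dom phi (c t) -> exists2 v : R -> C,
     {for t, continuous v} & \forall s \near t, rder (toC phi \o c) s (v s)) ->
  C1_at c t.
Proof.
move=> cc h; split=> // phi aphi dc part hpart.
have [v vc hv] := h phi aphi dc.
have pd : \forall s \near t,
    @is_derive R R R s 1 (part \o toC phi \o c) (part (v s)).
  by apply: filterS hv => s /rderP[hr hi]; case: hpart => ->.
have pcont : continuous part.
  by case: hpart => ->; [exact: continuous_Re|exact: continuous_Im].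
split; first by apply: filterS pd => s [].
have E : \forall s \near t, derive1 (part \o toC phi \o c : R -> R) s = (part \o v) s.
  by apply: filterS pd => s [_ h']; rewrite derive1E; exact: h'.
rewrite /prop_for /continuous_at (nbhs_singleton E).
have : (part \o v) @ t --> (part \o v) t by apply: continuous_comp vc (pcont _).
by apply: cvg_trans; apply: near_eq_cvg; apply: filterS E => s ->.
Qed.

Lemma C1_at_affine c k m t : C1_at c (k * t + m) -> C1_at (fun s => c (k * s + m)) t.
Proof.
move=> hc.
have ac : {for t, continuous (fun s => k * s + m)}.
  apply: cvgD; last exact: cvg_cst.
  by apply: cvgM; [exact: cvg_cst|exact: cvg_id].
apply: rder_C1_at => [|phi aphi dc].
  by apply: (@continuous_comp _ _ _ (fun s => k * s + m) c) => //; case: hc.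
have [h1 h2] := C1_at_rder hc aphi dc.
exists (fun s => rc k * velocity (toC phi \o c) (k * s + m)).
  apply: cvgM; first exact: cvg_cst.
  exact: (@continuous_comp _ _ _ (fun s => k * s + m) (velocity (toC phi \o c))).
have h3 : \forall s \near t, rder (toC phi \o c) (k * s + m)
  (velocity (toC phi \o c) (k * s + m)) by exact: ac _ h1.
by apply: filterS h3 => s hs; exact: rder_reparam hs.
Qed.

Lemma C1_arc_affine c c2 a b a' b' k m : C1_arc c a' b' ->
  (forall t, a <= t <= b -> a' <= k * t + m <= b' /\ c2 t = c (k * t + m)) ->
  C1_arc c2 a b.
Proof.
move=> [c' hc'] h; exists (fun s => c' (k * s + m)) => t tI.
have [aI ->] := h t tI; have [<- hat] := hc' _ aI.
by split; [exact: erefl|exact: C1_at_affine].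
Qed.

(** The subdivision list of [piecewise_C1] as an inductive predicate: concatenation becomes a
    constructor, and proofs go by induction on the pieces. *)
Inductive pC1 c : R -> R -> Prop :=
| pC1_arc a b : a < b -> C1_arc c a b -> pC1 c a b
| pC1_trans a b d : pC1 c a b -> pC1 c b d -> pC1 c a d.

Lemma pC1_lt c a b : pC1 c a b -> a < b.
Proof. by elim=> // x y z _ + _; exact: lt_trans. Qed.

(** The alternative covers a negative k, where the end points are exchanged; reversal of a curve is
    the case k = - 1. *)
Lemma pC1_affine c c2 a' b' k m : pC1 c a' b' -> k != 0 -> forall a b,
  a < b -> (a' = k * a + m /\ b' = k * b + m) \/ (a' = k * b + m /\ b' = k * a + m) ->
  (forall t, a <= t <= b -> c2 t = c (k * t + m)) -> pC1 c2 a b.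
Proof.
move=> h k0; elim: h => {a' b'} [a' b' ab' arc|a' b' d' h1 IH1 h2 IH2] a b ab.
  move=> E c2E; apply: pC1_arc => //; apply: (C1_arc_affine arc (k := k) (m := m)).
  move=> t tI; split; last exact: c2E.
  have [k_lt0|k_ge0] := ltP k 0.
    have : k * b <= k * t <= k * a.
      by case/andP: tI => *; rewrite !ler_nM2l //; apply/andP.
    have : k * b <= k * a by rewrite ler_nM2l // ltW.
    by case: E => -[Ea Eb] ? /andP[? ?]; apply/andP; split; lra.
  have : k * a <= k * t <= k * b.
    by case/andP: tI => *; rewrite !ler_wpM2l.
  have : k * a <= k * b by rewrite ler_wpM2l // ltW.
  by case: E => -[Ea Eb] ? /andP[? ?]; apply/andP; split; lra.
pose x := (b' - m) / k.
have xE : b' = k * x + m by rewrite /x; field.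
have l1 := pC1_lt h1; have l2 := pC1_lt h2.
case=> -[Ea Eb] c2E.
  have k_gt0 : 0 < k.
    have : 0 < k * (b - a) by lra.
    by rewrite pmulr_lgt0 // subr_gt0.
  have ax : a < x by rewrite -(ltr_pM2l k_gt0); lra.
  have xb : x < b by rewrite -(ltr_pM2l k_gt0); lra.
  apply: (@pC1_trans _ _ x); [apply: IH1 => //; first by left|apply: IH2 => //; first by left].
    by move=> t /andP[? ?]; apply: c2E; apply/andP; split; lra.
  by move=> t /andP[? ?]; apply: c2E; apply/andP; split; lra.
have k_lt0 : k < 0.
  have : 0 < - k * (b - a) by lra.
  by rewrite pmulr_lgt0 ?subr_gt0 // oppr_gt0.
have ax : a < x by rewrite -(ltr_nM2l k_lt0); lra.
have xb : x < b by rewrite -(ltr_nM2l k_lt0); lra.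
apply: (@pC1_trans _ _ x); [apply: IH2 => //; first by right|apply: IH1 => //; first by right].
  by move=> t /andP[? ?]; apply: c2E; apply/andP; split; lra.
by move=> t /andP[? ?]; apply: c2E; apply/andP; split; lra.
Qed.

Lemma piecewise_C1P c : piecewise_C1 c <-> pC1 c 0 1.
Proof.
split=> [[s [ps ls arcs]]|h].
  suff H : forall (a : R) (s : seq R), path <%R a s -> last a s != a ->
      (forall k, (k < size s)%N -> C1_arc c (nth 0 (a :: s) k) (nth 0 s k)) ->
      pC1 c a (last a s).
    by rewrite -ls; apply: H => //; rewrite ls oner_eq0.
  move=> {ps ls arcs} a {}s; elim: s a => [|b s IH] a /=; first by rewrite eqxx.
  move=> /andP[ab pb] _ arcs.
  have arc0 : pC1 c a b by apply: pC1_arc => //; exact: (arcs 0%N).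
  have [lb|nlb] := eqVneq (last b s) b; first by rewrite lb.
  by apply: pC1_trans arc0 (IH _ pb nlb _) => k ks; exact: (arcs k.+1).
suff H : forall a b, pC1 c a b -> exists s : seq R, [/\ path <%R a s, last a s = b &
    forall k, (k < size s)%N -> C1_arc c (nth 0 (a :: s) k) (nth 0 s k)] by exact: H.
move=> {h} a b.
elim=> {a b} [a b ab arc|a b d _ [s [ps ls arcs]] _ [s' [ps' ls' arcs']]].
  by exists [:: b]; split=> [|//|[|k]] //=; rewrite ab.
exists (s ++ s'); split.
- by rewrite cat_path ps ls.
- by rewrite last_cat ls.
move=> k; rewrite size_cat => ks.
have [k_s|s_k] := ltnP k (size s).
  have := arcs k k_s; rewrite nth_cat k_s.
  case: k k_s {ks} => [|k] k_s //=.
  by rewrite nth_cat (ltn_trans _ k_s).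
have k_s' : (k - size s < size s')%N by rewrite ltn_subLR.
have := arcs' _ k_s'; rewrite nth_cat ltnNge s_k /=.
case: k s_k {ks k_s'} => [|k] s_k.
  have s0 : s = [::] by apply: size0nil; apply/eqP; rewrite -leqn0.
  by subst s; rewrite /= in ls *; rewrite ls.
rewrite /= nth_cat.
have [k_s|s_k'] := ltnP k (size s).
  (* The piece that starts at the junction: its left end is the last point of the first list. *)
  have kE : k.+1 = size s by apply/eqP; rewrite eqn_leq s_k k_s.
  by rewrite -kE subnn /= -ls (last_nth 0) -kE.
by rewrite subSn.
Qed.

Lemma piecewise_C1_unit_path c : piecewise_C1 c -> unit_path c.
Proof.
move=> /piecewise_C1P h.
suff H : forall a b, pC1 c a b -> forall t, a <= t <= b -> forall A, nbhs (c t) A ->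
  exists2 r : R, 0 < r & forall s, a <= s <= b -> `|s - t| < r -> A (c s) by exact: H.
move=> {h} a b; elim=> {a b} [a b ab [c' hc']|a b d h1 IH1 h2 IH2] t tI A cA.
  have [E [cont _]] := hc' t tI; rewrite -E in cA.
  have /nbhs_abs[r r0 hr] := cont A cA; exists r => // s sI st.
  by have [<- _] := hc' s sI; exact: hr.
have l1 := pC1_lt h1; have l2 := pC1_lt h2.
case/andP: tI => at_ td.
have [tb|bt|tb] := ltgtP t b.
- have [|r r0 hr] := IH1 t _ A cA; first by rewrite at_ ltW.
  exists (Num.min r (b - t)) => [|s /andP[as_ sd]]; first by rewrite lt_min r0 subr_gt0.
  rewrite lt_min => /andP[sr sb]; apply: hr => //; rewrite as_ /=.
  by have := ler_norm (s - t); lra.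
- have [|r r0 hr] := IH2 t _ A cA; first by rewrite td ltW.
  exists (Num.min r (t - b)) => [|s /andP[as_ sd]]; first by rewrite lt_min r0 subr_gt0.
  rewrite lt_min => /andP[sr sb]; apply: hr => //; rewrite sd andbT.
  by have := ler_norm (t - s); rewrite distrC; lra.
subst t.
have [|r r0 hr] := IH1 b _ A cA; first by rewrite at_ lexx.
have [|r' r'0 hr'] := IH2 b _ A cA; first by rewrite td lexx.
exists (Num.min r r') => [|s /andP[as_ sd]]; first by rewrite lt_min r0.
rewrite lt_min => /andP[sr sr'].
have [sb|/ltW bs] := leP s b; first by apply: hr => //; rewrite as_.
by apply: hr' => //; rewrite bs.
Qed.

Lemma piecewise_C1_cat c1 c2 : piecewise_C1 c1 -> piecewise_C1 c2 -> c1 1 = c2 0 ->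
  piecewise_C1 (path_cat c1 c2).
Proof.
move=> /piecewise_C1P h1 /piecewise_C1P h2 E; apply/piecewise_C1P.
apply: (@pC1_trans _ _ 2^-1).
  apply: (pC1_affine h1 (k := 2) (m := 0)) => [//||| t /andP[_ tb]].
  - by lra.
  - by left; split; field.
  by rewrite /path_cat tb.
apply: (pC1_affine h2 (k := 2) (m := - 1)) => [//||| t /andP[at_ tb]].
- by lra.
- by left; split; field.
rewrite /path_cat; case: ifPn => // h.
have -> : t = 2^-1 by apply/eqP; rewrite eq_le h.
have -> : 2 * 2^-1 + 0 = 1 :> R by field.
have -> : 2 * 2^-1 + - 1 = 0 :> R by field.
exact: E.
Qed.

Lemma piecewise_C1_rev c : piecewise_C1 c -> piecewise_C1 (path_rev c).
Proof.
move=> /piecewise_C1P h; apply/piecewise_C1P.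
apply: (pC1_affine h (k := - 1) (m := 1)); [|exact: ltr01| |by []].
  by rewrite oppr_eq0 oner_eq0.
by right; split; ring.
Qed.

(** A straight segment in one chart; [transition_C1] makes it C1 in all others. Staying inside A
    lets one germ be used along the whole curve. *)
Lemma local_piecewise_C1 p (A : set S) : nbhs p A -> \forall q \near p,
  exists c, [/\ piecewise_C1 c, c 0 = p, c 1 = q & forall t, 0 <= t <= 1 -> A (c t)].
Proof.
move=> pA; have [phi [aphi dp]] := atlas_cover p.
have /nbhs_cmod[r1 r10 h1] := (near_chart A dp).1 pA.
have /nbhs_cmod[r2 r20 h2] := near_img dp.
pose r := Num.min r1 r2; have r0 : 0 < r by rewrite lt_min r10.
have rr1 : r <= r1 by rewrite ge_min lexx.
have rr2 : r <= r2 by rewrite ge_min lexx orbT.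
apply/(near_chart _ dp)/nbhs_cmod; exists (r / 2); first by rewrite divr_gt0.
set z0 := toC phi p => z zr.
pose l t := z0 + rc t * (z - z0).
have lr t : 0 <= t <= 1 -> cmod (l t - z0) < r.
  move=> /andP[t0 t1]; rewrite /l [z0 + _]addrC addrK cmodM cmod_rc ger0_norm //.
  have : t * cmod (z - z0) <= cmod (z - z0) by rewrite ler_piMl ?cmod_ge0.
  by move: zr r0; lra.
have lc : continuous l by move=> t; exact: rder_cont (rder_affine _ _ t).
exists (ofC phi \o l); split.
- apply/piecewise_C1P/pC1_arc; first exact: ltr01.
  exists (ofC phi \o l) => t tI; split=> //.
  have [|dl lE] := h2 (l t); first by apply: lt_le_trans rr2; exact: lr.
  apply: rder_C1_at => [|psi apsi dc].
    apply: continuous_comp; first exact: lc.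
    by rewrite -lE; exact: ofC_cont.
  have [d dc' hd] := transition_C1 aphi apsi dl dc.
  rewrite lE in dc' hd; exists (fun s => d (l s) * (z - z0)).
    apply: cvgM; last exact: cvg_cst.
    exact: (@continuous_comp _ _ _ l d t (lc t) dc').
  have hl : \forall s \near t, cder (transition phi psi) (l s) (d (l s)).
    exact: lc t _ hd.
  apply: filterS hl => s hs.
  exact: rder_comp (rder_affine z0 (z - z0) s) hs.
- by rewrite /l /= rmorph0 mul0r addr0 toCK.
- by rewrite /l /= rmorph1 mul1r [z0 + _]addrC subrK.
- by move=> t tI; apply: h1; apply: lt_le_trans rr1; exact: lr.
Qed.

(** The set of reachable points is open by local curves and closed by reversed local curves. *)
Lemma piecewise_C1_connected p q : exists c, [/\ piecewise_C1 c, c 0 = p & c 1 = q].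
Proof.
pose B := [set q | exists c, [/\ piecewise_C1 c, c 0 = p & c 1 = q]].
suff BT : B = setT by have : B q by rewrite BT.
have step x y : B x -> (exists c, [/\ piecewise_C1 c, c 0 = x & c 1 = y]) -> B y.
  move=> [c1 [h1 c10 c11]] [c2 [h2 c20 c21]]; exists (path_cat c1 c2); split.
  - by apply: piecewise_C1_cat => //; rewrite c11.
  - rewrite /path_cat ifT; last by lra.
    by rewrite mulr0 addr0.
  rewrite /path_cat ifF; last by lra.
  have -> : 2 * 1 + - 1 = 1 :> R by ring.
  exact: c21.
have loc x : \forall y \near x, exists c, [/\ piecewise_C1 c, c 0 = x & c 1 = y].
  have h : nbhs x setT by exact: filterT.
  by apply: filterS (local_piecewise_C1 h) => y [c [? ? ? _]]; exists c.
have rev x y : (exists c, [/\ piecewise_C1 c, c 0 = x & c 1 = y]) ->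
    exists c, [/\ piecewise_C1 c, c 0 = y & c 1 = x].
  move=> [c [h c0 c1]]; exists (path_rev c); split; first exact: piecewise_C1_rev.
    by rewrite /path_rev mulr0 add0r.
  by rewrite /path_rev mulr1 addNr.
apply: (@points_connected R S B).
- by exists p; exact: nbhs_singleton (loc p).
- exists B; last by rewrite setTI.
  by rewrite openE => x Bx; rewrite /interior; apply: filterS (loc x) => y; exact: step.
exists B; last by rewrite setTI.
move=> x clx; have [y [By h]] := clx _ (loc x).
by apply: step By _; exact: rev.
Qed.

End PiecewiseC1.

(** * Primitives and line integrals of holomorphic forms *)

Section Primitives.
Variable R : realType.
Local Notation C := (Cplx R).
Variable S : riemannSurface R.
Implicit Types (phi psi : chart R S) (p q : S) (c : R -> S) (w : one_form S)
  (P Q : S -> C).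

Definition primitive_at w P p := forall phi, atlas phi -> dom phi p ->
  cder (P \o ofC phi) (toC phi p) (w phi p).

Definition primitive_germ w p P := \forall q \near p, primitive_at w P q.

Definition form_law w := forall phi psi, atlas phi -> atlas psi ->
  forall p, dom phi p -> dom psi p ->
  w phi p = w psi p * derive1 (toC psi \o ofC phi) (toC phi p).

Lemma primitive_at_chart w P p phi : form_law w -> atlas phi -> dom phi p ->
  cder (P \o ofC phi) (toC phi p) (w phi p) -> primitive_at w P p.
Proof.
move=> law aphi dphi hP psi apsi dpsi.
rewrite (law _ _ apsi aphi _ dpsi dphi).
have hT := transition_cder apsi aphi dpsi dphi.
have := cder_comp hT; rewrite /transition toCK // => /(_ _ _ hP).
move=> /cder_near; apply.
have := (near_chart _ dpsi).1 (near_dom dphi); apply: filterS => z dz /=.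
by rewrite toCK.
Qed.

Lemma primitive_germ_exists w p : holomorphic_form w ->
  exists P, primitive_germ w p P.
Proof.
move=> [law hw]; have [phi [aphi dp]] := atlas_cover p.
have hd : \forall z \near toC phi p, cder (w phi \o ofC phi) z
    (derive1 (w phi \o ofC phi) z).
  apply/(near_toC _ dp); apply: filterS (near_dom dp) => q dq.
  exact: derivable_cder (hw _ aphi _ dq).
move/nbhs_cmod: hd => [r r0 hr]; have [P hP] := local_primitive r0 hr.
exists (P \o toC phi).
have rP : \forall z \near toC phi p, cder P z (w phi (ofC phi z)).
  by apply/nbhs_cmod; exists (r / 4) => [|z /hP //]; rewrite divr_gt0.
move/(near_toC _ dp): rP; rewrite /primitive_germ.
have := near_dom dp; apply: filterS2 => q dq; rewrite toCK // => hq.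
apply: (primitive_at_chart law aphi dq); apply: cder_near hq _.
by apply: filterS (near_img dq) => z [_ /= ->].
Qed.

Lemma primitive_germ_near w p P : primitive_germ w p P ->
  \forall q \near p, primitive_germ w q P.
Proof. exact: nbhs_interior. Qed.

Lemma primitive_germ_unique w p P Q : primitive_germ w p P ->
  primitive_germ w p Q -> \forall q \near p, P q - P p = Q q - Q p.
Proof.
move=> hP hQ; have [phi [aphi dp]] := atlas_cover p.
apply/(near_chart _ dp).
have h : \forall z \near toC phi p, cder ((P \o ofC phi) \- (Q \o ofC phi)) z 0.
  apply/(near_toC _ dp).
  apply: filterS3 hP hQ (near_dom dp) => q h1 h2 dq.
  by have := dif_sub (h1 _ aphi dq) (h2 _ aphi dq); rewrite subrr.
move/nbhs_cmod: h => [r r0 hr]; apply/nbhs_cmod; exists r => // z zr.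
have := disc_constant hr zr; rewrite /= toCK // => E.
have -> : P (ofC phi z) - P p = (P (ofC phi z) - Q (ofC phi z)) + (Q (ofC phi z) - P p).
  by ring.
by rewrite E; ring.
Qed.

Lemma primitive_cont w p P : primitive_at w P p -> {for p, continuous P}.
Proof.
move=> h; have [phi [aphi dp]] := atlas_cover p.
have := cder_cont (h phi aphi dp) => hc A.
rewrite /= -{1}(toCK dp) => hA; rewrite nbhs_simpl /=.
apply/(near_chart _ dp); exact: hc.
Qed.

Lemma form_cont w p phi : holomorphic_form w -> atlas phi -> dom phi p ->
  {for p, continuous (w phi)}.
Proof.
move=> [_ hw] aphi dp.
have := cder_cont (derivable_cder (hw _ aphi _ dp)) => hc A.
rewrite /= -{1}(toCK dp) => hA; rewrite nbhs_simpl /=.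
apply/(near_chart _ dp); exact: hc.
Qed.


(** At a corner the velocity of the curve is meaningless, so the integrand h agrees with a
    continuous h' inside the interval only, and U is merely continuous at the ends. Half-open
    intervals make consecutive pieces disjoint; measurability is carried along for their union. *)
Lemma integral_FTC_piece (h h' U : R -> R) (a b : R) : a < b ->
  (forall t, a <= t <= b -> {for t, continuous h'}) ->
  (forall t, a < t < b -> h t = h' t) ->
  (forall t, a < t < b -> is_derive t 1 U (h' t)) ->
  (forall t, a <= t <= b -> forall e : R, 0 < e -> exists2 r : R, 0 < r &
     forall s, a <= s <= b -> `|s - t| < r -> `|U s - U t| < e) ->
  measurable_fun `[a, b[ h /\
  (\int[lebesgue_measure]_(t in `[a, b[) (h t)%:E = (U b - U a)%:E)%E.
Proof.
move=> ab ch' hh' dU cU.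
have ch : {within `[a, b], continuous h'}.
  apply: continuous_in_subspaceT => t; rewrite inE /= in_itv /=; exact: ch'.
have mh' : measurable_fun `[a, b] h'.
  exact: subspace_continuous_measurable_fun ch.
have moo : measurable_fun `]a, b[ h'.
  by apply: measurable_funS mh' => //; exact: subset_itv_oo_cc.
have moo' : measurable_fun `]a, b[ h.
  apply: eq_measurable_fun moo => t; rewrite inE /= in_itv /= => /hh'.
  by move=> ->.
have hE : {in `]a, b[, h =1 h'} by move=> t; rewrite in_itv /=; exact: hh'.
split; first by apply/measurable_fun_itv_obnd_cbndP.
rewrite (eq_integral_itv_bounded true true moo' moo hE).
rewrite integral_itv_bndo_bndc; last first.
  apply/measurable_EFinP; apply: measurable_funS mh' => //.
  by apply: subset_itvl; rewrite bnd_simp.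
rewrite (@continuous_FTC2 _ h' U a b ab ch) //.
- split.
  + by move=> t; rewrite in_itv /= => /dU[].
  + apply/cvgrPdist_lt => e e0; have [|r r0 hr] := cU a _ e e0.
      by rewrite lexx ltW.
    have : \forall x \near a^'+, x < a + Num.min r (b - a).
      by apply: nbhs_right_lt; rewrite ltrDl lt_min r0 subr_gt0.
    have := nbhs_right_gt a; apply: filterS2 => x ax xr.
    have xm : x - a < Num.min r (b - a) by lra.
    move: xm; rewrite lt_min => /andP[? ?].
    rewrite distrC; apply: hr; first by apply/andP; split; lra.
    by rewrite ger0_norm; lra.
  + apply/cvgrPdist_lt => e e0; have [|r r0 hr] := cU b _ e e0.
      by rewrite lexx ltW.
    have : \forall x \near b^'-, b - Num.min r (b - a) < x.
      by apply: nbhs_left_gt; rewrite gtrBl lt_min r0 subr_gt0.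
    have := nbhs_left_lt b; apply: filterS2 => x ax xr.
    have xm : b - x < Num.min r (b - a) by lra.
    move: xm; rewrite lt_min => /andP[? ?].
    rewrite distrC; apply: hr; first by apply/andP; split; lra.
    by rewrite ler0_norm; lra.
- by move=> t; rewrite in_itv /= => /dU[_ <-]; rewrite derive1E.
Qed.

Lemma integral_cat (h : R -> R) (a b d x y : R) : a < b -> b < d ->
  measurable_fun `[a, b[ h /\
    (\int[lebesgue_measure]_(t in `[a, b[) (h t)%:E = x%:E)%E ->
  measurable_fun `[b, d[ h /\
    (\int[lebesgue_measure]_(t in `[b, d[) (h t)%:E = y%:E)%E ->
  measurable_fun `[a, d[ h /\
    (\int[lebesgue_measure]_(t in `[a, d[) (h t)%:E = (x + y)%:E)%E.
Proof.
move=> ab bd [m1 i1] [m2 i2].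
have E : `[a, d[%classic = `[a, b[%classic `|` `[b, d[%classic :> set R.
  by apply: itv_bndbnd_setU; rewrite bnd_simp ltW.
have m : measurable_fun `[a, d[ h by rewrite E; apply/measurable_funU.
split=> //; rewrite E integral_setU //; first by rewrite i1 i2.
  by rewrite -E; apply/measurable_EFinP.
apply/disj_setPS => t [/=]; rewrite !in_itv /= => /andP[_ tb] /andP[bt _].
by move: (lt_le_trans tb bt); rewrite ltxx.
Qed.

End Primitives.

Section LineIntegral.
Variable R : realType.
Local Notation C := (Cplx R).
Variable S : riemannSurface R.
Implicit Types (phi psi : chart R S) (p q : S) (c : R -> S) (w : one_form S)
  (P Q : S -> C).

Lemma rder_primitive w P c s phi v : {for s, continuous c} -> atlas phi ->
  dom phi (c s) -> primitive_at w P (c s) -> rder (toC phi \o c) s v ->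
  rder (P \o c) s (w phi (c s) * v).
Proof.
move=> cc aphi dc hP hv; have := rder_comp hv (hP phi aphi dc).
move=> /rder_near; apply.
have h : \forall t \near s, dom phi (c t) by exact: cc _ (near_dom dc).
by apply: filterS h => t dt /=; rewrite toCK.
Qed.

Lemma rder_chart c s phi psi v : {for s, continuous c} -> atlas phi -> atlas psi ->
  dom phi (c s) -> dom psi (c s) -> rder (toC phi \o c) s v ->
  rder (toC psi \o c) s (derive1 (toC psi \o ofC phi) (toC phi (c s)) * v).
Proof.
move=> cc aphi apsi dc dc' hv.
have := rder_comp hv (transition_cder aphi apsi dc dc').
move=> /rder_near; apply.
have h : \forall t \near s, dom phi (c t) by exact: cc _ (near_dom dc).
by apply: filterS h => t dt /=; rewrite /transition toCK.
Qed.

Definition line_integrand c w t : C :=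
  w (chart_at (c t)) (c t) * velocity (toC (chart_at (c t)) \o c) t.

Lemma chart_atP p : atlas (chart_at p) /\ dom (chart_at p) p.
Proof. exact: projT2 (cid (atlas_cover p)). Qed.

Lemma line_integrandE c w s phi v : form_law w -> {for s, continuous c} ->
  atlas phi -> dom phi (c s) -> rder (toC phi \o c) s v ->
  line_integrand c w s = w phi (c s) * v.
Proof.
move=> law cc aphi dc hv; have [apsi dpsi] := chart_atP (c s).
rewrite /line_integrand (rder_velocity (rder_chart cc aphi apsi dc dpsi hv)).
by rewrite (law _ _ aphi apsi _ dc dpsi) mulrA.
Qed.

(** The chart chosen by [chart_at (c s)] may jump with s, but near t the integrand has the same
    value in the fixed chart at c t. *)
Lemma line_integrand_cont c w t : holomorphic_form w -> C1_at c t ->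
  {for t, continuous (line_integrand c w)}.
Proof.
move=> hw hc; have [law _] := hw; have [aphi dc] := chart_atP (c t).
set phi := chart_at (c t) in aphi dc.
have [h1 h2] := C1_at_rder hc aphi dc; have [cc _] := hc.
(* [C1_at] asserts continuity of c at t only; at nearby parameters it is recovered from the
   coordinate of c through [ofC]. *)
have near_c : \forall s \near t, {for s, continuous c}.
  have h3 : \forall s \near t, nbhs s [set s | dom phi (c s)].
    by apply: nbhs_interior; exact: cc _ (near_dom dc).
  apply: filterS2 h1 h3 => s hs ds A cA.
  have dcs : dom phi (c s) := nbhs_singleton ds.
  have := rder_cont hs; rewrite /= => h4.
  have h5 : \forall r \near s, A (ofC phi (toC phi (c r))).
    exact: h4 _ ((near_chart A dcs).1 cA).
  by apply: filterS2 h5 ds => r + dr; rewrite /= toCK.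
have nd : \forall s \near t, dom phi (c s) by exact: cc _ (near_dom dc).
pose v := velocity (toC phi \o c).
have E : \forall s \near t, line_integrand c w s = w phi (c s) * v s.
  apply: filterS3 h1 near_c nd => s hs cs ds.
  exact: line_integrandE law cs aphi ds hs.
have cv : {for t, continuous (fun s => w phi (c s) * v s)}.
  apply: cvgM; last exact: h2.
  exact: (@continuous_comp _ _ _ c (w phi) t cc (form_cont hw aphi dc)).
rewrite /prop_for /continuous_at (nbhs_singleton E).
apply: cvg_trans cv; apply: near_eq_cvg; apply: filterS E => s ->.
by [].
Qed.

(** Inside each arc u is, up to a constant, a local primitive composed with c, so its derivative is
    the integrand. This is the link between Lebesgue integrals and continuation. *)
Lemma line_integral_continuation w c (u : R -> C) : holomorphic_form w ->
  piecewise_C1 c -> continuation (primitive_germ w) c u ->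
  line_integral c w = u 1 - u 0.
Proof.
move=> hw pc cu; have [law _] := hw.
have upath := piecewise_C1_unit_path pc.
have germ_at x P : primitive_germ w x P -> primitive_at w P x.
  exact: nbhs_singleton.
have cont_u t : 0 <= t <= 1 -> forall e : R, 0 < e -> exists2 r : R, 0 < r &
    forall s, 0 <= s <= 1 -> `|s - t| < r -> cmod (u s - u t) < e.
  move=> tI e e0; have [P GP [r r0 hr]] := cu t tI.
  have := primitive_cont (germ_at _ _ GP) => /contCP /(_ e e0) hP.
  have [r' r'0 hr'] := upath t tI _ hP.
  exists (Num.min r r') => [|s sI]; first by rewrite lt_min r0.
  by rewrite lt_min => /andP[/(hr s sI) -> /(hr' s sI)].
have piece (part : C -> R) : part = @complex.Re R \/ part = @complex.Im R ->
    forall a b, pC1 c a b -> 0 <= a -> b <= 1 ->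
    measurable_fun `[a, b[ (part \o line_integrand c w) /\
    (\int[lebesgue_measure]_(t in `[a, b[) ((part \o line_integrand c w) t)%:E =
      (part (u b) - part (u a))%:E)%E.
  move=> hpart; have pcont : continuous part.
    by case: hpart => ->; [exact: continuous_Re|exact: continuous_Im].
  have ple z : `|part z| <= cmod z.
    by case: hpart => ->; [exact: Re_le|exact: Im_le].
  have pB y z : part (y - z) = part y - part z.
    by case: hpart => ->; [exact: cReB|exact: cImB].
  move=> a b; elim=> {a b} [a b ab [c' hc'] a0 b1|a b d h1 IH1 h2 IH2 a0 d1];
    last first.
    have l1 := pC1_lt h1; have l2 := pC1_lt h2.
    have -> : part (u d) - part (u a) =
      (part (u b) - part (u a)) + (part (u d) - part (u b)) by ring.
    by apply: (integral_cat l1 l2); [apply: IH1|apply: IH2] => //; lra.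
  have eqc t : a < t < b -> \forall s \near t, c' s = c s.
    move=> /andP[at_ tb].
    apply/nbhs_abs; exists (Num.min (t - a) (b - t)).
      by rewrite lt_min !subr_gt0 at_.
    move=> s; rewrite lt_min ltr_norml => /andP[/andP[? ?]].
    rewrite ltr_norml => /andP[? ?].
    by have [|] := hc' s; first by apply/andP; split; lra.
  have inn t : a < t < b -> 0 <= t <= 1 /\ a <= t <= b.
    by move=> /andP[? ?]; split; apply/andP; split; lra.
  (* In the open interval c coincides locally with its C1 extension c', hence so do the velocities;
     at the ends they may differ. *)
  have data t : a < t < b -> [/\ {for t, continuous c}, line_integrand c w t =
      line_integrand c' w t & rder u t (line_integrand c w t)].
    move=> tI; have [t01 tab] := inn t tI; have [E hC] := hc' t tab.
    have [cc' _] := hC; have eqt := eqc t tI.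
    have cc : {for t, continuous c}.
      rewrite /prop_for /continuous_at -E; apply: cvg_trans cc'.
      by apply: near_eq_cvg; apply: filterS eqt => s ->.
    have [aphi dphi] := chart_atP (c t); set phi := chart_at (c t) in aphi dphi.
    have dphi' : dom phi (c' t) by rewrite E.
    have [/nbhs_singleton hv _] := C1_at_rder hC aphi dphi'.
    set v := velocity _ _ in hv.
    have hv' : rder (toC phi \o c) t v.
      by apply: rder_near hv _; apply: filterS eqt => s /= ->.
    have E1 := line_integrandE law cc aphi dphi hv'.
    have E2 := line_integrandE law cc' aphi dphi' hv.
    split; [exact: cc|by rewrite E1 E2 E|].
    rewrite E1; have [P GP [r r0 hr]] := cu t t01.
    have hP := rder_primitive cc aphi dphi (germ_at _ _ GP) hv'.
    have := dif_add hP (dif_cst (@rc R) (u t - P (c t))).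
    rewrite addr0 => hP2; apply: (@rder_near _ (fun s => (P \o c) s + (u t - P (c t)))).
      exact: hP2.
    case/andP: tI => at_ tb.
    apply/nbhs_abs; exists (Num.min r (Num.min (t - a) (b - t))).
      by rewrite !lt_min r0 !subr_gt0 at_.
    move=> s; rewrite !lt_min => /and3P[s1 s2 s3].
    have := ler_norm (s - t); have := ler_norm (t - s); rewrite distrC => n1 n2.
    have sI : 0 <= s <= 1 by apply/andP; split; lra.
    have -> : u s = (u s - u t) + u t by ring.
    by rewrite (hr s sI s1) /=; ring.
  apply: (integral_FTC_piece ab (h' := part \o line_integrand c' w) (U := part \o u)).
  - move=> t tI; have [_ hC] := hc' t tI.
    exact: continuous_comp (line_integrand_cont hw hC) (pcont _).
  - by move=> t /data[_ /= -> _].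
  - move=> t /data[_ E /rderP[d1 d2]]; rewrite /= -E.
    by case: hpart => ->.
  - move=> t tI e e0; have [|r r0 hr] := cont_u t _ e e0.
      by case/andP: tI => *; apply/andP; split; lra.
    exists r => // s sI st; apply: le_lt_trans (hr s _ st).
      by rewrite /= -pB.
    by case/andP: sI => *; apply/andP; split; lra.
have /piecewise_C1P h := pc.
have fin (part : C -> R) : part = @complex.Re R \/ part = @complex.Im R ->
    \int[lebesgue_measure]_(t in `[0, 1]) part (line_integrand c w t) =
    part (u 1) - part (u 0).
  move=> hpart; have [m E] := piece part hpart 0 1 h (lexx _) (lexx _).
  rewrite /Rintegral -integral_itv_bndo_bndc; first by rewrite E.
  exact/measurable_EFinP.
rewrite /line_integral /integral01; apply: cP; rewrite ?cReB ?cImB /=.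
  by apply: (fin (@complex.Re R)); left.
by apply: (fin (@complex.Im R)); right.
Qed.

Lemma line_integral_increment w c : holomorphic_form w -> piecewise_C1 c ->
  line_integral c w = increment (primitive_germ w) c.
Proof.
move=> hw pc; have pc' := piecewise_C1_unit_path pc.
have G_ex x := @primitive_germ_exists _ _ w x hw.
have [u hu] := continuation_exists G_ex (@primitive_germ_near _ _ w)
  (@primitive_germ_unique _ _ w) pc'.
rewrite (line_integral_continuation hw pc hu).
by rewrite (incrementE G_ex (@primitive_germ_unique _ _ w) pc' hu).
Qed.

End LineIntegral.

(** * Monodromy and covering maps *)

Section Monodromy.
Variable R : realType.
Local Notation C := (Cplx R).

Lemma locally_constant (S : riemannSurface R) (T : Type) (h : S -> T) :
  (forall x, \forall y \near x, h y = h x) -> forall x y, h x = h y.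
Proof.
move=> loc x y; pose B := [set z | h z = h x].
suff BT : B = setT by have : B y by rewrite BT.
apply: (@points_connected R S B).
- by exists x.
- exists B; last by rewrite setTI.
  by rewrite openE => z Bz; rewrite /interior; apply: filterS (loc z) => t E; rewrite /B /= E.
exists B; last by rewrite setTI.
move=> z clz; have [t [Bt E]] := clz _ (loc z).
by rewrite /B /= -E.
Qed.

Variable S : riemannSurface R.
Variable G : S -> (S -> C) -> Prop.
Hypothesis G_exists : forall x, exists P, G x P.
Hypothesis G_near : forall x P, G x P -> \forall y \near x, G y P.
Hypothesis G_unique : forall x P Q, G x P -> G x Q ->
  \forall y \near x, P y - P x = Q y - Q x.
Implicit Types (c : R -> S).

Lemma increment_eq c c' : unit_path c -> unit_path c' ->
  (forall t, 0 <= t <= 1 -> c t = c' t) -> increment G c = increment G c'.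
Proof.
move=> pc pc' E; have [u hu] := continuation_exists G_exists G_near G_unique pc.
have hu' : continuation G c' (fun t => u (1 * t + 0)).
  apply: continuation_affine hu _ _ => t tI; rewrite mul1r addr0 //.
  by rewrite E.
rewrite (incrementE G_exists G_unique pc hu).
rewrite (incrementE G_exists G_unique pc' hu').
by rewrite !mul1r !addr0.
Qed.

Lemma increment_loop c1 c2 : piecewise_C1 c1 -> piecewise_C1 c2 ->
  c1 0 = c2 0 -> c1 1 = c2 1 -> let l := path_cat c1 (path_rev c2) in
  [/\ piecewise_C1 l, l 0 = l 1 & increment G l = increment G c1 - increment G c2].
Proof.
move=> h1 h2 E0 E1 l.
have r0 : path_rev c2 0 = c1 1 by rewrite /path_rev mulr0 add0r.
have r1 : path_rev c2 1 = c1 0 by rewrite /path_rev mulr1 addNr.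
have h2' := piecewise_C1_rev h2.
have hl : piecewise_C1 l by apply: piecewise_C1_cat.
split=> //.
  rewrite /l /path_cat ifT; last by lra.
  rewrite ifF; last by lra.
  have -> : 2 * 1 + - 1 = 1 :> R by ring.
  by rewrite r1 mulr0 addr0.
have p1 := piecewise_C1_unit_path h1; have p2 := piecewise_C1_unit_path h2.
have p2' := piecewise_C1_unit_path h2'; have pl := piecewise_C1_unit_path hl.
rewrite (increment_cat G_exists G_near G_unique p1 p2' pl) //.
by rewrite (increment_rev G_exists G_near G_unique p2 p2').
Qed.

Lemma increment_step p q c P : piecewise_C1 c -> c 0 = p -> c 1 = q -> G q P ->
  \forall q' \near q, exists c', [/\ piecewise_C1 c', c' 0 = p, c' 1 = q' &
    increment G c' = increment G c + (P q' - P q)].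
Proof.
move=> h c0 c1 GP; apply: filterS (local_piecewise_C1 (G_near GP)).
move=> q' [s [hs s0 s1 sG]].
have E : c 1 = s 0 by rewrite c1.
have hl := piecewise_C1_cat h hs E.
exists (path_cat c s); split=> //.
- by rewrite /path_cat ifT; [rewrite mulr0 addr0|lra].
- rewrite /path_cat ifF; last by lra.
  have -> : 2 * 1 + - 1 = 1 :> R by ring.
  exact: s1.
rewrite (increment_cat G_exists G_near G_unique) //; do ?exact: piecewise_C1_unit_path.
congr (_ + _); rewrite -s0 -s1.
apply: (increment_germ G_exists G_near G_unique) => //.
exact: piecewise_C1_unit_path.
Qed.

Lemma simply_connected_increment c : simply_connected S -> piecewise_C1 c ->
  c 0 = c 1 -> increment G c = 0.
Proof.
move=> sc hc loop; have pc := piecewise_C1_unit_path hc.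
have [H [cH H0 H1 Hend]] := sc c ((unit_pathP c).2 pc) loop.
have I t : 0 <= t <= 1 -> (`[0, 1]%classic : set R) t by rewrite set_itvE.
have cont s t : 0 <= s <= 1 -> 0 <= t <= 1 -> forall A, nbhs (H (s, t)) A ->
    exists2 r : R, 0 < r & forall s' t', 0 <= s' <= 1 -> 0 <= t' <= 1 ->
      `|s' - s| < r -> `|t' - t| < r -> A (H (s', t')).
  move=> sI tI A hA; move/subspace_continuousP: cH => /(_ (s, t)).
  move=> /(_ (conj (I _ sI) (I _ tI)) A hA) /nbhs_ballP[r /= r0 hr].
  exists r => // s' t' s'I t'I ss tt; apply: (hr (s', t')).
    by split; rewrite /ball /= distrC.
  by split; exact: I.
have I0 : 0 <= (0 : R) <= 1 by rewrite lexx ler01.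
have I1 : 0 <= (1 : R) <= 1 by rewrite lexx ler01.
have path s : 0 <= s <= 1 -> unit_path (fun t => H (s, t)).
  move=> sI t tI A /(cont s t sI tI)[r r0 hr]; exists r => // t' t'I tt.
  by apply: hr => //; rewrite subrr normr0.
have E := @increment_homotopy _ _ _ G_exists G_near G_unique
  (fun s t => H (s, t)) cont.
have {}E := E _; rewrite -(increment_cst G_exists G_unique (c 0)).
rewrite -(@increment_eq (fun t => H (1, t)) (fun=> c 0) (path _ I1)); last first.
- by move=> t tI; rewrite H1.
- by move=> t _ A cA; exists 1 => // s _ _; exact: nbhs_singleton cA.
rewrite -(@increment_eq (fun t => H (0, t)) c (path _ I0) pc); last first.
  by move=> t tI; rewrite H0.
apply: E => s sI; have [-> ->] := Hend s sI.
by have [-> ->] := Hend 0 I0.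
Qed.

(** F x is the increment along an arbitrarily chosen curve from x0 to x. The curve chosen for a
    nearby y and the prolonged curve of x form a loop, whose increment vanishes, so the choices need
    no compatibility. *)
Theorem monodromy : simply_connected S -> exists F : S -> C,
  forall x P, G x P -> \forall y \near x, F y - F x = P y - P x.
Proof.
move=> sc; have [x0 _] := points_nonempty S.
have [c hc] := choice (fun x => piecewise_C1_connected x0 x).
exists (fun x => increment G (c x)) => x P GP.
have [hx cx0 cx1] := hc x.
apply: filterS (increment_step hx cx0 cx1 GP) => y [c' [h' c'0 c'1 E]].
have [hy cy0 cy1] := hc y.
have [||hl loop El] := increment_loop h' hy; rewrite ?c'0 ?cy0 ?c'1 ?cy1 //.
have := simply_connected_increment sc hl loop; rewrite El E => /eqP.
by rewrite subr_eq0 => /eqP <-; ring.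
Qed.

End Monodromy.

Section Covers.
Variable R : realType.
Local Notation C := (Cplx R).
Variables (S' S : riemannSurface R) (pr : S' -> S).
Hypothesis pr_universal : universal_cover pr.

Definition map_derivative (S1 S2 : riemannSurface R) (h : S1 -> S2)
    (phi : chart R S1) (psi : chart R S2) (p : S1) : C :=
  derive1 (toC psi \o h \o ofC phi) (toC phi p).

Lemma cover_continuous x : {for x, continuous pr}.
Proof. by case: pr_universal => _ h _ _; case: (h x I). Qed.

Lemma map_cder (S1 S2 : riemannSurface R) (U : set S1) (h : S1 -> S2) (P : S2 -> C)
    (phi : chart R S1) (psi : chart R S2) (p : S1) (d : C) :
  holomorphic_map_on U h -> U p -> atlas phi -> atlas psi -> dom phi p ->
  dom psi (h p) -> cder (P \o ofC psi) (toC psi (h p)) d ->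
  cder (P \o h \o ofC phi) (toC phi p) (d * map_derivative h phi psi p).
Proof.
move=> hh Up aphi apsi dp dhp hP; have [ch dh] := hh p Up.
have := derivable_cder (dh phi psi aphi apsi dp dhp).
rewrite -/(map_derivative h phi psi p) => hd.
have hP' : cder (P \o ofC psi) ((toC psi \o h \o ofC phi) (toC phi p)) d.
  by rewrite /= toCK.
have := cder_comp hd hP' => /cder_near; apply.
have nd : \forall q \near p, dom psi (h q) by exact: ch _ (near_dom dhp).
by apply: filterS ((near_chart _ dp).1 nd) => z dz /=; rewrite toCK.
Qed.

Lemma local_section x : exists sec : S -> S', exists U : set S,
  [/\ nbhs (pr x) U, sec (pr x) = x, forall q, U q -> pr (sec q) = q,
      \forall y \near x, sec (pr y) = y & holomorphic_map_on U sec].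
Proof.
have [_ _ _ ev] := pr_universal.
have [U [oU Ux [sheets [oV _ cover secs]]]] := ev (pr x).
have : (pr @^-1` U) x by [].
rewrite cover => -[V sV Vx]; have [sec [h1 h2 h3]] := secs V sV.
exists sec, U; split=> //.
- exact: open_nbhs_nbhs.
- exact: h2.
- by move=> q /h1[].
by apply: filterS (open_nbhs_nbhs (conj (oV V sV) Vx)) => y; exact: h2.
Qed.

(** The chain rule for sec \o pr, which is the identity near x; it shows that the derivative of the
    cover never vanishes. *)
Lemma section_derivative (sec : S -> S') (U : set S) x (phi : chart R S')
    (psi : chart R S) :
  nbhs (pr x) U -> sec (pr x) = x -> (\forall y \near x, sec (pr y) = y) ->
  holomorphic_map_on U sec -> atlas phi -> atlas psi -> dom phi x ->
  dom psi (pr x) ->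
  map_derivative sec psi phi (pr x) * map_derivative pr phi psi x = 1.
Proof.
move=> nU sx near_sec hsec aphi apsi dx dpx.
have [_ hpr _ _] := pr_universal.
have h1 : cder (toC phi \o ofC phi) (toC phi x) 1.
  apply: cder_near (cder_id _) _.
  by apply: filterS (near_img dx) => z [_].
have h2 : cder (toC phi \o sec \o ofC psi) (toC psi (pr x))
    (1 * map_derivative sec psi phi (pr x)).
  by apply: (map_cder hsec) => //; rewrite ?sx //; exact: nbhs_singleton.
rewrite mul1r in h2.
have h3 := @map_cder _ _ _ pr (toC phi \o sec) phi psi x _ hpr I aphi apsi dx dpx h2.
apply: cder_uniq h3 _; apply: cder_near h1 _.
by apply: filterS ((near_chart _ dx).1 near_sec) => z /= ->.
Qed.

Lemma cover_derivative_neq0 x (phi : chart R S') (psi : chart R S) :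
  atlas phi -> atlas psi -> dom phi x -> dom psi (pr x) ->
  map_derivative pr phi psi x != 0.
Proof.
move=> aphi apsi dx dpx; have [sec [U [h1 h2 _ h3 h4]]] := local_section x.
have := section_derivative h1 h2 h3 h4 aphi apsi dx dpx.
by apply: contra_eq_neq => ->; rewrite mulr0 eq_sym oner_eq0.
Qed.

End Covers.

(** * From Weierstrass data to ZMC-faces *)

Section Lift.
Variable R : realType.
Local Notation C := (Cplx R).
Variables (S' S : riemannSurface R) (pr : S' -> S).
Hypothesis pr_universal : universal_cover pr.

(* Admissible germs on the cover are the pull-backs of local primitives. *)
Definition pullback_germ (w : one_form S) (x : S') (P : S' -> C) :=
  exists2 Q, primitive_germ w (pr x) Q & \forall y \near x, P y = Q (pr y).

Lemma pullback_germ_exists w x : holomorphic_form w -> exists P, pullback_germ w x P.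
Proof.
move=> hw; have [Q hQ] := primitive_germ_exists (pr x) hw.
by exists (Q \o pr), Q => //; apply: nearW.
Qed.

Lemma pullback_germ_near w x P : pullback_germ w x P ->
  \forall y \near x, pullback_germ w y P.
Proof.
move=> [Q hQ PQ].
have h1 : \forall y \near x, primitive_germ w (pr y) Q.
  exact: cover_continuous pr_universal x _ (primitive_germ_near hQ).
have h2 : \forall y \near x, \forall z \near y, P z = Q (pr z) by exact: nbhs_interior.
by apply: filterS2 h1 h2 => y ? ?; exists Q.
Qed.

Lemma pullback_germ_unique w x P1 P2 : pullback_germ w x P1 -> pullback_germ w x P2 ->
  \forall y \near x, P1 y - P1 x = P2 y - P2 x.
Proof.
move=> [Q1 h1 E1] [Q2 h2 E2].
have h : \forall y \near x, Q1 (pr y) - Q1 (pr x) = Q2 (pr y) - Q2 (pr x).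
  exact: cover_continuous pr_universal x _ (primitive_germ_unique h1 h2).
have [e1 e2] := (nbhs_singleton E1, nbhs_singleton E2).
by apply: filterS3 E1 E2 h => y; rewrite e1 e2 => -> ->.
Qed.

Lemma pullback_cder w x P phi psi : pullback_germ w x P ->
  atlas phi -> atlas psi -> dom phi x -> dom psi (pr x) ->
  cder (P \o ofC phi) (toC phi x) (w psi (pr x) * map_derivative pr phi psi x).
Proof.
move=> [Q hQ E] aphi apsi dx dpx; have [_ hpr _ _] := pr_universal.
have := map_cder hpr I aphi apsi dx dpx (nbhs_singleton hQ _ apsi dpx).
move=> /cder_near; apply.
by apply: filterS ((near_chart _ dx).1 E) => z /= ->.
Qed.

(** [monodromy] gives each component up to a constant. The difference of its real part and f \o pr
    is locally constant, hence constant on the connected cover, and one normalization at x0 makes it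
    zero. *)
Lemma exists_lift (W : 'I_3 -> one_form S) (f : S -> 'rV[R]_3) :
  (forall k, holomorphic_form (W k)) ->
  (forall q k P, primitive_germ (W k) q P ->
     \forall p \near q, f p 0 k - f q 0 k = complex.Re (P p - P q)) ->
  exists F : S' -> 'rV[C]_3,
    (forall k x phi psi, atlas phi -> atlas psi -> dom phi x -> dom psi (pr x) ->
       cder (component F k \o ofC phi) (toC phi x)
         (W k psi (pr x) * map_derivative pr phi psi x)) /\
    forall x, f (pr x) = \row_k complex.Re (F x 0 k).
Proof.
move=> hW hf; have [sc _ _ _] := pr_universal.
have ex k := monodromy (fun x => pullback_germ_exists x (hW k))
  (@pullback_germ_near (W k)) (@pullback_germ_unique (W k)) sc.
have [F0 hF0] := choice ex.
have [x0 _] := points_nonempty S'.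
(* Normalized so that F x0 is real and equal to f (pr x0). *)
pose F x : 'rV[C]_3 := \row_k (F0 k x - F0 k x0 + rc (f (pr x0) 0 k)).
exists F; split.
  move=> k x phi psi aphi apsi dx dpx.
  have [P hP] := pullback_germ_exists x (hW k).
  have := pullback_cder hP aphi apsi dx dpx => h.
  have h2 := dif_add h (dif_cst id (F0 k x - P x - F0 k x0 + rc (f (pr x0) 0 k))).
  rewrite addr0 in h2.
  apply: (@cder_near _ (fun z => (P \o ofC phi) z +
    (F0 k x - P x - F0 k x0 + rc (f (pr x0) 0 k))) _ _ _ h2).
  have := (near_chart _ dx).1 (hF0 k x P hP); apply: filterS => z /= E.
  rewrite /component /F mxE.
  have -> : F0 k (ofC phi z) = (F0 k (ofC phi z) - F0 k x) + F0 k x.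
    by rewrite subrK.
  rewrite E; move: (rc _) (P x) (P _) (F0 k x) (F0 k x0) => b1 b2 b3 b4 b5.
  by ring.
move=> x1; apply/rowP => k; rewrite mxE /F mxE.
pose h y := complex.Re (F0 k y) - f (pr y) 0 k.
have h_local x : \forall y \near x, h y = h x.
  have [P hP] := pullback_germ_exists x (hW k); have [Q hQ E] := hP.
  have h1 : \forall y \near x, f (pr y) 0 k - f (pr x) 0 k = complex.Re (Q (pr y) - Q (pr x)).
    exact: cover_continuous pr_universal x _ (hf _ _ _ hQ).
  have e := nbhs_singleton E.
  apply: filterS3 E h1 (hF0 k x P hP) => y Ey fy Fy; rewrite /h.
  have -> : F0 k y = (F0 k y - F0 k x) + F0 k x by ring.
  by rewrite Fy Ey e cReD -fy; ring.
have hE := locally_constant h_local x1 x0.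
by rewrite cReD cReB /=; move: hE; rewrite /h; lra.
Qed.

End Lift.

#[local] Opaque line_integral.

Section Forward.
Variable R : realType.
Local Notation C := (Cplx R).
Variables (S' S : riemannSurface R) (pr : S' -> S).
Hypothesis pr_universal : universal_cover pr.

Lemma scale_form_primitive (a : C) (w : one_form S) q P :
  primitive_germ w q P -> primitive_germ (scale_form a w) q (fun p => a * P p).
Proof.
apply: filterS => p h phi aphi dp; exact: dif_scale (h phi aphi dp).
Qed.

Lemma scale_form_holomorphic (a : C) (w : one_form S) :
  holomorphic_form w -> holomorphic_form (scale_form a w).
Proof.
move=> [law hw]; split=> [phi psi aphi apsi p dp dp'|phi aphi p dp].
  by rewrite /scale_form (law _ _ aphi apsi _ dp dp') mulrA.
have := dif_scale a (derivable_cder (hw _ aphi _ dp)); exact: cder_derivable.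
Qed.

Lemma line_integral_scale (a : C) (w : one_form S) c : holomorphic_form w ->
  piecewise_C1 c -> line_integral c (scale_form a w) = a * line_integral c w.
Proof.
move=> hw hc; have pc := piecewise_C1_unit_path hc.
have [u hu] := continuation_exists (fun x => primitive_germ_exists x hw)
  (@primitive_germ_near _ _ w) (@primitive_germ_unique _ _ w) pc.
rewrite (line_integral_continuation hw hc hu).
rewrite (@line_integral_continuation _ _ _ _ (fun t => a * u t)
  (scale_form_holomorphic a hw) hc); first by ring.
move=> t tI; have [P GP [r r0 hr]] := hu t tI.
exists (fun p => a * P p); first exact: scale_form_primitive.
by exists r => // s sI /(hr s sI) E; rewrite -!mulrBr E.
Qed.

Section Integrals.
Variable W : 'I_3 -> one_form S.
Hypothesis hW : forall k, holomorphic_form (W k).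

Definition integral_map p0 (a : 'rV[R]_3) (f : S -> 'rV[R]_3) :=
  forall p (c : R -> S), piecewise_C1 c -> c 0 = p0 -> c 1 = p ->
    f p = a + \row_k complex.Re (line_integral c (W k)).

Lemma add_row_coef (a : 'rV[R]_3) (u : 'I_3 -> R) k :
  (a + \row_j u j) 0 k = a 0 k + u k.
Proof. by rewrite !mxE. Qed.

Lemma integral_map_exists p0 (a : 'rV[R]_3) :
  (forall c, piecewise_C1 c -> c 0 = c 1 ->
     forall k, complex.Re (line_integral c (W k)) = 0) ->
  exists! f : S -> 'rV[R]_3, integral_map p0 a f.
Proof.
move=> hP; have [c hc] := choice (fun p => piecewise_C1_connected p0 p).
exists (fun p => a + \row_k complex.Re (line_integral (c p) (W k))); split.
  move=> p c' hc' c'0 c'1; apply/rowP => k; rewrite [LHS]add_row_coef [RHS]add_row_coef.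
  apply: (congr1 (fun z => a 0 k + z)).
  have [hcp cp0 cp1] := hc p.
  have Gex x := primitive_germ_exists x (hW k).
  have [hl loop E] := increment_loop Gex (@primitive_germ_near _ _ (W k))
    (@primitive_germ_unique _ _ (W k)) hcp hc' (etrans cp0 (esym c'0))
    (etrans cp1 (esym c'1)).
  have := hP _ hl loop k.
  rewrite (line_integral_increment (hW k) hl) E.
  rewrite (line_integral_increment (hW k) hcp) (line_integral_increment (hW k) hc').
  by rewrite cReB => /eqP; rewrite subr_eq0 => /eqP.
move=> f' hf'; apply/funext => p; have [hcp cp0 cp1] := hc p.
by rewrite (hf' p _ hcp cp0 cp1).
Qed.

Lemma integral_map_local p0 a (f : S -> 'rV[R]_3) : integral_map p0 a f ->
  forall q k P, primitive_germ (W k) q P ->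
  \forall p \near q, f p 0 k - f q 0 k = complex.Re (P p - P q).
Proof.
move=> hf q k P hP.
have Gex x := primitive_germ_exists x (hW k).
have [c [hc c0 c1]] := piecewise_C1_connected p0 q.
have := increment_step Gex (@primitive_germ_near _ _ (W k))
    (@primitive_germ_unique _ _ (W k)) hc c0 c1 hP.
apply: filterS => p [c' [hc' c'0 c'1 E]].
have fE p1 c1' : piecewise_C1 c1' -> c1' 0 = p0 -> c1' 1 = p1 ->
    f p1 0 k = a 0 k + complex.Re (increment (primitive_germ (W k)) c1').
  move=> h h0 h1; rewrite (hf p1 c1' h h0 h1) add_row_coef.
  by rewrite (line_integral_increment (hW k) h).
have fp := fE _ _ hc' c'0 c'1; have fq := fE _ _ hc c0 c1.
rewrite E cReD in fp; rewrite fp fq.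
by move: (complex.Re _) (complex.Re _) => x y; ring.
Qed.

End Integrals.

Section Data.
Variables (g : S -> option C) (w : one_form S).
Hypothesis hw : holomorphic_form w.
Hypothesis hC : condition_C g w.

Let W := weierstrass_forms g w.

Lemma weierstrass_formsE k : W k =
  nth w [:: mul_form g w; w; scale_form (- 'i%C) w] k.
Proof. by rewrite /W /weierstrass_forms (tnth_nth w). Qed.

Lemma weierstrass_holomorphic k : holomorphic_form (W k).
Proof.
have [hg _] := hC; rewrite weierstrass_formsE.
case: k => -[|[|[|m]]] hk.
- exact: hg.
- exact: hw.
- exact: scale_form_holomorphic hw.
- by exfalso; move: hk.
Qed.

Lemma closed_periods c : condition_P g w -> piecewise_C1 c -> c 0 = c 1 ->
  forall k, complex.Re (line_integral c (W k)) = 0.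
Proof.
move=> hP hc loop; have [h0 h1] := hP c hc loop.
move=> k; rewrite weierstrass_formsE; case: k => -[|[|[|m]]] hk.
- exact: h0.
- by rewrite [X in line_integral _ X]/= h1.
- by rewrite [X in line_integral _ X]/= (line_integral_scale _ hw hc) h1 mulr0.
- by exfalso; move: hk.
Qed.

Lemma weierstrass_map_exists p0 (a : 'rV[R]_3) : condition_P g w ->
  exists! f : S -> 'rV[R]_3, is_weierstrass_map g w p0 a f.
Proof.
move=> hP; apply: (integral_map_exists weierstrass_holomorphic) => c hc loop k.
exact: closed_periods hP hc loop k.
Qed.

(** If w vanished identically so would g w, also at the poles of g, where its coefficient is a limit
    of zeros; this contradicts (C). The lemma makes F^1 non-constant. *)
Lemma form_nonzero : exists q psi, [/\ atlas psi, dom psi q & w psi q != 0].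
Proof.
apply: contrapT => none.
have w0 q psi : atlas psi -> dom psi q -> w psi q = 0.
  move=> apsi dq; apply: contrapT => /eqP wq; apply: none; exists q, psi.
  by split.
have [q _] := points_nonempty S; have [psi [apsi dq]] := atlas_cover q.
have [_ h] := hC; apply: (h q psi apsi dq); split; first exact: w0.
rewrite /mul_form; case: (g q) => [c|]; first by rewrite w0 // mulr0.
have pf := punctured_proper q.
apply: (@cvg_lim _ (@norm_hausdorff _ _)).
have E : \forall x \near q^', finite_part g x * w psi x = 0.
  rewrite near_withinE; apply: filterS (near_dom dq) => x dx _.
  by rewrite w0 // mulr0.
have : (fun _ : S => 0 : C) @ q^' --> (0 : C) by exact: cvg_cst.
by apply: cvg_trans; apply: near_eq_cvg; apply: filterS E => x ->.
Qed.

Theorem weierstrass_map_oriented p0 a (f : S -> 'rV[R]_3) :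
  is_weierstrass_map g w p0 a f -> oriented_ZMC_face pr f.
Proof.
move=> hf; have floc := integral_map_local weierstrass_holomorphic hf.
have [F [dF fF]] := exists_lift pr_universal weierstrass_holomorphic floc.
have [_ _ surj _] := pr_universal.
pose psi_ x := chart_at (pr x).
have apsi x : atlas (psi_ x) by case: (chart_atP (pr x)).
have dpsi x : dom (psi_ x) (pr x) by case: (chart_atP (pr x)).
have diffE k x phi : atlas phi -> dom phi x -> differential (component F k) phi x =
    W k (psi_ x) (pr x) * map_derivative pr phi (psi_ x) x.
  by move=> aphi dx; apply: cder_derive1; exact: dF.
have W0 x : W 0 (psi_ x) (pr x) = mul_form g w (psi_ x) (pr x).
  by rewrite weierstrass_formsE.
have W1 x : W 1 (psi_ x) (pr x) = w (psi_ x) (pr x).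
  by rewrite weierstrass_formsE.
have W2 x : W 2 (psi_ x) (pr x) = - 'i%C * w (psi_ x) (pr x).
  by rewrite weierstrass_formsE.
have i2 : 'i%C * 'i%C = -1 :> C by exact: iiE.
split; last first.
  move=> F' [[hol _] _ _ fF'] x phi aphi dx.
  have hol_cder k : cder (component F' k \o ofC phi) (toC phi x)
      (differential (component F' k) phi x).
    by apply: derivable_cder; exact: nbhs_singleton (hol k x phi aphi dx).
  (* Every lift has the real part f \o pr of the constructed one, hence the same differentials; so
     the sign convention passes to all lifts. *)
  have same k : differential (component F' k) phi x =
      W k (psi_ x) (pr x) * map_derivative pr phi (psi_ x) x.
    apply: (Re_determines_derivative (hol_cder k) (dF k x _ _ aphi (apsi x) dx (dpsi x))).
    apply/nbhs_cmod; exists 1 => // z _.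
    have E y : complex.Re (component F' k y) = complex.Re (component F k y).
      have : f (pr y) 0 k = f (pr y) 0 k by [].
      by rewrite {1}fF' fF !mxE.
    by rewrite /= !E.
  rewrite !same W1 W2; set m := map_derivative _ _ _ _; set z := w _ _.
  have -> : z * m - 'i%C * (- 'i%C * z * m) = z * m * (1 + 'i%C * 'i%C) by ring.
  by rewrite i2 subrr mulr0.
exists F; split=> //.
- split=> [k x phi aphi dx|x phi aphi dx].
    apply/(near_toC _ dx); apply: filterS (near_dom dx) => y dy.
    exact: cder_derivable (dF k y _ _ aphi (apsi y) dy (dpsi y)).
  set D := \row_k _; have d0 := cover_derivative_neq0 pr_universal aphi (apsi x) dx (dpsi x).
  have [k Dk] : exists k, D 0 k != 0.
    apply: contrapT => none.
    have D0 k : W k (psi_ x) (pr x) = 0.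
      have : D 0 k = 0 by apply: contrapT => /eqP h; apply: none; exists k.
      rewrite mxE diffE // => /eqP; rewrite mulf_eq0 (negbTE d0) orbF => /eqP.
      by [].
    have [_ h] := hC; apply: (h (pr x) (psi_ x) (apsi x) (dpsi x)).
    by rewrite -W1 -W0 !D0.
  move=> v v' /rowP/(_ k); rewrite !mxE.
  by have := Dk; rewrite mxE => Dk'; exact: mulIf.
- move=> x phi aphi dx; rewrite !diffE // W1 W2.
  set m := map_derivative _ _ _ _; set z := w _ _.
  have -> : (z * m) ^+ 2 + (- 'i%C * z * m) ^+ 2 = (z * m) ^+ 2 * (1 + 'i%C * 'i%C).
    by ring.
  by rewrite i2 subrr mulr0.
apply: contrapT => none; have [q [psi [apsi' dq wq]]] := form_nonzero.
have [x xq] := surj q; rewrite -{}xq in dq wq.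
have [phi [aphi dx]] := atlas_cover x.
have h := dF 1 x phi psi aphi apsi' dx dq.
have : W 1 psi (pr x) * map_derivative pr phi psi x = 0.
  apply: cder_uniq h _; apply: cder_near (cder_cst (component F 1 x) _) _.
  apply/nbhs_cmod; exists 1 => // z _ /=; apply: contrapT => /eqP ne; apply: none.
  by exists x, (ofC phi z).
move/eqP; rewrite mulf_eq0 (negbTE (cover_derivative_neq0 pr_universal aphi apsi' dx dq)).
by rewrite orbF weierstrass_formsE (negbTE wq).
Qed.

End Data.

End Forward.

(** * From ZMC-faces to Weierstrass data *)

Section Quotient.
Variable R : realType.
Local Notation C := (Cplx R).
Variable S : riemannSurface R.
Implicit Types (phi psi : chart R S) (p q : S) (w : one_form S).

(** The transformation law is the chain rule for a primitive, and the coefficient is holomorphic as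
    the derivative of one. This serves [coordinate_form], whose values are chosen pointwise. *)
Lemma primitives_holomorphic w : (forall q, exists P, primitive_germ w q P) ->
  holomorphic_form w.
Proof.
move=> ex; split=> [phi psi aphi apsi p dp dp'|phi aphi p dp]; have [P hP] := ex p.
  have h1 := nbhs_singleton hP _ aphi dp; have h2 := nbhs_singleton hP _ apsi dp'.
  have hT := transition_cder aphi apsi dp dp'.
  have h3 : cder (P \o ofC psi) (transition phi psi (toC phi p)) (w psi p).
    by rewrite /transition toCK.
  apply: cder_uniq h1 _; apply: cder_near (cder_comp hT h3) _.
  apply: filterS ((near_chart _ dp).1 (near_dom dp')) => z dz /=.
  by rewrite /transition toCK.
have h : \forall z \near toC phi p, cder (P \o ofC phi) z ((w phi \o ofC phi) z).
  apply/(near_toC _ dp); apply: filterS2 hP (near_dom dp) => q hq dq.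
  by rewrite /= toCK //; exact: hq.
move/nbhs_cmod: h => [r r0 hr].
have [s /andP[s0 _] [d hd]] := derivative_holomorphic r0 hr.
by apply: cder_derivable (hd _ _); rewrite subrr cmod0.
Qed.

Lemma eq_form_holomorphic w w' :
  (forall phi p, atlas phi -> dom phi p -> w phi p = w' phi p) ->
  holomorphic_form w -> holomorphic_form w'.
Proof.
move=> E [law hw]; split=> [phi psi aphi apsi p dp dp'|phi aphi p dp].
  by rewrite -!E //; exact: law.
have := derivable_cder (hw _ aphi _ dp) => /cder_near h.
apply: cder_derivable (h _ _).
by apply: filterS ((near_chart _ dp).1 (near_dom dp)) => z dz /=; rewrite E.
Qed.

Lemma eq_form_integral w w' c :
  (forall phi p, atlas phi -> dom phi p -> w phi p = w' phi p) ->
  line_integral c w = line_integral c w'.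
Proof.
move=> E; apply: (congr1 (@integral01 R)); apply/funext => t.
by have [a d] := chart_atP (c t); rewrite E.
Qed.

Lemma form_zero_chart w p phi psi : form_law w -> atlas phi -> atlas psi ->
  dom phi p -> dom psi p -> w phi p = 0 -> w psi p = 0.
Proof. by move=> law aphi apsi dp dp' E; rewrite (law _ _ apsi aphi _ dp' dp) E mul0r. Qed.

Lemma form_isolated_zeros w p phi : holomorphic_form w -> atlas phi -> dom phi p ->
  (\forall q \near p, w phi q = 0) \/ (\forall q \near p^', w phi q != 0).
Proof.
move=> [_ hw] aphi dp.
have h : \forall z \near toC phi p, cder (w phi \o ofC phi) z
    (derive1 (w phi \o ofC phi) z).
  apply/(near_toC _ dp); apply: filterS (near_dom dp) => q dq.
  exact: derivable_cder (hw _ aphi _ dq).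
move/nbhs_cmod: h => [r r0 hr].
case: (isolated_zeros r0 hr) => -[s s0 hs]; [left|right].
  by apply/(near_chart _ dp)/nbhs_cmod; exists s.
rewrite near_withinE; apply/(near_chart _ dp).
have h : \forall z \near toC phi p, z != toC phi p -> w phi (ofC phi z) != 0.
  by apply/nbhs_cmod; exists s => // z zs zp; exact: hs.
apply: filterS2 h (near_img dp) => z h1 [_ zE] zp; apply: h1.
by apply: contra zp => /eqP ->; rewrite toCK.
Qed.

(** The identity theorem: the interior Z of the zero set is closed. At a limit point p of Z,
    isolated zeros would make w nonzero on a punctured neighbourhood, which still meets Z unless p
    itself lies in Z. *)
Lemma form_identity w : holomorphic_form w ->
  (exists q, exists phi, [/\ atlas phi, dom phi q & \forall p \near q, w phi p = 0]) ->
  forall p phi, atlas phi -> dom phi p -> w phi p = 0.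
Proof.
move=> hw [q0 [phi0 [a0 d0 z0]]]; have [law _] := hw.
pose zero p := w (chart_at p) p = 0.
have zeroE p phi : atlas phi -> dom phi p -> (w phi p = 0) <-> zero p.
  move=> aphi dp; have [a d] := chart_atP p.
  by split; apply: form_zero_chart.
pose Z : set S := fun p : S => \forall q \near p, zero q.
suff ZT : Z = setT.
  move=> p phi aphi dp; apply/(zeroE _ _ aphi dp).
  have : Z p by rewrite ZT.
  exact: nbhs_singleton.
apply: (@points_connected R S Z).
- exists q0; apply: filterS2 z0 (near_dom d0) => p zp dp.
  exact: (zeroE p phi0 a0 dp).1.
- exists Z; last by rewrite setTI.
  by rewrite openE => z Zz; rewrite /interior; exact: nbhs_interior Zz.
exists Z; last by rewrite setTI.
move=> p clp; have [aphi dp] := chart_atP p.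
have [zp|nz] := form_isolated_zeros hw aphi dp.
  by apply: filterS2 zp (near_dom dp) => q zq dq; apply: (zeroE q _ aphi dq).1.
rewrite near_withinE in nz.
have nzi : \forall q \near p, \forall r \near q, r != p -> w (chart_at p) r != 0.
  exact: nbhs_interior.
have ddi : \forall q \near p, \forall r \near q, dom (chart_at p) r.
  exact: nbhs_interior (near_dom dp).
have [q [Zq [nq dq]]] := clp _ (filterI nzi ddi).
have [qp|qp] := eqVneq q p.
  by rewrite -qp.
have zq := nbhs_singleton Zq; have dq' := nbhs_singleton dq.
by have := nbhs_singleton nq qp; rewrite (zeroE q _ aphi dq').2 // eqxx.
Qed.

Section Meromorphic.
Variables (w0 w1 : one_form S).
Hypothesis hw0 : holomorphic_form w0.
Hypothesis hw1 : holomorphic_form w1.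
Hypothesis no_common_zero : forall p phi, atlas phi -> dom phi p ->
  ~ (w0 phi p = 0 /\ w1 phi p = 0).
Hypothesis w1_neq0 : ~ (forall p phi, atlas phi -> dom phi p -> w1 phi p = 0).

Definition form_quotient (p : S) : option C :=
  if w1 (chart_at p) p == 0 then None
  else Some (w0 (chart_at p) p / w1 (chart_at p) p).

Lemma form_quotientE p phi : atlas phi -> dom phi p -> form_quotient p =
  if w1 phi p == 0 then None else Some (w0 phi p / w1 phi p).
Proof.
move=> aphi dp; have [apsi dp'] := chart_atP p; rewrite /form_quotient.
have [law0 _] := hw0; have [law1 _] := hw1.
have [E|nE] := eqVneq (w1 phi p) 0.
  by rewrite (form_zero_chart law1 aphi apsi dp dp' E) eqxx.
have [E|nE'] := eqVneq (w1 (chart_at p) p) 0.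
  by move: nE; rewrite (form_zero_chart law1 apsi aphi dp' dp E) eqxx.
congr Some; move: nE; rewrite (law0 _ _ aphi apsi _ dp dp').
rewrite (law1 _ _ aphi apsi _ dp dp'); set t := derive1 _ _.
rewrite mulf_eq0 negb_or => /andP[_ t0].
by field; rewrite nE' t0.
Qed.

Lemma w1_punctured p phi : atlas phi -> dom phi p ->
  \forall q \near p, q != p -> w1 phi q != 0.
Proof.
move=> aphi dp; case: (form_isolated_zeros hw1 aphi dp).
  move=> z; exfalso; apply: w1_neq0; apply: (form_identity hw1).
  by exists p, phi.
by rewrite near_withinE.
Qed.

(** At a zero of w1 the coefficient is a limit; the nearby products are exactly those of w0, which
    is continuous. *)
Lemma form_quotient_mul p phi : atlas phi -> dom phi p ->
  mul_form form_quotient w1 phi p = w0 phi p.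
Proof.
move=> aphi dp; rewrite /mul_form (form_quotientE aphi dp).
case: eqP => [E|/eqP nE]; last by rewrite divfK.
have pf := punctured_proper p.
apply: (@cvg_lim _ (@norm_hausdorff _ _)).
have h : w0 phi @ p^' --> w0 phi p.
  move=> A cA; have hA : \forall q \near p, A (w0 phi q).
    exact: form_cont hw0 aphi dp _ cA.
  have : \forall q \near p^', A (w0 phi q).
    by rewrite near_withinE; apply: filterS hA => q ? _.
  by [].
apply: cvg_trans h; apply: near_eq_cvg; rewrite near_withinE.
apply: filterS2 (w1_punctured aphi dp) (near_dom dp) => q h1 dq qp.
by rewrite /finite_part (form_quotientE aphi dq) (negbTE (h1 qp)) /= divfK ?h1.
Qed.

Lemma form_quotient_meromorphic : meromorphic form_quotient.
Proof.
have near_nonzero p phi : atlas phi -> dom phi p -> w1 phi p != 0 ->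
    \forall q \near p, w1 phi q != 0.
  move=> aphi dp nz; have nz' : 0 < cmod (w1 phi p) by rewrite cmod_gt0.
  have /contCP/(_ _ nz') := form_cont hw1 aphi dp; apply: filterS => q hq.
  by apply: contraTneq hq => ->; rewrite sub0r cmodN ltxx.
split.
- move=> p clp; apply: contrapT => np.
  have [aphi dp] := chart_atP p.
  have nz : w1 (chart_at p) p != 0.
    by apply/eqP => E; apply: np; rewrite /poles /= (form_quotientE aphi dp) E eqxx.
  have [q [pq [nq dq]]] := clp _ (filterI (near_nonzero _ _ aphi dp nz) (near_dom dp)).
  by move: pq; rewrite /poles /= (form_quotientE aphi dq) (negbTE nq).
- move=> p np phi aphi dp.
  have nz : w1 phi p != 0.
    by apply/eqP => E; apply: np; rewrite /poles /= (form_quotientE aphi dp) E eqxx.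
  apply/(near_toC _ dp).
  have h : \forall q \near p, \forall q' \near q, w1 phi q' != 0.
    exact: nbhs_interior (near_nonzero p phi aphi dp nz).
  apply: filterS2 h (near_dom dp) => q hq dq.
  have nzq := nbhs_singleton hq.
  have [_ h0] := hw0; have [_ h1] := hw1.
  have c0 := derivable_cder (h0 _ aphi _ dq).
  have c1 := derivable_cder (h1 _ aphi _ dq).
  have nz1 : (w1 phi \o ofC phi) (toC phi q) != 0 by rewrite /= toCK.
  have := dif_mul c0 (cder_comp c1 (cder_inv nz1)) => hq2.
  apply: cder_derivable.
  apply: (@cder_near _ (fun z => (w0 phi \o ofC phi) z * ((w1 phi \o ofC phi) z)^-1)
    _ _ _ hq2).
  have hd := (near_chart _ dq).1 (near_dom dq).
  apply: filterS2 ((near_chart _ dq).1 hq) hd => z nzz dz /=.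
  by rewrite /finite_part (form_quotientE aphi dz) (negbTE nzz).
move=> p pole; have [aphi dp] := chart_atP p; set phi := chart_at p in aphi dp.
have z1 : w1 phi p = 0.
  by move: pole; rewrite /poles /= (form_quotientE aphi dp); case: eqP.
have nz0 : w0 phi p != 0.
  by apply/eqP => E; apply: (no_common_zero aphi dp).
split.
  rewrite near_withinE.
  apply: filterS2 (w1_punctured aphi dp) (near_dom dp) => q h1 dq qp.
  by rewrite /poles /= (form_quotientE aphi dq) (negbTE (h1 qp)).
move=> M; rewrite near_withinE.
pose n := cmod (w0 phi p); have n0 : 0 < n by rewrite cmod_gt0.
pose M' := `|M| + 1; have M'0 : 0 < M' by rewrite ltr_wpDl.
have n2 : 0 < n / 2 by rewrite divr_gt0.
(* Near the pole |w0| >= n / 2 and |w1| < n / (2 M'), so the quotient is at least M', which exceeds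
   M. *)
have nM : 0 < n / (2 * M') by rewrite divr_gt0 // mulr_gt0.
have /contCP/(_ _ n2) k0 := form_cont hw0 aphi dp.
have /contCP/(_ _ nM) k1 := form_cont hw1 aphi dp.
apply: filterS2 (filterI k0 k1) (filterI (w1_punctured aphi dp) (near_dom dp)).
move=> q [q0 q1] [h1 dq] qp; rewrite cmodE -[M%:C]/(rc M) ler_rc.
rewrite z1 subr0 in q1.
have nzq : 0 < cmod (w1 phi q) by rewrite cmod_gt0 h1.
rewrite /finite_part (form_quotientE aphi dq) (negbTE (h1 qp)) /= cmodM cmodV.
rewrite ler_pdivlMr //.
have a1 : n / 2 <= cmod (w0 phi q).
  have := cmod_sub (w0 phi p) (w0 phi q).
  by rewrite [cmod (_ - _)]cmodC -/n; move: q0; lra.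
apply: le_trans a1.
have a2 : M * cmod (w1 phi q) <= M' * cmod (w1 phi q).
  by rewrite ler_wpM2r ?cmod_ge0 // /M'; have := ler_norm M; lra.
apply: (le_trans a2).
have : M' * cmod (w1 phi q) <= M' * (n / (2 * M')) by rewrite ler_wpM2l ?ltW.
move=> a3; apply: (le_trans a3); rewrite le_eqVlt; apply/orP; left; apply/eqP.
by field; rewrite gt_eqF.
Qed.

End Meromorphic.

End Quotient.

Section Converse.
Variable R : realType.
Local Notation C := (Cplx R).
Variables (S' S : riemannSurface R) (pr : S' -> S).
Hypothesis pr_universal : universal_cover pr.
Variable f : S -> 'rV[R]_3.

(* The coefficient of 2 (d/dz) f^k, computed from any local holomorphic function
   with real part f^k. *)
Definition coordinate_form (k : 'I_3) : one_form S := fun phi p =>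
  xget 0 [set d | exists2 h : S -> C,
    \forall q \near p, complex.Re (h q) = f q 0 k &
    cder (h \o ofC phi) (toC phi p) d].

Lemma coordinate_formE k phi p (h : S -> C) d : dom phi p ->
  (\forall q \near p, complex.Re (h q) = f q 0 k) ->
  cder (h \o ofC phi) (toC phi p) d -> coordinate_form k phi p = d.
Proof.
move=> dp hh hd; rewrite /coordinate_form; case: xgetP => [d' _ [h' hh' hd']|/(_ d)].
  apply: (Re_determines_derivative hd' hd).
  apply: filterS2 ((near_chart _ dp).1 hh) ((near_chart _ dp).1 hh') => z e1 e2.
  rewrite /= e1 e2 toCK //.
  by rewrite (nbhs_singleton hh) (nbhs_singleton hh').
by case; exists h.
Qed.

Variable F : S' -> 'rV[C]_3.
Hypothesis F_lift : holomorphic_lift pr f F.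
Hypothesis F_oriented : forall p phi, atlas phi -> dom phi p ->
  differential (component F 1) phi p - 'i%C * differential (component F 2) phi p = 0.

Lemma component_cder k x phi : atlas phi -> dom phi x ->
  cder (component F k \o ofC phi) (toC phi x) (differential (component F k) phi x).
Proof.
move=> aphi dx; have [[hol _] _ _ _] := F_lift.
by apply: derivable_cder; exact: nbhs_singleton (hol k x phi aphi dx).
Qed.

Lemma section_germ k x : exists P, [/\ primitive_germ (coordinate_form k) (pr x) P,
  \forall q \near pr x, complex.Re (P q) = f q 0 k &
  \forall y \near x, P (pr y) = component F k y].
Proof.
have [sec [U [nU sx prsec near_sec hsec]]] := local_section pr_universal x.
have [_ _ _ fF] := F_lift.
have ReU q : U q -> complex.Re ((component F k \o sec) q) = f q 0 k.
  by move=> Uq; rewrite -{2}(prsec q Uq) fF mxE.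
exists (component F k \o sec); split.
- have := nbhs_interior nU; apply: filterS => q nUq phi aphi dq.
  have [apsi dpsi] := chart_atP (sec q).
  have hd := map_cder hsec (nbhs_singleton nUq) aphi apsi dq dpsi
    (component_cder k apsi dpsi).
  rewrite (coordinate_formE dq _ hd); first exact: hd.
  by apply: filterS nUq => r; exact: ReU.
- by apply: filterS nU => q; exact: ReU.
- by apply: filterS near_sec => y /= ->.
Qed.

Lemma coordinate_form_differential x phi psi : atlas phi -> atlas psi ->
  dom phi (pr x) -> dom psi x -> forall k,
  differential (component F k) psi x =
    coordinate_form k phi (pr x) * map_derivative pr psi phi x.
Proof.
move=> aphi apsi dx dx' k; have [P [hP _ PE]] := section_germ k x.
have [_ hpr _ _] := pr_universal.
apply: cder_uniq (component_cder k apsi dx') _.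
have := map_cder hpr I apsi aphi dx' dx (nbhs_singleton hP _ aphi dx).
move=> h; apply: cder_near h _.
by apply: filterS ((near_chart _ dx').1 PE) => z /= ->.
Qed.

Lemma coordinate_germ k q : exists P, primitive_germ (coordinate_form k) q P /\
  \forall p \near q, complex.Re (P p) = f p 0 k.
Proof.
have [_ _ surj _] := pr_universal; have [x <-] := surj q.
by have [P [h1 h2 _]] := section_germ k x; exists P.
Qed.

Lemma coordinate_form_holomorphic k : holomorphic_form (coordinate_form k).
Proof.
apply: primitives_holomorphic => q; have [P [h _]] := coordinate_germ k q.
by exists P.
Qed.

Lemma coordinate_form2 p phi : atlas phi -> dom phi p ->
  coordinate_form 2 phi p = - 'i%C * coordinate_form 1 phi p.
Proof.
move=> aphi; have [_ _ surj _] := pr_universal; have [x <-] := surj p => dp.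
have [psi [apsi dx]] := atlas_cover x.
have E := coordinate_form_differential aphi apsi dp dx.
have d0 := cover_derivative_neq0 pr_universal apsi aphi dx dp.
have i2 : 'i%C * 'i%C = -1 :> C by exact: iiE.
have := F_oriented apsi dx; rewrite !E.
set m := map_derivative _ _ _ _ in d0 *.
set a := coordinate_form 1 _ _; set b := coordinate_form 2 _ _.
have -> : a * m - 'i%C * (b * m) = (a - 'i%C * b) * m by ring.
move=> /eqP; rewrite mulf_eq0 (negbTE d0) orbF subr_eq0 => /eqP ->.
have -> : - 'i%C * ('i%C * b) = - ('i%C * 'i%C) * b by ring.
by rewrite i2 opprK mul1r.
Qed.

(** At a common zero the third form vanishes too, so the differential of F upstairs is zero and
    sends 1 and 0 to the same vector. *)
Lemma coordinate_forms_no_common_zero p phi : atlas phi -> dom phi p ->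
  ~ (coordinate_form 0 phi p = 0 /\ coordinate_form 1 phi p = 0).
Proof.
move=> aphi; have [_ _ surj _] := pr_universal; have [x <-] := surj p => dp [e0 e1].
have e2 : coordinate_form 2 phi (pr x) = 0.
  by rewrite coordinate_form2 // e1 mulr0.
have [psi [apsi dx]] := atlas_cover x.
have E := coordinate_form_differential aphi apsi dp dx.
have [[_ inj] _ _ _] := F_lift.
have row0 : \row_k differential (component F k) psi x = 0.
  apply/rowP => k; rewrite [LHS]mxE [RHS]mxE E.
  suff -> : coordinate_form k phi (pr x) = 0 by rewrite mul0r.
  case: k => -[|[|[|m]]] hk; last by exfalso; move: hk.
  - by rewrite -[RHS]e0; congr coordinate_form; apply: val_inj.
  - by rewrite -[RHS]e1; congr coordinate_form; apply: val_inj.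
  - by rewrite -[RHS]e2; congr coordinate_form; apply: val_inj.
have := inj x psi apsi dx 1 0; rewrite row0 !scaler0 => /(_ erefl) /eqP.
by rewrite oner_eq0.
Qed.

Lemma coordinate_form1_neq0 :
  ~ (forall p phi, atlas phi -> dom phi p -> coordinate_form 1 phi p = 0).
Proof.
move=> z; have [_ _ [x [y /eqP ne]] _] := F_lift; apply: ne.
apply: locally_constant => {}x; have [P [hP _ PE]] := section_germ 1 x.
have h0 : primitive_germ (coordinate_form 1) (pr x) (fun=> 0).
  by apply: nearW => q phi aphi dq; rewrite z //; exact: cder_cst.
have h : \forall y \near x, P (pr y) - P (pr x) = 0 - 0.
  exact: cover_continuous pr_universal x _ (primitive_germ_unique hP h0).
have e := nbhs_singleton PE.
apply: filterS2 h PE => {}y; rewrite e subrr => + E; rewrite E => /eqP.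
by rewrite subr_eq0 => /eqP.
Qed.

(** Along c the real part of a continuation grows exactly as f^k does; closed curves then have
    periods with zero real part because f lives on S. *)
Lemma coordinate_integral k c : piecewise_C1 c ->
  complex.Re (line_integral c (coordinate_form k)) = f (c 1) 0 k - f (c 0) 0 k.
Proof.
move=> hc; have pc := piecewise_C1_unit_path hc.
have hw := coordinate_form_holomorphic k.
have [u hu] := continuation_exists (fun x => primitive_germ_exists x hw)
  (@primitive_germ_near _ _ _) (@primitive_germ_unique _ _ _) pc.
rewrite (line_integral_continuation hw hc hu).
apply: (@cousin R 0 1 (fun a b => complex.Re (u b - u a) = f (c b) 0 k - f (c a) 0 k)).
- exact: ler01.
- move=> a b d _ _ _ _ h1 h2.
  have -> : u d - u a = (u b - u a) + (u d - u b) by ring.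
  by rewrite cReD h1 h2; ring.
move=> t tI; have [P [hP ReP]] := coordinate_germ k (c t).
have [r r0 hr] := continuation_germ (@primitive_germ_unique _ _ _) pc hu tI hP.
have [r' r'0 hr'] := pc t tI _ ReP.
have one s : 0 <= s <= 1 -> `|s - t| < Num.min r r' ->
    complex.Re (u s - u t) = f (c s) 0 k - f (c t) 0 k.
  move=> sI; rewrite lt_min => /andP[s1 s2].
  by rewrite (hr s sI s1) cReB (hr' s sI s2) (nbhs_singleton ReP).
exists (Num.min r r') => [|a b a0 at_ tb b1 ba]; first by rewrite lt_min r0.
have ha := one a _ _; have hb := one b _ _.
have -> : u b - u a = (u b - u t) - (u a - u t) by ring.
rewrite cReB ha ?hb; first by ring.
- by case/andP: tI => *; apply/andP; split; lra.
- by rewrite ger0_norm ?subr_ge0 //; lra.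
- by case/andP: tI => *; apply/andP; split; lra.
- by rewrite ler0_norm ?subr_le0 //; lra.
Qed.

Theorem exists_weierstrass_data p0 : exists (g : S -> option C) (w : one_form S),
  [/\ meromorphic g, holomorphic_form w, condition_C g w, condition_P g w &
      exists a : 'rV[R]_3, is_weierstrass_map g w p0 a f].
Proof.
pose g := form_quotient (coordinate_form 0) (coordinate_form 1).
have h0 := coordinate_form_holomorphic 0.
have h1 := coordinate_form_holomorphic 1.
have mulE phi p : atlas phi -> dom phi p ->
    coordinate_form 0 phi p = mul_form g (coordinate_form 1) phi p.
  move=> aphi dp; apply/esym.
  exact: (form_quotient_mul h0 h1 coordinate_form1_neq0 aphi dp).
have scaleE phi p : atlas phi -> dom phi p ->
    coordinate_form 2 phi p = scale_form (- 'i%C) (coordinate_form 1) phi p.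
  by move=> aphi dp; rewrite coordinate_form2.
have loop0 c k : piecewise_C1 c -> c 0 = c 1 ->
    complex.Re (line_integral c (coordinate_form k)) = 0.
  by move=> hc E; rewrite coordinate_integral // E subrr.
exists g, (coordinate_form 1); split.
- exact: (form_quotient_meromorphic h0 h1 coordinate_forms_no_common_zero
    coordinate_form1_neq0).
- exact: h1.
- split; first exact: eq_form_holomorphic mulE h0.
  move=> p phi aphi dp [e1 e0]; apply: (coordinate_forms_no_common_zero aphi dp).
  by split; [rewrite mulE|].
- move=> c hc loop; split.
    by rewrite -(eq_form_integral c mulE); exact: loop0.
  (* The real part of the integral of - i w is the imaginary part of that of w, so the components 1
     and 2 together give the full period condition on w. *)
  have r1 := loop0 c 1 hc loop; have := loop0 c 2 hc loop.
  rewrite (eq_form_integral c scaleE) (line_integral_scale _ h1 hc) cReM /=.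
  rewrite oppr0 mul0r sub0r mulN1r opprK => i1.
  by apply: cP; rewrite ?r1 ?i1.
exists (f p0); move=> p c hc c0 c1.
have E k : line_integral c (weierstrass_forms g (coordinate_form 1) k) =
    line_integral c (coordinate_form k).
  rewrite weierstrass_formsE; case: k => -[|[|[|m]]] hk; last by exfalso; move: hk.
  - rewrite [X in line_integral _ X]/= -(eq_form_integral c mulE).
    by apply: (congr1 (fun j => line_integral c (coordinate_form j))); apply: val_inj.
  - by apply: (congr1 (fun j => line_integral c (coordinate_form j))); apply: val_inj.
  - rewrite [X in line_integral _ X]/= -(eq_form_integral c scaleE).
    by apply: (congr1 (fun j => line_integral c (coordinate_form j))); apply: val_inj.
apply/rowP => k; rewrite add_row_coef E coordinate_integral // c0 c1.
by rewrite addrC subrK.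
Qed.

End Converse.

Theorem proposition2p4 (R : realType) (S' S : riemannSurface R)
    (pr : S' -> S) (pr_universal : universal_cover pr) (p0 : S) :
  (forall (g : S -> option (Cplx R)) (w : one_form S),
     meromorphic g -> holomorphic_form w ->
     condition_C g w -> condition_P g w ->
     forall a : 'rV[R]_3,
       (exists! f : S -> 'rV[R]_3, is_weierstrass_map g w p0 a f) /\
       (forall f : S -> 'rV[R]_3,
          is_weierstrass_map g w p0 a f -> oriented_ZMC_face pr f)) /\
  (forall f : S -> 'rV[R]_3, oriented_ZMC_face pr f ->
     exists (g : S -> option (Cplx R)) (w : one_form S),
       [/\ meromorphic g, holomorphic_form w,
           condition_C g w, condition_P g w &
           exists a : 'rV[R]_3, is_weierstrass_map g w p0 a f]).
Proof.
split=> [g w _ hw hC hP a|f [[F F_lift] F_oriented]].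
  split; first exact: weierstrass_map_exists.
  by move=> f; exact: weierstrass_map_oriented.
exact: exists_weierstrass_data F_lift (F_oriented F F_lift) p0.
Qed.
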